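(* For every $\nu\in\mathcal{P}(\mathbb{R}^d)$, the metric space $(\mathcal{P}_{2,\nu}(\mathbb{R}^{2d}),W_{2,\nu})$ is Polish, i.e., a complete and separable metric space.
   Context: Points of $\mathbb{R}^{2d}$ are written $(x,\omega)$ with $x,\omega\in\mathbb{R}^d$. $\mathcal{P}_{2,\nu}(\mathbb{R}^{2d})$ is the set of Borel probability measures $\mu$ on $\mathbb{R}^{2d}$ whose marginal in $\omega$ is $\nu$ and with $\int_{\mathbb{R}^{2d}}|x|^2d\mu(x,\omega)<\infty$ (no moment condition in $\omega$). Each such $\mu$ has a $\nu$-a.e. unique disintegration $\mu(x,\omega)=\mu^\omega(x)\otimes\nu(\omega)$ with $\mu^\omega\in\mathcal{P}_2(\mathbb{R}^d)$ for $\nu$-a.e. $\omega$. The distance is $W_{2,\nu}(\mu_1,\mu_2)=\left(\int_{\mathbb{R}^d}W_2^2(\mu_1^\omega,\mu_2^\omega)\,d\nu(\omega)\right)^{1/2}$, where $W_2$ is the quadratic Wasserstein distance on $\mathcal{P}_2(\mathbb{R}^d)$. *)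

(* Defs.v *)
From HB Require Import structures.
From mathcomp Require Import all_boot all_order all_algebra.
From mathcomp Require Import all_classical all_reals all_analysis.

Set Implicit Arguments.
Unset Strict Implicit.
Unset Printing Implicit Defensive.

Import Order.TTheory GRing.Theory Num.Theory.
Import numFieldNormedType.Exports.

Local Open Scope classical_set_scope.
Local Open Scope ring_scope.
Local Open Scope ereal_scope.

(* R^d is [d.-tuple R] and R^2d, with points (x, omega), is
   [d.-tuple R * d.-tuple R].  Both carry the product sigma-algebra of the
   Borel sigma-algebra of R, which is the Borel sigma-algebra of R^d and R^2d
   since R is second countable. *)

Section Wasserstein.
Context {R : realType} {d : nat}.
Local Notation Rd := (d.-tuple R).
Implicit Type m : {measure set Rd -> \bar R}.

Definition enorm2 (x : Rd) : R := (\sum_(i < d) tnth x i ^+ 2)%R.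

Definition edist2 (x y : Rd) : R :=
  (\sum_(i < d) (tnth x i - tnth y i) ^+ 2)%R.

Definition coupling m1 m2 : set (probability (Rd * Rd)%type R) :=
  [set g | forall A, measurable A ->
     pushforward g fst A = m1 A /\ pushforward g snd A = m2 A].

(* The arguments are arbitrary measures because the values of a probability
   kernel are typed as such; W2 is only meant for probability measures. *)
Definition W2 m1 m2 : \bar R :=
  sqrte (ereal_inf
    [set \int[g]_p (edist2 p.1 p.2)%:E | g in coupling m1 m2]).

End Wasserstein.

Section P2nu.
Context {R : realType} {d : nat}.
Local Notation Rd := (d.-tuple R).
Variable nu : probability Rd R.

Record P2nu := {
  P2nu_measure :> probability (Rd * Rd)%type R ;
  P2nu_marginal : forall B, measurable B ->
    pushforward P2nu_measure snd B = nu B ;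
  P2nu_moment : \int[P2nu_measure]_p (enorm2 p.1)%:E < +oo }.

(* A library measure is a function on all sets, constrained only on the
   measurable ones: equality of measures is equality on measurable sets. *)
Definition same_measure (mu1 mu2 : P2nu) : Prop :=
  forall A, measurable A -> mu1 A = mu2 A.

(* [k omega] is mu^omega. *)
Definition is_disintegration (mu : P2nu) (k : R.-pker Rd ~> Rd) : Prop :=
  forall A B, measurable A -> measurable B ->
    mu (A `*` B) = \int[nu]_(w in B) k w A.

(* A choice of disintegration.  Every mu has one, unique nu-a.e., so the
   default value (the constant kernel nu) is never used and W2nu does not
   depend on the choice. *)
Definition disintegration (mu : P2nu) : R.-pker Rd ~> Rd :=
  if pselect (exists k, is_disintegration mu k) is left mu_k
  then sval (cid mu_k)
  else kprobability (measurable_cst (nu : pprobability Rd R)).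

Definition W2nu (mu1 mu2 : P2nu) : \bar R :=
  sqrte (\int[nu]_w (W2 (disintegration mu1 w) (disintegration mu2 w) ^+ 2)).

End P2nu.

Definition complete_space {R : realType} (M : metricType R) : Prop :=
  forall F : set_system M, ProperFilter F -> cauchy F -> exists l : M, F --> l.

Definition separable_space {R : realType} (M : metricType R) : Prop :=
  exists2 D : set M, countable D & dense D.

(* M is the metric space of points of T, identified along eqT, with distance
   D; the distance of M being real-valued, D is then finite. *)
Definition is_metric_quotient {R : realType} {T : Type}
    (eqT : T -> T -> Prop) (D : T -> T -> \bar R)
    (M : metricType R) (pi : T -> M) : Prop :=
  [/\ forall m, exists x, pi x = m,
      forall x y, pi x = pi y <-> eqT x y &
      forall x y, D x y = (mdist (pi x) (pi y))%:E].

(* Main.v *)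
(* Every mu in P_{2,nu} is the law of (H(w, u), w) under nu x lam, for lam uniform
   on [0, 1] and some square-integrable H.  By Birkhoff's theorem applied to step
   functions, W_2^2 between the laws of h1 and h2 under lam is the infimum of
   ||h1 - h2 o s||^2 over the permutations s of finitely many equal subintervals of
   [0, 1].  These s form a countable family, so an almost optimal s can be chosen
   measurably in w: W_{2,nu}(mu1, mu2) is the infimum of ||H1 - H2|| over the
   representations H2 of mu2, whichever representation H1 of mu1 is fixed.
   Hence P_{2,nu} inherits the triangle inequality, completeness (fast Cauchy
   sequences have fast Cauchy representations) and separability from L^2(nu x lam). *)

Require Import Defs.
From HB Require Import structures.
From mathcomp Require Import all_boot all_order all_algebra fingroup perm.
Set Implicit Arguments.
Unset Strict Implicit.
Unset Printing Implicit Defensive.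
Import Order.TTheory GRing.Theory Num.Theory.

(** * Birkhoff's theorem on doubly stochastic matrices *)

(** [W2nu] integrates [W2 ^+ 2] along a disintegration chosen without any control, and a direct
    argument would need optimal couplings of the fibers that depend measurably on [w]. Neither the
    measurability of the integrand nor such a selection comes for free. A countable family of
    rearrangements settles both: a countable infimum is measurable, and the first almost optimal
    index is a measurable choice. The passage from couplings to rearrangements rests on two facts. A
    coupling of the laws of [h1] and [h2] lifts to a coupling of two uniform variables whose images
    under [h1] and [h2] are the coupled variables. The cells into which these uniform variables fall
    have, up to scaling, a doubly stochastic joint law, and some permutation costs no more than it
    does. The infimum need not be attained. Hence every argument carries a slack, and
    [W2nu mu1 mu2 = 0] does not provide a common representation: separation of points needs a limit.
    The maps [H] are quantile transforms of conditional laws, after a measurable coding of [R^d] in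
    [[0, 1]]. *)

Section hall.
Variables (I J : finType).
Implicit Types (A : I -> {set J}) (S : {set I}).

Definition neighbors A S := \bigcup_(i in S) A i.

Lemma neighborsU A S S' : neighbors A (S :|: S') = neighbors A S :|: neighbors A S'.
Proof. exact: bigcup_setU. Qed.

Lemma neighborsS A S S' : S \subset S' -> neighbors A S \subset neighbors A S'.
Proof. by move=> SS'; rewrite -(setUidPr SS') neighborsU subsetUl. Qed.

Lemma neighbors1 A i : neighbors A [set i] = A i.
Proof. exact: big_set1. Qed.

Let drop A i0 x := fun i => if i == i0 then A i :\ x else A i.

Let drop_neighbors A i0 x S : i0 \in S ->
  neighbors A (S :\ i0) :|: (A i0 :\ x) \subset neighbors (drop A i0 x) S.
Proof.
move=> i0S; rewrite -[X in _ \subset neighbors _ X](setD1K i0S).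
rewrite neighborsU neighbors1 /drop eqxx setUC setUS//.
apply/bigcupsP => i iS; apply: (subset_trans _ (bigcup_sup i iS)).
by move: iS; rewrite !inE => /andP[/negbTE ->].
Qed.

Let drop_neighborsN A i0 x S : i0 \notin S ->
  neighbors (drop A i0 x) S = neighbors A S.
Proof.
move=> i0S; apply: eq_bigr => i iS; rewrite /drop ifN//.
by apply: contraNneq i0S => <-.
Qed.

(* If neither [x] nor [y] could be removed from [A i0], the two violating sets would
   contradict submodularity of the number of neighbors. *)
Let hall_drop A i0 x y : x != y -> x \in A i0 -> y \in A i0 ->
  (forall S, #|S| <= #|neighbors A S|) ->
  (forall S, #|S| <= #|neighbors (drop A i0 x) S|) \/
  (forall S, #|S| <= #|neighbors (drop A i0 y) S|).
Proof.
move=> xy xA yA hA.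
have [/forallP|/forallPn[S]] := boolP
  [forall S : {set I}, #|S| <= #|neighbors (drop A i0 x) S|]; first by left.
have [/forallP|/forallPn[S']] := boolP
  [forall S : {set I}, #|S| <= #|neighbors (drop A i0 y) S|]; first by right.
rewrite -!ltnNge => S'y Sx; exfalso.
have i0S : i0 \in S.
  by apply: contraTT Sx => i0S; rewrite drop_neighborsN// -leqNgt.
have i0S' : i0 \in S'.
  by apply: contraTT S'y => i0S'; rewrite drop_neighborsN// -leqNgt.
pose P := S :\ i0; pose Q := S' :\ i0.
pose X := neighbors A P :|: (A i0 :\ x).
pose Y := neighbors A Q :|: (A i0 :\ y).
have cX : #|X| <= #|P|.
  have := leq_ltn_trans (subset_leq_card (drop_neighbors A x i0S)) Sx.
  by rewrite (cardsD1 i0 S) i0S.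
have cY : #|Y| <= #|Q|.
  have := leq_ltn_trans (subset_leq_card (drop_neighbors A y i0S')) S'y.
  by rewrite (cardsD1 i0 S') i0S'.
(* Since [x != y], the union [X :|: Y] contains all of [A i0]. Hall's condition for
   [i0 |: (P :|: Q)] thus gains the one unit that yields the contradiction. *)
have cU : #|P :|: Q|.+1 <= #|X :|: Y|.
  have -> : #|P :|: Q|.+1 = #|i0 |: (P :|: Q)|.
    by rewrite cardsU1 !inE eqxx.
  apply: (leq_trans (hA _)); apply: subset_leq_card.
  rewrite !neighborsU neighbors1 !subUset; apply/and3P; split.
  - apply/subsetP => z zA; rewrite !inE zA !andbT.
    have [->|_] := eqVneq z x; first by rewrite xy !orbT.
    by rewrite !orbT.
  - by rewrite /X -setUA subsetUl.
  - by rewrite /Y (setUC X) -setUA subsetUl.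
have cI : #|P :&: Q| <= #|X :&: Y|.
  apply: (leq_trans (hA _)); apply: subset_leq_card.
  rewrite subsetI; apply/andP; split.
    by apply: (subset_trans (neighborsS A (subsetIl _ _))); exact: subsetUl.
  by apply: (subset_trans (neighborsS A (subsetIr _ _))); exact: subsetUl.
have := leq_add cU cI; rewrite addSn !cardsUI.
by rewrite ltnNge leq_add.
Qed.

Lemma hall A : (forall S, #|S| <= #|neighbors A S|) ->
  exists2 f : I -> J, injective f & forall i, f i \in A i.
Proof.
have [m] := ubnP (\sum_i #|A i|); elim: m A => // m ih A Am hA.
have [/forallP sA|/forallPn[i0]] := boolP [forall i, #|A i| <= 1]; last first.
  rewrite -ltnNge => /card_gt1P[x [y [xA yA xy]]].
  have dropm z : z \in A i0 -> \sum_i #|drop A i0 z i| < m.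
    move=> zA; rewrite -ltnS (leq_trans _ Am)// ltnS.
    rewrite (bigD1 i0)//= [in ltnRHS](bigD1 i0)//= /drop eqxx.
    rewrite (cardsD1 z (A i0)) zA add1n addSn ltnS leq_add2l.
    by apply: leq_sum => i /negbTE ->.
  have dropA z i : drop A i0 z i \subset A i.
    by rewrite /drop; case: ifP => // _; rewrite subsetDl.
  have [h|h] := hall_drop xy xA yA hA.
    have [f fi fA] := ih _ (dropm _ xA) h; exists f => // i.
    exact: (subsetP (dropA x i)).
  have [f fi fA] := ih _ (dropm _ yA) h; exists f => // i.
  exact: (subsetP (dropA y i)).
have A1 i : exists j, A i == [set j].
  suff /cards1P[j ->] : #|A i| == 1 by exists j.
  rewrite eqn_leq sA/=.
  by have := hA [set i]; rewrite neighbors1 cards1.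
pose f i := xchoose (A1 i); have fE i : A i = [set f i].
  exact/eqP/(xchooseP (A1 i)).
exists f; last by move=> i; rewrite fE inE.
move=> i i' ff; apply/eqP; apply/negPn/negP => ii'.
have := hA [set i; i'].
by rewrite neighborsU !neighbors1 !fE ff setUid cards1 cards2 ii'.
Qed.

End hall.

Section birkhoff.
Local Open Scope ring_scope.
Context {R : realFieldType}.

(** Induction on the number of nonzero entries; the common sum [s] is free because it decreases.
    Hall's theorem puts a permutation [tau] in the support of [p]. Subtracting [tau] with its
    smallest entry [t] as weight kills an entry and leaves sums [s - t]. The cost splits
    accordingly, so the cheaper of [tau] and the permutation given by induction works. *)
Lemma birkhoff_le (n : nat) (c p : 'I_n -> 'I_n -> R) (s : R) :
  (forall i j, 0 <= p i j) ->
  (forall i, \sum_j p i j = s) -> (forall j, \sum_i p i j = s) ->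
  exists sigma : 'S_n, s * (\sum_i c i (sigma i)) <= \sum_i \sum_j c i j * p i j.
Proof.
have [n0|n0] := posnP n.
  by subst n; exists 1%g; rewrite !big_ord0 mulr0.
pose i0 := Ordinal n0.
have [m] := ubnP #|[set ij : 'I_n * 'I_n | p ij.1 ij.2 != 0]|.
elim: m p s => // m ih p s pm p0 ps ps'.
have [s0|s0] := leP s 0.
  have p_0 i j : p i j = 0.
    apply/eqP; rewrite eq_le p0 andbT (le_trans _ s0)// -(ps i).
    by rewrite (bigD1 j)//= lerDl sumr_ge0.
  exists 1%g; rewrite (_ : s = 0) ?mul0r; last first.
    by apply/eqP; rewrite eq_le s0 -(ps i0) sumr_ge0.
  by rewrite big1// => i _; rewrite big1// => j _; rewrite p_0 mulr0.
pose A i : {set 'I_n} := [set j | p i j != 0].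
(* The rows in [S] have total mass [#|S| * s], all of it in the columns of [neighbors A S], whose
   total mass is [#|neighbors A S| * s]. *)
have hA (S : {set 'I_n}) : (#|S| <= #|neighbors A S|)%N.
  rewrite -(ler_nat R) -(ler_pM2r s0).
  have -> : #|S|%:R * s = \sum_(i in S) \sum_j p i j.
    by under eq_bigr do rewrite ps; rewrite sumr_const mulr_natl.
  have -> : #|neighbors A S|%:R * s = \sum_(j in neighbors A S) \sum_i p i j.
    by under eq_bigr do rewrite ps'; rewrite sumr_const mulr_natl.
  rewrite exchange_big/= [leLHS](bigID (mem (neighbors A S)))/=.
  rewrite [X in _ + X]big1 ?addr0; last first.
    move=> j jS; rewrite big1// => i iS; apply/eqP; apply: contraNT jS => pij.
    by apply/bigcupP; exists i => //; rewrite inE.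
  apply: ler_sum => j _; rewrite [leRHS](bigID (mem S))/= lerDl.
  by apply: sumr_ge0 => i _.
have [f fi fA] := hall hA.
pose tau : 'S_n := perm fi.
have pt i : 0 < p i (tau i).
  by rewrite lt_neqAle p0 andbT eq_sym permE; have := fA i; rewrite inE.
pose k := [arg min_(i < i0) p i (tau i)]%O.
have kP i : p k (tau k) <= p i (tau i).
  by rewrite /k; case: arg_minP => // j _; apply.
pose t := p k (tau k).
pose p' i j := p i j - t * (j == tau i)%:R.
have st : 0 <= s - t.
  by rewrite subr_ge0 -(ps k) (bigD1 (tau k))//= lerDl sumr_ge0.
have pE i j : p i j = p' i j + t * (j == tau i)%:R by rewrite /p' subrK.
have sdr i : \sum_j t * (j == tau i)%:R = t.
  rewrite (bigD1 (tau i))//= eqxx mulr1 big1 ?addr0// => j /negbTE ->.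
  by rewrite mulr0.
have sdc j : \sum_i t * (j == tau i)%:R = t.
  rewrite (bigD1 (tau^-1 j)%g)//= permKV eqxx mulr1 big1 ?addr0// => i ij.
  rewrite (_ : (j == tau i) = false) ?mulr0//; apply: contraNF ij => /eqP ->.
  by rewrite permK.
have [|i j|i|j|sigma sigmaP] := ih p' (s - t).
- rewrite -ltnS (leq_trans _ pm)// ltnS; apply: proper_card.
  apply/properP; split.
    apply/subsetP => -[i j]; rewrite !inE/=; apply: contraNN => /eqP pij.
    rewrite /p' pij; have [jt|_] := eqVneq j (tau i); last by rewrite mulr0 subr0.
    by have := pt i; rewrite -jt pij ltxx.
  exists (k, tau k); rewrite !inE/=; first by rewrite gt_eqF.
  by rewrite /p' eqxx mulr1 subrr negbK.
- rewrite /p'; case: eqP => [->|_]; last by rewrite mulr0 subr0.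
  by rewrite mulr1 subr_ge0.
- by rewrite /p' sumrB ps sdr.
- by rewrite /p' sumrB ps' sdc.
have -> : \sum_i \sum_j c i j * p i j =
    \sum_i \sum_j c i j * p' i j + t * \sum_i c i (tau i).
  rewrite mulr_sumr -big_split/=; apply: eq_bigr => i _.
  under eq_bigr do rewrite pE mulrDr.
  rewrite big_split/=; congr +%R.
  rewrite (bigD1 (tau i))//= eqxx mulr1 mulrC big1 ?addr0// => j /negbTE ->.
  by rewrite !mulr0.
have t0 : 0 <= t by exact: ltW (pt k).
have [tausigma|/ltW sigmatau] := leP (\sum_i c i (tau i)) (\sum_i c i (sigma i)).
  exists tau; rewrite -[X in X * _](subrK t) mulrDl lerD2r.
  by rewrite (le_trans _ sigmaP)// ler_wpM2l.
exists sigma; rewrite -[X in X * _](subrK t) mulrDl lerD// ler_wpM2l//.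
Qed.

End birkhoff.

From mathcomp Require Import all_classical all_reals all_analysis.
From mathcomp Require Import measurable_realfun ring lra.
Import numFieldNormedType.Exports.
Local Open Scope classical_set_scope.
Local Open Scope ring_scope.
Local Open Scope ereal_scope.

(** * Laws of measurable maps on [0, 1] *)

Section laws.
Context {R : realType}.

Definition law d1 d2 (T1 : measurableType d1) (T2 : measurableType d2)
    (P : probability T1 R) (f : T1 -> T2) (mf : measurable_fun setT f) :
    probability T2 R :=
  distribution P (mfun_Sub (mem_set mf)).

Lemma lawE d1 d2 (T1 : measurableType d1) (T2 : measurableType d2)
    (P : probability T1 R) (f : T1 -> T2) (mf : measurable_fun setT f) A :
  law P mf A = P (f @^-1` A).
Proof. by []. Qed.

Lemma ge0_integral_law d1 d2 (T1 : measurableType d1) (T2 : measurableType d2)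
    (P : probability T1 R) (f : T1 -> T2) (mf : measurable_fun setT f)
    (h : T2 -> \bar R) : measurable_fun setT h -> (forall x, 0 <= h x) ->
  \int[law P mf]_x h x = \int[P]_x h (f x).
Proof.
move=> mh h0; by rewrite ge0_integral_pushforward// => x _; exact: h0.
Qed.

(** The uniform probability lives on the copy [measurableTypeR R] of the line; the identity moves it
    to [R]. *)
Lemma measurable_id_R : measurable_fun setT (idfun : measurableTypeR R -> R).
Proof. by move=> _ A mA; rewrite setTI. Qed.

Definition lam : probability R R :=
  law (uniform_prob (@ltr01 R)) measurable_id_R.

Lemma lamE (A : set R) : measurable A -> lam A = lebesgue_measure (A `&` `[0%R, 1%R]%classic).
Proof.
move=> mA; rewrite lawE preimage_id -(setIT A) -integral_indic//.
rewrite integral_uniform//=; last first.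
  by apply/measurable_EFinP; exact: measurable_indic.
by rewrite subr0 invr1 mul1e integral_indic// setIT.
Qed.

Lemma lam_itv (a b : R) : (0 <= a)%R -> (b <= 1)%R -> (a <= b)%R ->
  lam `]a, b]%classic = (b - a)%:E.
Proof.
move=> a0 b1 ab; rewrite lamE// (_ : _ `&` _ = `]a, b]%classic); last first.
  apply/seteqP; split => x /=; rewrite !in_itv/=; first by case.
  by move=> /andP[? ?]; split; lra.
rewrite lebesgue_measure_itv/= lte_fin; case: ltgtP ab => // -> _.
by rewrite subrr.
Qed.

Lemma lam_itvoo (a b : R) : (0 <= a)%R -> (b <= 1)%R -> (a <= b)%R ->
  lam `[a, b[%classic = (b - a)%:E.
Proof.
move=> a0 b1 ab; rewrite lamE// (_ : _ `&` _ = `[a, b[%classic); last first.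
  apply/seteqP; split => x /=; rewrite !in_itv/=; first by case.
  by move=> /andP[? ?]; split; lra.
rewrite lebesgue_measure_itv/= lte_fin; case: ltgtP ab => // -> _.
by rewrite subrr.
Qed.

Lemma lam_unit : lam `]0%R, 1%R]%classic = 1.
Proof. by rewrite lam_itv// subr0. Qed.

Lemma lam_unit_co : lam `[0%R, 1%R[%classic = 1.
Proof. by rewrite lam_itvoo// subr0. Qed.

Lemma prob_measureI_full d (T : measurableType d) (P : probability T R)
    (A B : set T) : measurable A -> measurable B -> P A = 1 ->
  P (B `&` A) = P B.
Proof.
move=> mA mB A1; have mCA := measurableC mA.
have mBC := measurableI _ _ mB mCA; rewrite -[in RHS](setIT B) -(setUv A) setIUr measureU//.
- rewrite [X in _ + X](_ : _ = 0) ?adde0//.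
  apply/eqP; rewrite eq_le measure_ge0 andbT.
  apply: (@le_trans _ _ (P (~` A))).
    by rewrite le_measure ?inE.
  by rewrite probability_setC// A1 subee.
- exact: measurableI.
- by rewrite setIACA setICr setI0.
Qed.

Lemma prob_eqR (P1 P2 : probability R R) :
  (forall t : R, P1 `]-oo, t[%classic = P2 `]-oo, t[%classic) ->
  forall A, measurable A -> P1 A = P2 A.
Proof.
move=> P12 A mA.
apply: (measure_unique (RGenInftyO.G (R:=R)) (fun n => `]-oo, n%:R[%classic)) => //.
- exact: RGenInftyO.measurableE.
- move=> _ _ [x ->] [y ->]; exists (Num.min x y); apply/seteqP.
  by split => z /=; rewrite !in_itv/= lt_min; [case=> -> ->|move/andP].
- by move=> i; exists i%:R.
- apply/seteqP; split => // x _.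
  exists (Num.truncn `|x|).+1 => //=; rewrite in_itv/=.
  by rewrite (le_lt_trans (ler_norm _))// truncnS_gt.
- by move=> _ [x ->]; exact: P12.
- move=> k; rewrite (le_lt_trans (probability_le1 P1 _))//.
  by rewrite ltry.
Qed.

End laws.
Global Opaque lam.

(** * Encoding of R^n into R *)

Section ternary_code.
Local Open Scope ring_scope.
Context {R : realType}.
Implicit Types b : nat -> bool.

(** Only the digits 0 and 2 occur, so the sums lie in the Cantor set, where the expansion is unique
    and can be read back measurably. *)
Definition ternary_term b : R^nat := fun n => (b n)%:R * 2 * 3^-1 ^+ n.+1.

Definition ternary b : R := limn (series (ternary_term b)).

Lemma ternary_term_ge0 b n : (0 <= ternary_term b n)%R.
Proof. by rewrite /ternary_term !mulr_ge0// exprn_ge0. Qed.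

Lemma ternary_series_le1 b n : (series (ternary_term b) n <= 1 - 3^-1 ^+ n)%R.
Proof.
elim: n => [|n ih]; first by rewrite /series/= big_geq// expr0 subrr.
rewrite seriesSr (le_trans (lerD ih (lexx _)))// /ternary_term exprS.
have : (0 <= 3^-1 ^+ n :> R)%R by rewrite exprn_ge0.
by move: (3^-1 ^+ n : R)%R => x; case: (b n) => /= ?; lra.
Qed.

Lemma ternary_cvg b : series (ternary_term b) @ \oo --> ternary b.
Proof.
rewrite /ternary; apply: nondecreasing_is_cvgn.
  by apply: nondecreasing_series => n _ _; exact: ternary_term_ge0.
exists 1 => _ [n _ <-]; by rewrite (le_trans (ternary_series_le1 _ _))// gerBl exprn_ge0.
Qed.

Lemma ternary_ge0 b : (0 <= ternary b)%R.
Proof.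
rewrite /ternary; apply: limr_ge; first exact: ternary_cvg.
apply: nearW => n.
by apply: sumr_ge0 => i _; exact: ternary_term_ge0.
Qed.

Lemma ternary_le1 b : (ternary b <= 1)%R.
Proof.
rewrite /ternary; apply: limr_le; first exact: ternary_cvg.
apply: nearW => n.
by rewrite (le_trans (ternary_series_le1 _ _))// gerBl exprn_ge0.
Qed.

Lemma ternary_rec b : ternary b = ((b 0)%:R * 2 / 3 + ternary (b \o S) / 3)%R.
Proof.
rewrite [LHS]/ternary; apply/cvg_lim => //.
rewrite -(cvg_shiftS (series _)).
have -> : (fun n => series (ternary_term b) n.+1) =
   (fun n => (b 0)%:R * 2 / 3 + series (ternary_term (b \o S)) n / 3)%R.
  apply/funext => n; rewrite /series/= big_nat_recl//; congr +%R.
  rewrite /= mulr_suml; apply: eq_bigr => i _.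
  by rewrite /ternary_term /= (exprSr _ i.+1) mulrA.
by apply: cvgD; [exact: cvg_cst|apply: cvgMl; exact: ternary_cvg].
Qed.

(** On the Cantor set a first digit 0 gives at most 1/3 and a first digit 2 at least 2/3, so
    comparing with 1/2 reads it. *)
Definition ternary_digit (r : R) : bool := (2^-1 <= r)%R.

Definition ternary_shift (r : R) : R := (3 * r - 2 * (ternary_digit r)%:R)%R.

Lemma ternary_digitE b : ternary_digit (ternary b) = b 0.
Proof.
rewrite /ternary_digit ternary_rec.
have := ternary_ge0 (b \o S); have := ternary_le1 (b \o S).
by case: (b 0) => /= ? ?; [apply/idP; lra|apply/negbTE; rewrite -ltNge; lra].
Qed.

Lemma ternary_shiftE b : ternary_shift (ternary b) = ternary (b \o S).
Proof. by rewrite /ternary_shift ternary_digitE ternary_rec; field. Qed.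

Lemma ternaryK b n : ternary_digit (iter n ternary_shift (ternary b)) = b n.
Proof.
elim: n b => [|n ih] b; first exact: ternary_digitE.
by rewrite iterSr ternary_shiftE ih.
Qed.

Lemma measurable_ternary_digit : measurable_fun setT ternary_digit.
Proof. by apply: measurable_fun_ler => //; exact: measurable_id. Qed.

Lemma measurable_ternary_shift : measurable_fun setT ternary_shift.
Proof.
apply: measurable_funB => //.
apply: measurable_funM => //.
apply: (@measurableT_comp _ _ _ _ _ _ (fun b : bool => b%:R : R)) => //.
exact: measurable_ternary_digit.
Qed.

Lemma measurable_ternary d (T : measurableType d) (b : T -> nat -> bool) :
  (forall n, measurable_fun setT (b ^~ n)) ->
  measurable_fun setT (ternary \o b).
Proof.
move=> mb; apply: (@measurable_fun_cvg _ _ _ setT (fun n x => series (ternary_term (b x)) n)).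
  move=> n; apply: measurable_sum => i; apply: measurable_funM => //.
  apply: measurable_funM => //.
  exact: (@measurableT_comp _ _ _ _ _ _ (fun b : bool => b%:R : R)).
by move=> x _; exact: ternary_cvg.
Qed.

End ternary_code.

Section encoding.
Local Open Scope ereal_scope.
Context {R : realType}.

(** A measurable embedding in [[0, 1]] with a measurable left inverse: laws on [T] become laws on
    the line, which have distribution and quantile functions. *)
Definition encoding d (T : measurableType d) (phi : T -> R) (psi : R -> T) :=
  [/\ measurable_fun setT phi, measurable_fun setT psi, cancel phi psi &
      forall x, (0 <= phi x <= 1)%R].

(** A point is coded by all the comparisons of its coordinates with rationals; [tuple_undigit]
    recovers a coordinate as the supremum of the rationals below it. *)
Definition tuple_digit n (x : n.-tuple R) (k : nat) : bool :=
  if unpickle k is Some iq then (ratr (iq : 'I_n * rat).2 < tnth x iq.1)%R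
  else false.

Definition tuple_undigit n (r : R) : n.-tuple R :=
  [tuple fine (ereal_sup [set (if @ternary_digit R (iter (pickle (i, q)) ternary_shift r)
     then (ratr q)%:E else -oo) | q in [set: rat]]) | i < n].

Lemma tuple_encoding n :
  encoding (fun x : n.-tuple R => ternary (tuple_digit x)) (@tuple_undigit n).
Proof.
split.
- apply: measurable_ternary => k; rewrite /tuple_digit.
  case: (unpickle k) => [[i q]|]; last exact: measurable_cst.
  by apply: measurable_fun_ltr => //; exact: measurable_tnth.
- apply/measurable_fun_tnthP => i.
  under [X in measurable_fun _ X]eq_fun do rewrite /= tnth_mktuple.
  apply: measurableT_comp; first exact: fine_measurable.
  have mq q : measurable_fun setT (fun r : R =>
     if @ternary_digit R (iter (pickle (i, q)) ternary_shift r)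
     then (ratr q)%:E else -oo : \bar R).
    apply: measurable_fun_if => //.
      apply: (@measurableT_comp _ _ _ _ _ _ (@ternary_digit R)) => //.
        exact: measurable_ternary_digit.
      elim: (pickle _) => [|k ih] /=; first exact: measurable_id.
      by apply: measurableT_comp => //; exact: measurable_ternary_shift.
  (* Enumerating the rationals turns the supremum into one over a sequence, whose measurability is
     known. *)
  pose h k r := if unpickle k is Some q then
     (if @ternary_digit R (iter (pickle (i, q)) ternary_shift r)
     then (ratr q)%:E else -oo : \bar R) else -oo.
  rewrite (_ : (fun x => _) = (fun x => esups (h ^~ x) 0%N)).
    apply: measurable_fun_esups => k; rewrite /h.
    by case: (unpickle k) => [q|]; [exact: mq|exact: measurable_cst].
  apply/funext => r; apply/eqP; rewrite eq_le; apply/andP; split.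
    apply: ge_ereal_sup => _ [q _ <-]; apply: ereal_sup_ubound => /=.
    by exists (pickle q) => //; rewrite /h pickleK.
  apply: ge_ereal_sup => _ [k _ <-]; rewrite /h.
  case: (unpickle k) => [q|]; last by rewrite leNye.
  by apply: ereal_sup_ubound => /=; exists q.
- move=> x; apply: eq_from_tnth => i; rewrite tnth_mktuple.
  rewrite (_ : ereal_sup _ = (tnth x i)%:E)//.
  have dE q : ternary_digit (iter (pickle (i, q)) ternary_shift
      (ternary (tuple_digit x) : R)) = (ratr q < tnth x i)%R.
    by rewrite ternaryK /tuple_digit pickleK.
  apply/eqP; rewrite eq_le; apply/andP; split.
    apply: ge_ereal_sup => _ [q _ <-]; rewrite dE; case: ifPn => qx; rewrite ?leNye//.
    by rewrite lee_fin ltW.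
  apply/lee_subgt0Pr => e e0; have : (tnth x i - e < tnth x i)%R by lra.
  move=> /rat_in_itvoo[q]; rewrite in_itv/= => /andP[eq qx].
  apply: (@le_trans _ _ (ratr q)%:E); first by rewrite lee_fin ltW.
  by apply: ereal_sup_ubound => /=; exists q => //; rewrite dE qx.
- by move=> x; rewrite ternary_ge0 ternary_le1.
Qed.

Lemma encoding_comp d1 d2 (T : measurableType d1) (S : measurableType d2)
    (f : T -> S) (g : S -> T) (phi : S -> R) (psi : R -> S) :
  measurable_fun setT f -> measurable_fun setT g -> cancel f g ->
  encoding phi psi -> encoding (phi \o f) (g \o psi).
Proof.
move=> mf mg fK [mphi mpsi phiK phi01]; split.
- exact: measurableT_comp.
- exact: measurableT_comp.
- exact: can_comp.
- by move=> x; exact: phi01.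
Qed.

Definition encodable d (T : measurableType d) := exists phi psi, @encoding d T phi psi.

Lemma encodable_tuple n : encodable (n.-tuple R).
Proof. by do 2 eexists; exact: tuple_encoding. Qed.

Lemma encodable_can d1 d2 (T : measurableType d1) (S : measurableType d2)
    (f : T -> S) (g : S -> T) :
  measurable_fun setT f -> measurable_fun setT g -> cancel f g ->
  encodable S -> encodable T.
Proof.
move=> mf mg fK [phi [psi pe]]; exists (phi \o f), (g \o psi).
exact: encoding_comp pe.
Qed.

Lemma encodable_R : encodable R.
Proof.
apply: (@encodable_can _ _ R (1.-tuple R) (fun x => [tuple x]) (fun t => tnth t ord0)).
- apply/measurable_fun_tnthP => i; rewrite (ord1 i).
  exact: measurable_id.
- exact: measurable_tnth.
- by [].
- exact: encodable_tuple.
Qed.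

(** Carries the density of step functions from the line to maps on [Rd * R], for separability. *)
Lemma encodable_tupleX n : encodable (n.-tuple R * R)%type.
Proof.
apply: (@encodable_can _ _ (n.-tuple R * R)%type (n.+1.-tuple R)
  (fun z => [tuple of z.2 :: z.1]) (fun t => ([tuple of behead t], tnth t ord0))).
- exact: measurable_cons.
- by apply/measurable_fun_pair; [exact: measurable_behead|exact: measurable_tnth].
- by move=> [x u]; congr pair; apply: val_inj.
- exact: encodable_tuple.
Qed.

End encoding.

(** Makes []-oo, t[] an increasing union of half-lines with rational endpoints. The [n]-th rational
    is taken between [t - 1/(n+1)] and [t - 1/(n+2)]. *)
Lemma rat_seq_lt (R : realType) (t : R) : exists r : nat -> rat,
  [/\ nondecreasing_seq r, forall n, (ratr (r n) < t)%R &
      forall x : R, (x < t)%R -> exists n, (x < ratr (r n))%R].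
Proof.
pose x (n : nat) : R := (t - n.+1%:R^-1)%R.
have xx n : (x n < x n.+1)%R.
  by rewrite /x ltrD2l ltrN2 ltf_pV2 ?posrE// ltr_nat.
have /choice[r rP] : forall n, exists q : rat, (x n < ratr q < x n.+1)%R.
  by move=> n; have /rat_in_itvoo[q] := xx n; rewrite in_itv/=; exists q.
exists r; split.
- apply/nondecreasing_seqP => n; rewrite -(ler_rat R).
  have /andP[_ h1] := rP n; have /andP[h2 _] := rP n.+1.
  exact/ltW/(lt_trans h1).
- move=> n; have /andP[_] := rP n => /lt_le_trans; apply.
  by rewrite /x gerBl invr_ge0.
- move=> y yt; have ty0 : (0 < t - y)%R by rewrite subr_gt0.
  exists (Num.truncn (t - y)^-1); have /andP[+ _] := rP (Num.truncn (t - y)^-1).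
  apply: lt_trans; rewrite /x ltrBrDr addrC -ltrBrDr invf_plt ?posrE//.
  exact: truncnS_gt.
Qed.

(** * Quantile functions and disintegration *)

Section quantile.
Context {R : realType} {d} {Y : measurableType d}.
(** [F q w] is meant as the mass given to []-oo, q]] by a law on [[0, 1]] that depends on [w], known
    at rational [q] only. *)
Variable F : rat -> Y -> R.
Hypothesis mF : forall q, measurable_fun setT (F q).
Hypothesis F_ge0 : forall q w, (0 <= F q w)%R.
Hypothesis F_le1 : forall q w, (F q w <= 1)%R.
Hypothesis F_nd : forall w q q', (q <= q')%R -> (F q w <= F q' w)%R.
Hypothesis F_0 : forall w q, (q < 0)%R -> F q w = 0%R.
Hypothesis F_1 : forall w q, (1 <= q)%R -> F q w = 1%R.

Let equantile (z : Y * R) : \bar R :=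
  ereal_inf [set (ratr q : R)%:E | q in [set q | (z.2 <= F q z.1)%R]].

(** Strict sublevels are unions over rational [q] of conditions on [F q]. This gives both the
    measurability and the law of the quantile. *)
Let equantile_lt z (t : R) :
  equantile z < t%:E <-> exists2 q, (ratr q < t)%R & (z.2 <= F q z.1)%R.
Proof.
split; first by move=> /ereal_inf_lt[_ [q zq <-]]; rewrite lte_fin => qt; exists q.
move=> [q qt zq]; apply: (@le_lt_trans _ _ (ratr q)%:E); last by rewrite lte_fin.
by apply: ereal_inf_lbound; exists q.
Qed.

(* Meant for [0 < z.2 <= 1]: otherwise the infimum may be infinite, and [fine] gives 0. *)
Definition quantile (z : Y * R) : R := fine (equantile z).

Lemma measurable_quantile : measurable_fun setT quantile.
Proof.
apply: measurableT_comp; first exact: fine_measurable.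
move=> mT; apply: (measurability _ (ErealGenInftyO.measurableE R)) => //.
move=> _ [_ [t ->] <-]; apply: measurableI => //.
rewrite (_ : _ @^-1` _ = \bigcup_(q : rat) if (ratr q < t)%R then
    [set z : Y * R | (z.2 <= F q z.1)%R] else set0).
  apply: bigcupT_measurable_rat => q; case: ifPn => // _.
  rewrite -[X in measurable X]setTI -[X in _ `&` X]preimage_true.
  apply: (measurable_fun_ler _ _ measurableT) => //.
  by apply: measurableT_comp => //.
apply/seteqP; split => z /=; rewrite in_itv/=.
  by move=> /equantile_lt[q qt zq]; exists q => //; rewrite qt.
by move=> [q _]; case: ifPn => // qt zq; apply/equantile_lt; exists q.
Qed.

Lemma equantile_fin z : (0 < z.2)%R -> (z.2 <= 1)%R -> equantile z \is a fin_num.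
Proof.
move=> z0 z1; rewrite fin_numE; apply/andP; split.
  rewrite gt_eqF//; apply: (@lt_le_trans _ _ 0); first by rewrite ltNy0.
  apply: le_ereal_inf_tmp => _ [q zq <-]; rewrite lee_fin ler0q leNgt.
  by apply/negP => q0; move: zq; rewrite /= F_0// leNgt z0.
rewrite lt_eqF//; apply: (@le_lt_trans _ _ (ratr 1)%:E); last exact: ltry.
by apply: ereal_inf_lbound; exists 1%R => //=; rewrite F_1.
Qed.

(** Within []0, 1]], which has full measure and where [equantile] is finite, the sublevel set is the
    increasing union of the intervals []0, F (r n) w]]. *)
Lemma lam_quantile w (t : R) (r : nat -> rat) : nondecreasing_seq r ->
  (forall n, (ratr (r n) < t)%R) ->
  (forall x : R, (x < t)%R -> exists n, (x < ratr (r n))%R) ->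
  (F (r n) w)%:E @[n --> \oo] --> lam [set u : R | (quantile (w, u) < t)%R].
Proof.
move=> rnd rt tr.
have mQ : measurable [set u : R | (quantile (w, u) < t)%R].
  rewrite -[X in measurable X]setTI.
  have := @measurableT_comp _ _ _ _ _ _ quantile _ _ measurable_quantile (pair1_measurable w).
  by move=> /(_ measurableT `]-oo, t[%classic); rewrite preimage_itvNyo; exact.
have -> : lam [set u : R | (quantile (w, u) < t)%R] =
    lam (\bigcup_n `]0%R, F (r n) w]%classic).
  rewrite -(@prob_measureI_full _ _ _ lam `]0%R, 1%R]%classic) ?lam_unit//.
  congr (lam _); apply/seteqP; split => u /=.
    move=> [+]; rewrite in_itv/= => + /andP[u0 u1].
    rewrite -lte_fin fineK ?equantile_fin// => /equantile_lt[q /tr[n qn] /= uq].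
    exists n => //=; rewrite in_itv/= u0 (le_trans uq)// F_nd//.
    by rewrite -(ler_rat R) ltW.
  move=> [n _] /=; rewrite in_itv/= => /andP[u0 un].
  have u1 : (u <= 1)%R by rewrite (le_trans un).
  split; last by rewrite in_itv/= u0.
  rewrite -lte_fin fineK ?equantile_fin//; apply/equantile_lt.
  by exists (r n).
have -> : (fun n => (F (r n) w)%:E) = (fun n => lam `]0%R, F (r n) w]%classic).
  by apply/funext => n; rewrite lam_itv// subr0.
apply: nondecreasing_cvg_mu => //.
- exact: bigcupT_measurable.
- move=> n m nm; apply/subsetPset/subset_itvl => /=.
  by rewrite bnd_simp F_nd// rnd.
Qed.

End quantile.

Section kernel_noise.
Context {R : realType} {d1 d2} {Y : measurableType d1} {T : measurableType d2}.

(** Quantile transform with a parameter: [F] is the distribution function of the code under [P w],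
    and [psi] decodes its quantile at a uniform [u]. *)
Lemma noise_of_probability (P : Y -> probability T R) :
  encodable (R:=R) T -> (forall A, measurable A -> measurable_fun setT (fun w => P w A)) ->
  exists2 G : Y * R -> T, measurable_fun setT G &
    forall w A, measurable A -> P w A = lam [set u | A (G (w, u))].
Proof.
move=> [phi [psi [mphi mpsi phiK phi01]]] mP.
have mphiq (q : rat) : measurable [set x | (phi x <= ratr q)%R].
  by rewrite -[X in measurable X]setTI -preimage_itvNyc; exact: mphi.
pose F (q : rat) w : R := fine (P w [set x | (phi x <= ratr q)%R]).
have PF q w : P w [set x | (phi x <= ratr q)%R] = (F q w)%:E.
  by rewrite fineK// fin_num_measure.
have mF q : measurable_fun setT (F q).
  by apply: measurableT_comp; [exact: fine_measurable|exact: mP].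
have F0 q w : (0 <= F q w)%R by rewrite -lee_fin -PF.
have F1 q w : (F q w <= 1)%R by rewrite -lee_fin -PF probability_le1.
have Fnd w q q' : (q <= q')%R -> (F q w <= F q' w)%R.
  move=> qq'; rewrite -lee_fin -!PF le_measure ?inE// => x /=.
  by move=> /le_trans; apply; rewrite ler_rat.
have F_0 w q : (q < 0)%R -> F q w = 0%R.
  move=> q0; rewrite /F (_ : [set _ | _] = set0) ?measure0//.
  apply/seteqP; split => // x /=; have /andP[p0 _] := phi01 x.
  by move=> /(le_trans p0); rewrite ler0q leNgt q0.
have F_1 w q : (1 <= q)%R -> F q w = 1%R.
  move=> q1; rewrite /F (_ : [set _ | _] = setT) ?probability_setT//.
  apply/seteqP; split => // x _ /=; have /andP[_ p1] := phi01 x.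
  by rewrite (le_trans p1)// -(rmorph1 (@ratr R)) ler_rat.
have mQ := measurable_quantile mF.
exists (psi \o quantile F); first exact: measurableT_comp mpsi mQ.
move=> w A mA.
have mQw : measurable_fun setT (fun u => quantile F (w, u)).
  exact: (measurableT_comp mQ (pair1_measurable w)).
transitivity (law (P w) mphi (psi @^-1` A)).
  by rewrite lawE -comp_preimage; congr (P w _); apply/funext => x /=; rewrite phiK.
transitivity (law lam mQw (psi @^-1` A)); last by rewrite lawE.
apply: prob_eqR.
- move=> t; rewrite [LHS]lawE [RHS]lawE.
  have [r [rnd rt tr]] := rat_seq_lt t.
  have c2 : (F (r n) w)%:E @[n --> \oo] --> lam [set u | (quantile F (w, u) < t)%R].
    exact: lam_quantile.
  have c1 : P w [set x | (phi x <= ratr (r n))%R] @[n --> \oo] -->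
    P w (\bigcup_n [set x | (phi x <= ratr (r n))%R]).
    apply: nondecreasing_cvg_mu => //; first exact: bigcupT_measurable.
    move=> n m nm; apply/subsetPset => x /=.
    by move=> /le_trans; apply; rewrite ler_rat rnd.
  have {}c2 : P w [set x | (phi x <= ratr (r n))%R] @[n --> \oo] -->
      lam [set u | (quantile F (w, u) < t)%R].
    by under eq_fun do rewrite PF.
  transitivity (P w (\bigcup_n [set x | (phi x <= ratr (r n))%R])).
    congr (P w _); apply/seteqP; split => x /=.
      by rewrite in_itv/= => /tr[n /ltW]; exists n.
    by move=> [n _] /= /le_lt_trans; rewrite in_itv/=; apply.
  rewrite (cvg_unique (@ereal_hausdorff R) c1 c2).
  apply: (congr1 (fun B : set R => lam B)).
  by apply/seteqP; split => u /=; rewrite in_itv.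
- by rewrite -[X in measurable X]setTI; exact: mpsi.
Qed.

(** A kernel value is typed as a mere measure; normalization, which changes nothing at total mass 1,
    types it as a probability. *)
Lemma pker_probability (k : R.-pker Y ~> T) :
  exists2 P : Y -> probability T R, (forall w A, P w A = k w A) &
    (forall A, measurable A -> measurable_fun setT (fun w => P w A)).
Proof.
pose P w : probability T R := mnormalize (k w) \d_point.
have Pk w A : P w A = k w A.
  rewrite /P/= /mnormalize/= prob_kernel/=.
  by rewrite onee_eq0/= invr1 mule1.
exists P => // A mA; under eq_fun do rewrite Pk.
exact: measurable_kernel.
Qed.

Lemma kernel_noise (k : R.-pker Y ~> T) : encodable (R:=R) T ->
  exists2 G : Y * R -> T, measurable_fun setT G &
    forall w A, measurable A -> k w A = lam [set u | A (G (w, u))].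
Proof.
move=> eT; have [P Pk mP] := pker_probability k.
have [G mG PG] := noise_of_probability eT mP.
by exists G => // w A mA; rewrite -Pk PG.
Qed.

Lemma noise_kernel (G : Y * R -> T) : measurable_fun setT G ->
  exists k : R.-pker Y ~> T, forall w A, k w A = lam [set u | A (G (w, u))].
Proof.
move=> mG.
have mGw w : measurable_fun setT (fun u => G (w, u)).
  exact: (measurableT_comp mG (pair1_measurable w)).
pose P w : pprobability T R := law lam (mGw w).
have mP : measurable_fun setT P.
  apply: (measurability (@pset _ _ _ : set (set (pprobability _ R)))) => //.
  move=> _ [_ [r r01 [U mU <-]] <-].
  have mGU := mG measurableT _ mU; rewrite setTI in mGU.
  have := measurable_fun_xsection lam mGU.
  move=> /(_ measurableT _ (emeasurable_itv `]-oo, r%:E[)).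
  rewrite preimage_itvNyo; congr (measurable (_ `&` _)).
  by apply/seteqP; split => w /=; rewrite /mset/= xsectionE.
by exists (kprobability mP).
Qed.

End kernel_noise.

(** * Equality of probabilities on a product *)

Section prod_prob_eq.
Context {R : realType}.

Lemma prob_eq_prod d1 d2 (T1 : measurableType d1) (T2 : measurableType d2)
    (P Q : probability (T1 * T2)%type R) :
  (forall A B, measurable A -> measurable B -> P (A `*` B) = Q (A `*` B)) ->
  forall C, measurable C -> P C = Q C.
Proof.
move=> PQ C mC.
apply: (measure_unique [set A `*` B | A in measurable & B in measurable]
  (fun=> setT)) => //.
- exact: measurable_prod_measurableType.
- move=> _ _ [A1 mA1 [B1 mB1 <-]] [A2 mA2 [B2 mB2 <-]].
  exists (A1 `&` A2); first exact: measurableI.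
  by exists (B1 `&` B2); [exact: measurableI|rewrite setXI].
- by move=> _; exists setT => //; exists setT => //; rewrite setXTT.
- by apply/seteqP; split => // x _; exists 0%N.
- by move=> _ [A mA [B mB <-]]; exact: PQ.
- by move=> k; rewrite (le_lt_trans (probability_le1 P _))// ltry.
Qed.

(** For fixed [B], the sets [S] with equal masses of [S x B] form a Dynkin system. The whole space
    is treated separately because it need not belong to [G]. *)
Lemma prob_eq_gen d1 d2 (T1 : measurableType d1) (Y : measurableType d2)
    (G : set (set T1)) (P Q : probability (T1 * Y)%type R) :
  @measurable _ T1 = <<s G >> -> setI_closed G ->
  (forall B, measurable B -> P (setT `*` B) = Q (setT `*` B)) ->
  (forall A B, G A -> measurable B -> P (A `*` B) = Q (A `*` B)) ->
  forall C, measurable C -> P C = Q C.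
Proof.
move=> genG setIG PQT PQ; apply: prob_eq_prod => A B mA mB.
have finP (M : probability (T1 * Y)%type R) C : measurable C -> M C < +oo.
  by move=> mC; rewrite (le_lt_trans (probability_le1 M _))// ltry.
suff H : forall S, <<s G >> S -> P (S `*` B) = Q (S `*` B).
  by apply: H; rewrite -[X in X _]genG.
move=> S; apply: (@dynkin_induction _ T1 G [set S | P (S `*` B) = Q (S `*` B)]) => //=.
- exact: PQT.
- by move=> D GD; exact: PQ.
- move=> D mD PQD.
  have cE (M : probability (T1 * Y)%type R) :
      M (~` D `*` B) = M (setT `*` B) - M (D `*` B).
    have mDB : measurable (D `*` B) by exact: measurableX.
    have mTB : measurable (setT `*` B : set (T1 * Y)) by exact: measurableX.
    rewrite (_ : ~` D `*` B = (setT `*` B) `\` (D `*` B)); last first.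
      apply/seteqP; split => -[x y] /= [].
        by move=> nDx yB; split => // -[].
      by move=> [_ yB] nD; split => // xD; apply: nD.
    rewrite (measureD mTB mDB (finP M _ mTB)); congr (_ - M _).
    by apply/seteqP; split => -[x y] /=; [case|move=> [? ?]; split].
  by rewrite !cE PQT// PQD.
- move=> F mF tF PQF.
  have -> : (\bigcup_k F k) `*` B = \bigcup_k (F k `*` B).
    by apply/seteqP; split => [[x y] [[k _ xk] yB]|[x y] [k _ [xk yB]]];
      [exists k|split => //; exists k].
  have tFB : trivIset setT (fun k => F k `*` B).
    apply/trivIsetP => i j _ _ ij; rewrite -setXI.
    by move/trivIsetP : tF => /(_ _ _ Logic.I Logic.I ij) ->; rewrite set0X.
  have mFB k : measurable (F k `*` B) by exact: measurableX.
  rewrite !measure_bigcup//; apply: eq_eseriesr => k _; exact: PQF.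
Qed.

Lemma prob_eq_RX d (Y : measurableType d) (P Q : probability (R * Y)%type R) :
  (forall B, measurable B -> P (setT `*` B) = Q (setT `*` B)) ->
  (forall (t : R) B, measurable B -> P (`]-oo, t[%classic `*` B) = Q (`]-oo, t[%classic `*` B)) ->
  forall C, measurable C -> P C = Q C.
Proof.
move=> PQT PQ; apply: (prob_eq_gen (G := RGenInftyO.G (R := R))) => //.
- exact: RGenInftyO.measurableE.
- move=> _ _ [x ->] [y ->]; exists (Num.min x y); apply/seteqP.
  by split => z /=; rewrite !in_itv/= lt_min; [case=> -> ->|move/andP].
- by move=> _ B [x ->]; exact: PQ.
Qed.

End prod_prob_eq.

Section noise_law.
Context {R : realType} {d1 d2} {Y : measurableType d1} {T : measurableType d2}.
Variable nu : probability Y R.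

Lemma measurable_graph (G : Y * R -> T) : measurable_fun setT G ->
  measurable_fun setT (fun z => (G z, z.1)).
Proof. by move=> mG; apply/measurable_fun_pair. Qed.

Lemma measurable_section (G : Y * R -> T) (w : Y) : measurable_fun setT G ->
  measurable_fun setT (fun u => G (w, u)).
Proof. by move=> mG; exact: (measurableT_comp mG (pair1_measurable w)). Qed.

Definition noise_law (G : Y * R -> T) (mG : measurable_fun setT G) :
    probability (T * Y)%type R :=
  law (nu \x lam)%E (measurable_graph mG).

Lemma noise_lawE (G : Y * R -> T) (mG : measurable_fun setT G) A B :
  measurable A -> measurable B ->
  noise_law mG (A `*` B) = \int[nu]_(w in B) lam [set u | A (G (w, u))].
Proof.
move=> mA mB; rewrite [LHS]lawE/= /product_measure1 [RHS]integral_mkcond.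
apply: eq_integral => w _; rewrite /patch; case: ifPn => [/[!inE] wB|].
  congr (lam _); apply/seteqP; split => u; rewrite xsectionE /=; first by case.
  by split.
rewrite notin_setE => wB; rewrite -[RHS](measure0 lam); congr (lam _).
by apply/seteqP; split => u; rewrite xsectionE //= => -[].
Qed.

End noise_law.

Section slice.
Context {R : realType} {d1 d2} {Y : measurableType d1} {T : measurableType d2}.
Variables (mu : probability (T * Y)%type R) (D : set T).

(** Taking the measurability of [D] as an argument lets [slice] carry the structure of a finite
    measure, as Radon-Nikodym requires. *)
Definition slice & measurable D := fun B : set Y => mu (D `*` B).

Hypothesis mD : measurable D.
Local Notation m := (slice mD).

Let m_0 : m set0 = 0. Proof. by rewrite /slice setX0 measure0. Qed.

Let m_ge0 B : 0 <= m B. Proof. exact: measure_ge0. Qed.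

Let m_sigma_additive : semi_sigma_additive m.
Proof.
move=> F mF tF mUF; rewrite /slice.
have -> : D `*` (\bigcup_n F n) = \bigcup_n (D `*` F n).
  by apply/seteqP; split => [[x y] [xD [n _ ?]]|[x y] [n _ [? ?]]];
    [exists n|split => //; exists n].
apply: measure_semi_sigma_additive => [n||].
- exact: measurableX.
- apply/trivIsetP => /= i j _ _ ij; rewrite -setXI.
  by move/trivIsetP : tF => /(_ _ _ _ _ ij) ->//; rewrite setX0.
- by apply: bigcupT_measurable => n; exact: measurableX.
Qed.

HB.instance Definition _ := isMeasure.Build _ _ _ m m_0 m_ge0 m_sigma_additive.

Let m_fin : fin_num_fun m.
Proof. by move=> U mU; apply: fin_num_measure; exact: measurableX. Qed.

HB.instance Definition _ := Measure_isFinite.Build _ _ _ m m_fin.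

End slice.

(** * Disintegration along a marginal, by Radon-Nikodym densities *)

Section disintegration.
Context {R : realType} {d1 d2} {Y : measurableType d1} {T : measurableType d2}.
Variables (mu : probability (T * Y)%type R) (nu : probability Y R).
Hypothesis mu_nu : forall B, measurable B -> mu (setT `*` B) = nu B.

(** A version of the conditional probability of [D] given the second coordinate. *)
Definition conditional_density (D : set T) (f : Y -> R) :=
  [/\ measurable_fun setT f, forall w, (0 <= f w)%R &
    forall B, measurable B -> mu (D `*` B) = \int[nu]_(w in B) (f w)%:E].

Lemma conditional_density_exists D : measurable D ->
  exists f, conditional_density D f.
Proof.
move=> mD; pose m2 : {finite_measure set Y -> \bar R} := slice mu mD.
have m2E B : m2 B = mu (D `*` B).
  by [].
have m2nu : m2 `<< nu.
  apply/null_content_dominatesP => B mB B0.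
  have : mu (D `*` B) <= mu (setT `*` B).
    by rewrite le_measure ?inE//; [exact: measurableX|exact: measurableX|move=> [x y] [_ ?]].
  rewrite mu_nu// (_ : nu B = 0)// -m2E => m20.
  by apply/eqP; rewrite eq_le m20 measure_ge0.
have [f [f0 ffin /measurable_int mf fE]] := radon_nikodym_sigma_finite m2nu.
exists (fine \o f); split.
- by apply: measurableT_comp mf; exact: fine_measurable.
- by move=> w; exact: fine_ge0.
- move=> B mB; rewrite -m2E fE//; apply: eq_integral => w _ /=.
  by rewrite fineK.
Qed.

Lemma conditional_density_int D f : conditional_density D f -> measurable D ->
  nu.-integrable setT (EFin \o f).
Proof.
move=> [mf f0 fE] mD; apply/integrableP; split; first exact/measurable_EFinP.
under eq_integral do rewrite /= ger0_norm//.
by rewrite -fE// (le_lt_trans (probability_le1 _ _)) ?ltry//; exact: measurableX.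
Qed.

(** A density [g] of the difference of the two sets is nonnegative, and [f1 + g] has the same
    integrals as [f2], hence equals it almost everywhere. *)
Lemma conditional_density_le D1 D2 f1 f2 : measurable D1 -> measurable D2 ->
  D1 `<=` D2 -> conditional_density D1 f1 -> conditional_density D2 f2 ->
  {ae nu, forall w, (f1 w <= f2 w)%R}.
Proof.
move=> mD1 mD2 D12 c1 c2.
have mD : measurable (D2 `\` D1) by exact: measurableD.
have [g cg] := conditional_density_exists mD.
have i1 := conditional_density_int c1 mD1.
have i2 := conditional_density_int c2 mD2.
have ig := conditional_density_int cg mD.
case: c1 c2 cg => [mf1 f10 f1E] [mf2 f20 f2E] [mg g0 gE].
have : ae_eq nu setT (EFin \o f2) (fun w => (f1 w)%:E + (g w)%:E).
  apply: integral_ae_eq => //.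
    apply: emeasurable_funD; exact/measurable_EFinP.
  move=> B _ mB; rewrite -f2E// ge0_integralD//.
  - rewrite -f1E// -gE// -measureU//; [|exact: measurableX|exact: measurableX|].
      congr (mu _); apply/seteqP; split => -[x y] /=; last first.
        by move=> [[/D12]|[[]]].
      by move=> [? ?]; have [?|?] := pselect (D1 x); [left|right].
    by apply/seteqP; split => -[x y] //= [] [? ?] [] [].
  - by move=> w _; rewrite lee_fin.
  - exact/measurable_EFinP/measurable_funTS.
  - by move=> w _; rewrite lee_fin.
  - exact/measurable_EFinP/measurable_funTS.
apply: filterS => w /= /(_ Logic.I) [->].
by rewrite lerDl.
Qed.

(** The conditional distribution functions of the code at rational points are nondecreasing outside
    one null set, since only countably many comparisons are involved. After correction on that set,
    their quantile transform gives [G]. *)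
Lemma disintegration_noise : encodable (R:=R) T ->
  exists G (mG : measurable_fun setT G),
    forall C, measurable C -> mu C = noise_law nu mG C.
Proof.
move=> [phi [psi [mphi mpsi phiK phi01]]].
pose D (q : rat) : set T := [set x | (phi x <= ratr q)%R].
have mD q : measurable (D q).
  rewrite -[X in measurable X]setTI (_ : D q = phi @^-1` `]-oo, ratr q]); last first.
    by apply/seteqP; split => x /=; rewrite in_itv.
  exact: mphi.
have D_0 (q : rat) : (q < 0)%R -> D q = set0.
  move=> q0; apply/seteqP; split => // x /=; have /andP[p0 _] := phi01 x.
  by move=> /(le_trans p0); rewrite ler0q leNgt q0.
have D_1 (q : rat) : (1 <= q)%R -> D q = setT.
  move=> q1; apply/seteqP; split => // x _ /=; have /andP[_ p1] := phi01 x.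
  by rewrite /D/= (le_trans p1)// -(rmorph1 (@ratr R)) ler_rat.
have Dnd (q q' : rat) : (q <= q')%R -> D q `<=` D q'.
  by move=> qq' x /= /le_trans; apply; rewrite ler_rat.
have /choice[f fP] q := conditional_density_exists (mD q).
have c1 : conditional_density setT (cst 1%R).
  by split => // B mB; have := integral_cst nu mB 1; rewrite mul1e mu_nu// => <-.
(* The quantile requires the values 0 and 1 outside [[0, 1[] at every [w], not merely almost
   everywhere. *)
pose f' q : Y -> R := if (q < 0)%R then cst 0%R else if (1 <= q)%R then cst 1%R else f q.
have f'P q : conditional_density (D q) (f' q).
  rewrite /f'; case: ifPn => q0; last first.
    by case: ifPn => // q1; rewrite D_1.
  rewrite D_0//; split => // B mB.
  by have := integral_cst nu mB 0; rewrite mul0e set0X measure0 => <-.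
have mf' q : measurable_fun setT (f' q) by have [] := f'P q.
pose goodn n : set Y := if unpickle n is Some (q, q') then
  (if (q <= q' :> rat)%R then [set w | (f' q w <= f' q' w)%R] else setT) else setT.
pose good : set Y := \bigcap_n goodn n.
have mgood : measurable good.
  apply: bigcapT_measurable => n; rewrite /goodn.
  case: (unpickle n) => [[q q']|//]; case: ifPn => // _.
  rewrite -[X in measurable X]setTI -[X in _ `&` X]preimage_true.
  exact: (measurable_fun_ler (mf' q) (mf' q') measurableT).
have aegood : {ae nu, forall w, good w}.
  suff : {ae nu, forall w n, goodn n w} by apply: filterS => w wg n _; exact: wg.
  apply/ae_foralln => n; rewrite /goodn.
  case: (unpickle n) => [[q q']|]; last exact: aeW.
  case: ifPn => [qq'|_]; last exact: aeW.
  exact: (conditional_density_le (mD q) (mD q') (Dnd _ _ qq') (f'P q) (f'P q')).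
have goodP w q q' : good w -> (q <= q')%R -> (f' q w <= f' q' w)%R.
  by move=> /(_ (pickle (q, q')) Logic.I); rewrite /goodn pickleK => + qq'; rewrite qq'.
(* Outside [good], the distribution function of the Dirac mass at 0. *)
pose F q w : R := if w \in good then f' q w else (0 <= q)%R%:R.
have mF q : measurable_fun setT (F q).
  have mm : measurable_fun setT (fun w => w \in good).
    apply: (measurable_fun_bool true); rewrite setTI.
    rewrite (_ : _ @^-1` _ = good)//.
    by apply/seteqP; split => w /=; [move=> /set_mem|move=> /mem_set].
  by apply: measurable_fun_if => //; exact: measurable_funTS.
have F0 q w : (0 <= F q w)%R.
  by rewrite /F; case: ifPn => // _; have [] := f'P q.
have F_0 w q : (q < 0)%R -> F q w = 0%R.
  by move=> q0; rewrite /F /f' q0; case: ifPn => //; rewrite leNgt q0.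
have F_1 w q : (1 <= q)%R -> F q w = 1%R.
  move=> q1; rewrite /F /f' q1 ltNge (le_trans _ q1)//=.
  by case: ifPn.
have Fnd w q q' : (q <= q')%R -> (F q w <= F q' w)%R.
  move=> qq'; rewrite /F; case: ifPn => [/set_mem wg|_]; first exact: goodP.
  by rewrite ler_nat; case: (leP 0%R q) => //= /le_trans ->.
have F1 q w : (F q w <= 1)%R.
  have [q1|/ltW q1] := leP 1%R q; first by rewrite F_1.
  by rewrite -(F_1 w 1%R)// Fnd.
have FE q B : measurable B -> mu (D q `*` B) = \int[nu]_(w in B) (F q w)%:E.
  move=> mB; have [_ _ ->//] := f'P q.
  apply: ae_eq_integral => //.
  - exact/measurable_EFinP/measurable_funTS.
  - exact/measurable_EFinP/measurable_funTS.
  - apply: filterS aegood => w wg _; rewrite /F ifT//.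
    by rewrite inE.
have mQ := measurable_quantile mF.
pose G := psi \o quantile F.
have mG : measurable_fun setT G by exact: measurableT_comp mpsi mQ.
exists G, mG.
have mphi2 : measurable_fun setT (fun z : T * Y => (phi z.1, z.2)).
  by apply/measurable_fun_pair => //; exact: measurableT_comp.
have mpsi2 : measurable_fun setT (fun z : R * Y => (psi z.1, z.2)).
  by apply/measurable_fun_pair => //; exact: measurableT_comp.
(* For the codes, the masses of []-oo, t[ x B] on both sides are limits of [mu (D (r n) x B)]: by
   continuity from below on the left, by monotone convergence on the right. *)
have key : forall C, measurable C -> law mu mphi2 C = noise_law nu mQ C.
  apply: prob_eq_RX => [B mB|t B mB].
    rewrite noise_lawE// [LHS]lawE.
    under eq_integral do rewrite [X in lam X](_ : _ = setT) ?probability_setT//.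
    rewrite integral_cst// mul1e; apply: (etrans _ (mu_nu mB)).
    by congr (mu _); apply/seteqP; split => -[x y].
  rewrite noise_lawE//.
  have [r [rnd rt tr]] := rat_seq_lt t.
  have c2 : mu (D (r n) `*` B) @[n --> \oo] -->
      \int[nu]_(w in B) lam [set u | `]-oo, t[%classic (quantile F (w, u))].
    under eq_fun do rewrite FE//.
    rewrite (eq_integral (fun w => limn (fun n => (F (r n) w)%:E))); last first.
      move=> w _; apply/esym/cvg_lim => //.
      rewrite (_ : [set u | _] = [set u | (quantile F (w, u) < t)%R]).
        exact: lam_quantile.
      by apply/seteqP; split => u /=; rewrite in_itv.
    apply: cvg_monotone_convergence => //.
    - by move=> n; exact/measurable_EFinP/measurable_funTS.
    - by move=> n w _; rewrite lee_fin.
    - by move=> w _ n m nm; rewrite lee_fin Fnd// rnd.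
  have c3 : mu (D (r n) `*` B) @[n --> \oo] --> mu (\bigcup_n (D (r n) `*` B)).
    apply: nondecreasing_cvg_mu => //.
    - by move=> n; exact: measurableX.
    - by apply: bigcupT_measurable => n; exact: measurableX.
    - move=> n m nm; apply/subsetPset => -[x y] [/= xn yB]; split => //=.
      exact: (Dnd (r n) (r m) (rnd _ _ nm)).
  rewrite -(cvg_unique (@ereal_hausdorff R) c3 c2) [LHS]lawE.
  congr (mu _); apply/seteqP; split => -[x y] /=.
    by rewrite in_itv/= => -[/tr[n /ltW xn] yB]; exists n.
  by move=> [n _ [/= xn yB]]; split => //; rewrite in_itv/= (le_lt_trans xn).
move=> C mC.
have mC2 : measurable ((fun z : R * Y => (psi z.1, z.2)) @^-1` C).
  by rewrite -[X in measurable X]setTI; exact: mpsi2.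
transitivity (law mu mphi2 ((fun z : R * Y => (psi z.1, z.2)) @^-1` C)).
  rewrite [RHS]lawE; congr (mu _); apply/seteqP; split => -[x y] /=; rewrite phiK//.
by rewrite key.
Qed.

End disintegration.

(** * Square-integrable maps *)

Section euclidean.
Context {R : realType} {n : nat}.
Local Notation Rn := (n.-tuple R).
Implicit Types x y z : Rn.

Lemma edist2_ge0 x y : (0 <= edist2 x y)%R.
Proof. by apply: sumr_ge0 => i _; exact: sqr_ge0. Qed.

Lemma edist2C x y : edist2 x y = edist2 y x.
Proof. by apply: eq_bigr => i _; rewrite -sqrrN opprB. Qed.

Lemma edist2xx x : edist2 x x = 0%R.
Proof. by rewrite /edist2 big1// => i _; rewrite subrr expr0n. Qed.

(** A triangle inequality for squares with a free weight: it can be integrated, and the choice of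
    [t] afterwards gives back the one for norms. *)
Lemma edist2_le (t : R) x y z : (0 < t)%R ->
  (edist2 x z <= (1 + t) * edist2 x y + (1 + t^-1) * edist2 y z)%R.
Proof.
move=> t0; rewrite /edist2 !mulr_sumr -big_split/=; apply: ler_sum => i _.
set a := tnth x i; set b := tnth y i; set c := tnth z i.
rewrite -subr_ge0 [leRHS](_ : _ = t^-1 * (t * (a - b) - (b - c)) ^+ 2)%R.
  by rewrite mulr_ge0 ?sqr_ge0// invr_ge0 ltW.
by field; rewrite gt_eqF.
Qed.

Lemma enorm2E x : enorm2 x = edist2 x [tuple 0%R | i < n].
Proof. by apply: eq_bigr => i _; rewrite tnth_mktuple subr0. Qed.

Lemma measurable_edist2 d (T : measurableType d) (f g : T -> Rn) :
  measurable_fun setT f -> measurable_fun setT g ->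
  measurable_fun setT (fun t => edist2 (f t) (g t)).
Proof.
move=> /measurable_fun_tnthP mf /measurable_fun_tnthP mg.
apply: measurable_sum => i; apply: measurable_funX.
by apply: measurable_funB; [exact: mf|exact: mg].
Qed.

End euclidean.

Section L2.
Context {R : realType} {n : nat} {d} {T : measurableType d}.
Local Notation Rn := (n.-tuple R).
Implicit Types (P : probability T R) (f g h : T -> Rn).

Definition L2sq P f g : \bar R := \int[P]_t (edist2 (f t) (g t))%:E.

Lemma L2sq_ge0 P f g : 0 <= L2sq P f g.
Proof. by apply: integral_ge0 => t _; rewrite lee_fin edist2_ge0. Qed.

Lemma L2sqC P f g : L2sq P f g = L2sq P g f.
Proof. by apply: eq_integral => t _; rewrite edist2C. Qed.

Lemma L2sqxx P f : L2sq P f f = 0.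
Proof. by apply: integral0_eq => t _; rewrite edist2xx. Qed.

Lemma L2sq_le P f g h (t : R) : measurable_fun setT f -> measurable_fun setT g ->
  measurable_fun setT h -> (0 < t)%R ->
  L2sq P f h <= (1 + t)%:E * L2sq P f g + (1 + t^-1)%:E * L2sq P g h.
Proof.
move=> mf mg mh t0.
have t1 : (0 <= 1 + t)%R by rewrite addr_ge0// ltW.
have t2 : (0 <= 1 + t^-1)%R by rewrite addr_ge0// invr_ge0 ltW.
have mE (f1 f2 : T -> Rn) : measurable_fun setT f1 -> measurable_fun setT f2 ->
    measurable_fun setT (fun s => (edist2 (f1 s) (f2 s))%:E).
  by move=> m1 m2; apply/measurable_EFinP; exact: measurable_edist2.
rewrite /L2sq -!ge0_integralZl//; try exact: mE;
  try by move=> s _; rewrite lee_fin edist2_ge0.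
rewrite -ge0_integralD//; last 4 first.
- by move=> s _; rewrite mule_ge0// lee_fin edist2_ge0.
- by apply: measurable_funeM; exact: mE.
- by move=> s _; rewrite mule_ge0// lee_fin edist2_ge0.
- by apply: measurable_funeM; exact: mE.
apply: ge0_le_integral => //.
- by move=> s _; rewrite lee_fin edist2_ge0.
- exact: mE.
- by apply: emeasurable_funD; apply: measurable_funeM; exact: mE.
- by move=> s _; rewrite -!EFinM -EFinD lee_fin edist2_le.
Qed.

Lemma sqrt_weighted_le (X A B : R) : (0 <= A)%R -> (0 <= B)%R ->
  (forall t, 0 < t -> X <= (1 + t) * A + (1 + t^-1) * B)%R ->
  (Num.sqrt X <= Num.sqrt A + Num.sqrt B)%R.
Proof.
move=> A0 B0 H; apply/ler_addgt0Pl => e e0.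
(* The best weight is the ratio of the two roots; the added [e / 2] keeps it defined and positive
   when [A] or [B] vanishes. *)
pose a := (Num.sqrt A + e / 2)%R; pose b := (Num.sqrt B + e / 2)%R.
have a0 : (0 < a)%R by rewrite ltr_wpDl ?sqrtr_ge0// divr_gt0.
have b0 : (0 < b)%R by rewrite ltr_wpDl ?sqrtr_ge0// divr_gt0.
have Aa : (A <= a ^+ 2)%R.
  have sa : (Num.sqrt A <= a)%R by rewrite /a lerDl ltW// divr_gt0.
  by rewrite -[leLHS](sqr_sqrtr A0) lerXn2r// nnegrE ?sqrtr_ge0// ltW.
have Bb : (B <= b ^+ 2)%R.
  have sa : (Num.sqrt B <= b)%R by rewrite /b lerDl ltW// divr_gt0.
  by rewrite -[leLHS](sqr_sqrtr B0) lerXn2r// nnegrE ?sqrtr_ge0// ltW.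
rewrite (_ : e + _ = a + b)%R; last by rewrite /a /b; field.
have ab0 : (0 <= a + b)%R by rewrite addr_ge0// ltW.
rewrite -[leRHS](ger0_norm ab0) -sqrtr_sqr ler_sqrt ?sqr_ge0//.
have t0 : (0 < b / a)%R by rewrite divr_gt0.
apply: (le_trans (H _ t0)).
have -> : ((a + b) ^+ 2 = (1 + b / a) * a ^+ 2 + (1 + (b / a)^-1) * b ^+ 2)%R.
  by field; rewrite !gt_eqF.
by rewrite lerD// ler_wpM2l// addr_ge0// ?invr_ge0 ltW.
Qed.

Lemma L2_triangle P f g h : measurable_fun setT f -> measurable_fun setT g ->
  measurable_fun setT h ->
  sqrte (L2sq P f h) <= sqrte (L2sq P f g) + sqrte (L2sq P g h).
Proof.
move=> mf mg mh.
have := L2sq_le P mf mg mh.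
have := L2sq_ge0 P f g; have := L2sq_ge0 P g h; have := L2sq_ge0 P f h.
case: (L2sq P f g) => [a| |]//; last first.
  by rewrite /= addye ?leey// gt_eqF// (lt_le_trans _ (sqrte_ge0 _))// ltNyr.
case: (L2sq P g h) => [b| |]//; last by rewrite /= addey ?leey.
case: (L2sq P f h) => [x| |]// x0 b0 a0 H; last first.
  by have := H 1%R ltr01; rewrite -!EFinM -EFinD leye_eq.
rewrite /= lee_fin sqrt_weighted_le//.
Qed.

End L2.

Section L2_comp.
Context {R : realType} {n : nat} {d1 d2} {T1 : measurableType d1} {T2 : measurableType d2}.

Lemma L2sq_law (P : probability T1 R) (m : T1 -> T2) (mm : measurable_fun setT m)
   (f g : T2 -> n.-tuple R) : measurable_fun setT f -> measurable_fun setT g ->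
  L2sq (law P mm) f g = L2sq P (f \o m) (g \o m).
Proof.
move=> mf mg; rewrite /L2sq ge0_integral_law//.
  by apply/measurable_EFinP; exact: measurable_edist2.
by move=> x; rewrite lee_fin edist2_ge0.
Qed.

End L2_comp.

(** * Density of rational step functions in L2 *)

Section step_functions.
Context {R : realType}.
Implicit Types (s : seq (rat * rat)) (f g : R -> R).

(** Rational coefficients make the family countable; rational breakpoints make each member constant
    on the cells of a regular subdivision. *)
Definition rstep s (x : R) : R :=
  (\sum_(cq <- s) ratr cq.1 * (x < ratr cq.2)%R%:R)%R.

Lemma measurable_rstep s : measurable_fun setT (rstep s).
Proof.
rewrite /rstep; apply: measurable_sum => cq; apply: measurable_funM => //.
apply: (@measurableT_comp _ _ _ _ _ _ (fun b : bool => b%:R : R)) => //.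
by apply: measurable_fun_ltr => //; exact: measurable_id.
Qed.

Lemma rstep_cat s s' x : rstep (s ++ s') x = (rstep s x + rstep s' x)%R.
Proof. by rewrite /rstep big_cat. Qed.

Definition rscale (r : rat) s := [seq (r * cq.1, cq.2)%R | cq <- s].

Lemma rstep_scale r s x : rstep (rscale r s) x = (ratr r * rstep s x)%R.
Proof.
rewrite /rstep /rscale big_map mulr_sumr; apply: eq_bigr => cq _ /=.
by rewrite rmorphM mulrA.
Qed.

Lemma rstep_bounded s : exists2 M : R, (0 <= M)%R & forall x, (`|rstep s x| <= M)%R.
Proof.
exists (\sum_(cq <- s) `|ratr cq.1|)%R => [|x]; first exact: sumr_ge0.
rewrite (le_trans (ler_norm_sum _ _ _))//; apply: ler_sum => cq _.
by rewrite normrM ler_piMr//; case: (x < _)%R; rewrite ?normr1 ?normr0.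
Qed.

Variable P : probability R R.

Definition msq f g : \bar R := \int[P]_x ((f x - g x) ^+ 2)%:E.

Lemma measurable_msq f g : measurable_fun setT f -> measurable_fun setT g ->
  measurable_fun setT (fun x => ((f x - g x) ^+ 2)%:E).
Proof.
by move=> mf mg; apply/measurable_EFinP/measurable_funX; exact: measurable_funB.
Qed.

Lemma msq_lin_le (a b : R) f1 g1 f2 g2 (f g : R -> R) :
  measurable_fun setT f -> measurable_fun setT g ->
  measurable_fun setT f1 -> measurable_fun setT g1 ->
  measurable_fun setT f2 -> measurable_fun setT g2 ->
  (forall x, f x - g x = a * (f1 x - g1 x) + b * (f2 x - g2 x))%R ->
  msq f g <= (2 * a ^+ 2)%:E * msq f1 g1 + (2 * b ^+ 2)%:E * msq f2 g2.
Proof.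
move=> mf mg mf1 mg1 mf2 mg2 fgE.
have a2 : (0 <= 2 * a ^+ 2)%R by rewrite mulr_ge0// sqr_ge0.
have b2 : (0 <= 2 * b ^+ 2)%R by rewrite mulr_ge0// sqr_ge0.
rewrite /msq -!ge0_integralZl//; try exact: measurable_msq;
  try by move=> s _; rewrite lee_fin sqr_ge0.
rewrite -ge0_integralD//; last 4 first.
- by move=> s _; rewrite mule_ge0// lee_fin sqr_ge0.
- by apply: measurable_funeM; exact: measurable_msq.
- by move=> s _; rewrite mule_ge0// lee_fin sqr_ge0.
- by apply: measurable_funeM; exact: measurable_msq.
apply: ge0_le_integral => //.
- by move=> s _; rewrite lee_fin sqr_ge0.
- exact: measurable_msq.
- by apply: emeasurable_funD; apply: measurable_funeM; exact: measurable_msq.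
- move=> x _; rewrite -!EFinM -EFinD lee_fin fgE.
  set u := (f1 x - g1 x)%R; set v := (f2 x - g2 x)%R.
  rewrite -subr_ge0 (_ : _ - _ = (a * u - b * v) ^+ 2)%R ?sqr_ge0//; ring.
Qed.

Definition approximable f := measurable_fun setT f /\
  forall e : R, (0 < e)%R -> exists s, msq f (rstep s) < e%:E.

Lemma approximable_closed f : measurable_fun setT f ->
  (forall e : R, (0 < e)%R -> exists2 g, approximable g & msq f g < e%:E) ->
  approximable f.
Proof.
move=> mf H; split => // e e0.
have e4 : (0 < e / 4)%R by rewrite divr_gt0.
have [g [mg gs] fg] := H _ e4; have [s gse] := gs _ e4; exists s.
have ms := measurable_rstep s.
apply: (@le_lt_trans _ _ ((2 * 1 ^+ 2)%:E * msq f g + (2 * 1 ^+ 2)%:E * msq g (rstep s))).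
  by apply: msq_lin_le => // x; ring.
rewrite (_ : e = 2 * 1 ^+ 2 * (e / 4) + 2 * 1 ^+ 2 * (e / 4))%R; last by field.
by rewrite EFinD !EFinM lteD// lte_pmul2l// lte_fin expr1n mulr1.
Qed.

Lemma approximableD f g : approximable f -> approximable g ->
  approximable (fun x => f x + g x)%R.
Proof.
move=> [mf fs] [mg gs]; split; first exact: measurable_funD.
move=> e e0; have e4 : (0 < e / 4)%R by rewrite divr_gt0.
have [s1 h1] := fs _ e4; have [s2 h2] := gs _ e4; exists (s1 ++ s2).
have ms1 := measurable_rstep s1; have ms2 := measurable_rstep s2.
apply: (@le_lt_trans _ _ ((2 * 1 ^+ 2)%:E * msq f (rstep s1) + (2 * 1 ^+ 2)%:E * msq g (rstep s2))).
  apply: msq_lin_le => //; [exact: measurable_funD|exact: measurable_rstep|].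
  by move=> x; rewrite rstep_cat; ring.
rewrite (_ : e = 2 * 1 ^+ 2 * (e / 4) + 2 * 1 ^+ 2 * (e / 4))%R; last by field.
by rewrite EFinD !EFinM lteD// lte_pmul2l// lte_fin expr1n mulr1.
Qed.

Lemma approximable0 : approximable (fun=> 0%R).
Proof.
split=> // e e0; exists [::]; rewrite /msq integral0_eq ?lte_fin// => x _.
by rewrite /rstep big_nil subrr expr0n.
Qed.

(** A real factor is not allowed in [rstep], so [c] is also replaced by a rational [r]. The constant
    [e1] keeps the error on [f] below [e / 2] despite [c]. The constant [e2] does so for the error
    on [c], despite the bound [M] of the step function; [eta <= 1] ensures that [eta ^+ 2 <= e2]. *)
Lemma approximableZ (c : R) f : approximable f -> approximable (fun x => c * f x)%R.
Proof.
move=> [mf fs]; split; first exact: measurable_funM.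
move=> e e0.
have c1 : (0 < c ^+ 2 + 1)%R by rewrite ltr_wpDl// sqr_ge0.
pose e1 : R := (e / (4 * (c ^+ 2 + 1)))%R.
have e10 : (0 < e1)%R by rewrite divr_gt0// mulr_gt0.
have [s hs] := fs _ e10; have ms := measurable_rstep s.
have [M M0 sM] := rstep_bounded s.
have M1 : (0 < M ^+ 2 + 1)%R by rewrite ltr_wpDl// sqr_ge0.
pose e2 : R := (e / (4 * (M ^+ 2 + 1)))%R.
have e20 : (0 < e2)%R by rewrite divr_gt0// mulr_gt0.
pose eta : R := Num.min 1%R e2.
have eta0 : (0 < eta)%R by rewrite lt_min ltr01.
have : (c - eta < c)%R by lra.
move=> /rat_in_itvoo[r]; rewrite in_itv/= => /andP[r1 r2].
have cr : ((c - ratr r) ^+ 2 <= e2)%R.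
  have cr0 : (0 <= c - ratr r)%R by rewrite subr_ge0 ltW.
  have cr1 : (c - ratr r <= eta)%R by lra.
  have /andP[eta1 eta2] : (eta <= 1)%R && (eta <= e2)%R by rewrite -le_min.
  by rewrite (le_trans _ eta2)// expr2 (le_trans (ler_pM _ _ cr1 cr1))// ler_piMr// ltW.
exists (rscale r s).
apply: (@le_lt_trans _ _ ((2 * c ^+ 2)%:E * msq f (rstep s) +
    (2 * (c - ratr r) ^+ 2)%:E * msq (rstep s) (fun=> 0%R))).
  apply: msq_lin_le => //; [exact: measurable_funM|exact: measurable_rstep|].
  by move=> x; rewrite rstep_scale; ring.
have h1 : (2 * c ^+ 2)%:E * msq f (rstep s) <= (e / 2)%:E.
  apply: (@le_trans _ _ ((2 * c ^+ 2)%:E * e1%:E)).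
    by rewrite lee_wpmul2l ?(ltW hs)// lee_fin mulr_ge0// sqr_ge0.
  rewrite -EFinM lee_fin (_ : 2 * c ^+ 2 * e1 = e / 2 * (c ^+ 2 / (c ^+ 2 + 1)))%R.
    rewrite ler_piMr//; first by rewrite divr_ge0// ltW.
    by rewrite ler_pdivrMr// mul1r lerDl.
  by rewrite /e1; field; rewrite gt_eqF.
have h2 : msq (rstep s) (fun=> 0%R) <= (M ^+ 2)%:E.
  apply: (@le_trans _ _ (\int[P]_x (M ^+ 2)%:E)).
    apply: ge0_le_integral => //.
    - by move=> x _; rewrite lee_fin sqr_ge0.
    - exact: measurable_msq.
    - move=> x _; rewrite lee_fin subr0 -real_normK ?num_real//.
      by rewrite lerXn2r ?nnegrE.
  by rewrite (integral_cst P measurableT (M ^+ 2)%:E) [X in _ * X]probability_setT mule1.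
apply: (@le_lt_trans _ _ ((e / 2)%:E + (2 * e2)%:E * (M ^+ 2)%:E)).
  apply: leeD => //; apply: lee_pmul => //.
  - by rewrite lee_fin mulr_ge0// sqr_ge0.
  - by apply: integral_ge0 => x _; rewrite lee_fin sqr_ge0.
  - by rewrite lee_fin ler_wpM2l.
rewrite -EFinM -EFinD lte_fin.
rewrite (_ : 2 * e2 * M ^+ 2 = e / 2 * (M ^+ 2 / (M ^+ 2 + 1)))%R; last first.
  by rewrite /e2; field; rewrite gt_eqF.
have : (M ^+ 2 / (M ^+ 2 + 1) < 1)%R by rewrite ltr_pdivrMr// mul1r ltrDl.
by move: (_ / _)%R => z z1; nra.
Qed.

Lemma approximableN f : approximable f -> approximable (fun x => - f x)%R.
Proof.
move=> /(approximableZ (-1)); congr (approximable _).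
by apply/funext => x; rewrite mulN1r.
Qed.

Lemma approximable_sum (I : Type) (r : seq I) (F : I -> R -> R) :
  (forall i, approximable (F i)) -> approximable (fun x => \sum_(i <- r) F i x)%R.
Proof.
move=> aF; elim: r => [|i r ih].
  by under eq_fun do rewrite big_nil; exact: approximable0.
by under eq_fun do rewrite big_cons; exact: approximableD.
Qed.

Lemma msq_indic_nd (A B : set R) : measurable A -> measurable B -> A `<=` B ->
  msq (\1_B) (\1_A) = P (B `\` A).
Proof.
move=> mA mB AB; transitivity (\int[P]_x (\1_(B `\` A) x)%:E); last first.
  by rewrite integral_indic ?setIT//; exact: measurableD.
apply: eq_integral => x _; congr EFin; rewrite !indicE in_setD.
have [xA|xA] := boolP (x \in A).
  by rewrite (_ : x \in B) /= ?subrr ?expr0n// inE; apply: AB; rewrite inE in xA.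
by rewrite andbT; case: (x \in B) => /=; rewrite subr0 ?expr1n ?expr0n.
Qed.

Lemma approximable_nd (F : (set R)^nat) : (forall n, measurable (F n)) ->
  nondecreasing_seq F -> (forall n, approximable (\1_(F n))) ->
  approximable (\1_(\bigcup_n F n)).
Proof.
move=> mF ndF aF; have mU := bigcupT_measurable _ mF.
apply: approximable_closed; first exact: measurable_indic.
move=> e e0.
have finU := fin_num_measure P _ mU.
have : P (F n) @[n --> \oo] --> (fine (P (\bigcup_n F n)))%:E.
  by rewrite fineK//; exact: nondecreasing_cvg_mu.
move=> /fine_cvgP[_ /cvgrPdist_lt/(_ _ e0)[N _ /(_ N)]].
rewrite /= => /(_ (leqnn N)) hN; exists (\1_(F N)) => //.
rewrite msq_indic_nd//; last exact: bigcup_sup.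
have finN := fin_num_measure P _ (mF N).
rewrite measureD//; last by rewrite ltey_eq finU.
rewrite setIidr; last exact: bigcup_sup.
rewrite -(fineK finU) -(fineK finN) -EFinB lte_fin.
exact: le_lt_trans (ler_norm _) hN.
Qed.

Lemma approximable_ltr (t : R) : approximable (\1_`]-oo, t[%classic).
Proof.
have [r [rnd rt tr]] := rat_seq_lt t.
have -> : `]-oo, t[%classic = \bigcup_n `]-oo, (ratr (r n) : R)[%classic.
  apply/seteqP; split => x /=; rewrite in_itv/=.
    by move=> /tr[n xn]; exists n => //=; rewrite in_itv.
  by move=> [n _] /=; rewrite in_itv/= => /lt_trans; apply.
apply: approximable_nd => // [n m nm|n].
  by apply/subsetPset/subset_itvl; rewrite bnd_simp ler_rat rnd.
split; first exact: measurable_indic.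
move=> e e0; exists [:: (1%R, r n)].
rewrite /msq integral0_eq ?lte_fin// => x _; congr EFin.
rewrite /rstep big_seq1 /= rmorph1 mul1r indicE mem_setE in_itv/=.
by rewrite subrr expr0n.
Qed.

Lemma approximableT : approximable (\1_[set: R]).
Proof.
have -> : [set: R] = \bigcup_n `]-oo, (n%:R : R)[%classic.
  apply/seteqP; split => // x _.
  exists (Num.truncn `|x|).+1 => //=; rewrite in_itv/=.
  by rewrite (le_lt_trans (ler_norm _))// truncnS_gt.
apply: approximable_nd => // [n m nm|n]; last exact: approximable_ltr.
by apply/subsetPset/subset_itvl; rewrite bnd_simp ler_nat.
Qed.

Lemma approximableU (A B : set R) : A `&` B = set0 ->
  approximable (\1_A) -> approximable (\1_B) -> approximable (\1_(A `|` B)).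
Proof.
move=> AB aA aB; have := approximableD aA aB; congr approximable.
apply/funext => x; rewrite !indicE in_setU.
have [xA|] := boolP (x \in A); have [xB|] := boolP (x \in B);
  rewrite /= ?addr0 ?add0r//.
have : (A `&` B) x := conj (set_mem xA) (set_mem xB).
by rewrite AB.
Qed.

(** Sets with approximable indicator form a Dynkin system containing the half-lines; a disjoint
    union is reached as the increasing union of its finite parts. *)
Lemma approximable_indic (A : set R) : measurable A -> approximable (\1_A).
Proof.
move=> mA.
suff H : forall S : set R, <<s RGenInftyO.G (R:=R) >> S -> approximable (\1_S).
  by apply: H; rewrite -[X in X _]RGenInftyO.measurableE.
move=> S; apply: (@dynkin_induction _ R (RGenInftyO.G (R:=R))
   [set S | approximable (\1_S)]) => /=.
- exact: RGenInftyO.measurableE.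
- move=> _ _ [x ->] [y ->]; exists (Num.min x y); apply/seteqP.
  by split => z /=; rewrite !in_itv/= lt_min; [case=> -> ->|move/andP].
- exact: approximableT.
- by move=> _ [x ->]; exact: approximable_ltr.
- move=> D mD aD; have aT := approximableT.
  have := approximableD aT (approximableN aD); congr approximable.
  apply/funext => x; rewrite !indicE in_setT in_setC.
  by case: (x \in D); rewrite /= ?subrr ?subr0.
- move=> F mF tF aF.
  rewrite -bigcup_bigsetU_bigcup.
  apply: approximable_nd => [n|n m nm|n].
  + exact: bigsetU_measurable.
  + by apply/subsetPset; exact: subset_bigsetU.
  + elim: n.+1 => [|{}n ih]; first by rewrite big_ord0 indic0; exact: approximable0.
    rewrite big_ord_recr/=; apply: approximableU => //.
    by apply: (@trivIset_bigsetUI _ xpredT F _ n n) => //; exact: sub_trivIset tF.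
Qed.

Import HBNNSimple.

Lemma approximable_nnsfun (f : {nnsfun R >-> R}) : approximable f.
Proof.
have -> : (f : R -> R) = (fun x => \sum_(y <- finmap.enum_fset (fset_set (range f)))
   (y * \1_(f @^-1` [set y]) x))%R.
  by apply/funext => x; rewrite fimfunE fsbig_finite.
apply: approximable_sum => i; apply: approximableZ; exact: approximable_indic.
Qed.

(** Simple functions increase to [f], and the squared errors are dominated by [f ^+ 2]. *)
Lemma approximable_ge0 f : measurable_fun setT f -> (forall x, 0 <= f x)%R ->
  msq f (fun=> 0%R) < +oo -> approximable f.
Proof.
move=> mf f0 foo; apply: approximable_closed => // e e0.
have mEf : measurable_fun setT (EFin \o f) by exact/measurable_EFinP.
pose g := nnsfun_approx measurableT mEf.
have gf n x : (g n x <= f x)%R.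
  by rewrite -lee_fin /g nnsfun_approxE; apply: le_approx => // y _; rewrite lee_fin.
have ig : P.-integrable setT (fun x => ((f x - 0) ^+ 2)%:E).
  apply/integrableP; split; first exact: measurable_msq.
  by under eq_integral do rewrite gee0_abs ?lee_fin ?sqr_ge0//.
have [] := @dominated_convergence _ _ _ P setT measurableT
  (fun n x => ((f x - g n x) ^+ 2)%:E) (fun=> 0) (fun x => ((f x - 0) ^+ 2)%:E).
- by move=> n; exact: measurable_msq.
- exact: measurable_cst.
- apply: aeW => x _.
  have : (g n x)%:E @[n --> \oo] --> (f x)%:E.
    by apply: cvg_nnsfun_approx => // y _; rewrite lee_fin.
  move=> /fine_cvgP[_ gfx].
  have h : (f x - g n x)%R @[n --> \oo] --> (0 : R)%R.
    by rewrite -(subrr (f x)); apply: cvgB => //; exact: cvg_cst.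
  have h2 := cvgM h h; rewrite mulr0 in h2.
  by apply/fine_cvgP; split; [exact: nearW|exact: h2].
- exact: ig.
- apply: aeW => x n _; rewrite gee0_abs ?lee_fin ?sqr_ge0// subr0.
  by rewrite lerXn2r ?nnegrE ?subr_ge0// gerBl.
move=> _ _; rewrite integral0.
move=> /fine_cvgP[h1 /cvgrPdist_lt/(_ _ e0) h2].
have [N _ HN] : \forall n \near \oo, msq f (g n) < e%:E.
  near=> n.
  have nfin : msq f (g n) \is a fin_num by near: n.
  rewrite -(fineK nfin) lte_fin.
  have : (`|0 - fine (msq f (g n))| < e)%R by near: n.
  by rewrite sub0r normrN => /(le_lt_trans (ler_norm _)).
exists (g N); [exact: approximable_nnsfun|exact: (HN N (leqnn N))].
Unshelve. all: by end_near. Qed.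

Lemma approximable_L2 f : measurable_fun setT f -> msq f (fun=> 0%R) < +oo ->
  approximable f.
Proof.
move=> mf foo.
have -> : f = (fun x => Num.max (f x) 0 + - Num.max (- f x) 0)%R.
  by apply/funext => x; case: (leP 0%R (f x)) => fx; case: (leP 0%R (- f x)%R) => fx'; lra.
apply: approximableD; last apply: approximableN.
  apply: approximable_ge0.
  - by apply: measurable_maxr.
  - by move=> x; rewrite le_max lexx orbT.
  - apply: (le_lt_trans _ foo); apply: ge0_le_integral => //.
    + by move=> x _; rewrite lee_fin sqr_ge0.
    + by apply: measurable_msq => //; exact: measurable_maxr.
    + exact: measurable_msq.
    + move=> x _; rewrite lee_fin !subr0 /Num.max.
      by case: ifP => _; rewrite ?expr0n/= ?sqr_ge0.
apply: approximable_ge0.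
- by apply: measurable_maxr => //; exact: measurableT_comp.
- by move=> x; rewrite le_max lexx orbT.
- apply: (le_lt_trans _ foo); apply: ge0_le_integral => //.
  + by move=> x _; rewrite lee_fin sqr_ge0.
  + by apply: measurable_msq => //; apply: measurable_maxr => //; exact: measurableT_comp.
  + exact: measurable_msq.
  + move=> x _; rewrite lee_fin !subr0 /Num.max.
    by case: ifP => _; rewrite ?sqrrN ?expr0n/= ?sqr_ge0.
Qed.

End step_functions.

Section vector_steps.
Context {R : realType} {n : nat}.
Local Notation Rn := (n.-tuple R).

Definition vstep (S : n.-tuple (seq (rat * rat))) (x : R) : Rn :=
  [tuple rstep (tnth S i) x | i < n].

Lemma measurable_vstep S : measurable_fun setT (vstep S).
Proof.
apply/measurable_fun_tnthP => i.
rewrite (_ : _ \o _ = rstep (tnth S i)); first exact: measurable_rstep.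
by apply/funext => x /=; rewrite tnth_mktuple.
Qed.

Lemma L2sq_sum (P : probability R R) (f g : R -> Rn) :
  measurable_fun setT f -> measurable_fun setT g ->
  L2sq P f g = \sum_(i < n) msq P (fun x => tnth (f x) i) (fun x => tnth (g x) i).
Proof.
move=> /measurable_fun_tnthP mf /measurable_fun_tnthP mg.
rewrite /L2sq /msq -ge0_integral_sum//.
- by apply: eq_integral => x _; rewrite /edist2 -sumEFin.
- move=> i; apply: measurable_msq; [exact: mf|exact: mg].
- by move=> i x _; rewrite lee_fin sqr_ge0.
Qed.

Lemma vstep_dense (P : probability R R) (f : R -> Rn) (e : R) :
  measurable_fun setT f -> L2sq P f (cst [tuple 0%R | i < n]) < +oo -> (0 < e)%R ->
  exists S, L2sq P f (vstep S) < e%:E.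
Proof.
move=> mf foo e0; have mf' := mf; move/measurable_fun_tnthP in mf'.
have mfi i : measurable_fun setT (fun x => tnth (f x) i) by exact: mf'.
(* Dividing by [n.+1] instead of [n] allows [n = 0] and leaves the final sum strictly below [e]. *)
have e1 : (0 < e / n.+1%:R)%R by rewrite divr_gt0.
have H (i : 'I_n) : exists s, msq P (fun x => tnth (f x) i) (rstep s) < (e / n.+1%:R)%:E.
  have [] := @approximable_L2 _ P (fun x => tnth (f x) i) (mfi i); last first.
    by move=> _; exact.
  apply: (le_lt_trans _ foo); apply: ge0_le_integral => //.
  - by move=> x _; rewrite lee_fin sqr_ge0.
  - exact: measurable_msq.
  - by apply/measurable_EFinP; exact: measurable_edist2.
  - move=> x _; rewrite lee_fin /edist2 (bigD1 i)//= tnth_mktuple lerDl.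
    by apply: sumr_ge0 => j _; exact: sqr_ge0.
have /choice[s sP] := H; exists [tuple s i | i < n].
rewrite L2sq_sum//; last exact: measurable_vstep.
apply: (@le_lt_trans _ _ (\sum_(i < n) (e / n.+1%:R)%:E)).
  apply: lee_sum => i _; apply/ltW.
  under [X in msq P _ X]eq_fun do rewrite /vstep !tnth_mktuple.
  exact: sP.
rewrite sumEFin lte_fin sumr_const card_ord -[X in (X < _)%R]mulr_natr mulrAC ltr_pdivrMr//.
by rewrite ltr_pM2l// ltr_nat.
Qed.

End vector_steps.

Section finite_valued.
Context {R : realType} {d} {T : measurableType d} {I : finType}.
Variable h : T -> I.
Hypothesis mh : forall i, measurable [set t | h t = i].

Lemma fin_indicE (v : I -> R) t : v (h t) = (\sum_i v i * \1_[set t | h t = i] t)%R.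
Proof.
rewrite (bigD1 (h t))//= indicE mem_set// mulr1 big1 ?addr0// => i ih.
by rewrite indicE memNset ?mulr0//= => hi; rewrite hi eqxx in ih.
Qed.

Lemma measurable_fun_fin (v : I -> R) : measurable_fun setT (fun t => v (h t)).
Proof.
under eq_fun do rewrite fin_indicE.
by apply: measurable_sum => i; apply: measurable_funM => //; exact: measurable_indic.
Qed.

Lemma integral_fin (Q : probability T R) (v : I -> R) : (forall i, 0 <= v i)%R ->
  \int[Q]_t (v (h t))%:E = \sum_i (v i)%:E * Q [set t | h t = i].
Proof.
move=> v0; under eq_integral do rewrite fin_indicE -sumEFin.
rewrite ge0_integral_sum//.
- apply: eq_bigr => i _; under eq_integral do rewrite EFinM.
  rewrite ge0_integralZl// ?lee_fin//; last exact/measurable_EFinP/measurable_indic.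
  by rewrite integral_indic// setIT.
- by move=> i; apply/measurable_EFinP/measurable_funM => //; exact: measurable_indic.
- by move=> i t _; rewrite lee_fin mulr_ge0.
Qed.

Lemma measure_fin (Q : probability T R) (A : set T) : measurable A ->
  Q A = \sum_i Q (A `&` [set t | h t = i]).
Proof.
move=> mA; rewrite -[LHS](_ : \int[Q]_t (\1_A t)%:E = _); last by rewrite integral_indic// setIT.
transitivity (\int[Q]_t (\sum_i (\1_(A `&` [set t | h t = i]) t)%:E)).
  apply: eq_integral => t _; rewrite sumEFin; congr EFin.
  under eq_bigr do rewrite indicI.
  rewrite /= -mulr_sumr -[LHS]mulr1; congr (_ * _)%R.
  rewrite (fin_indicE (fun=> 1%R) t); apply: eq_bigr => i _; exact: mul1r.
rewrite ge0_integral_sum//.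
- by apply: eq_bigr => i _; rewrite integral_indic ?setIT//; exact: measurableI.
- by move=> i; apply/measurable_EFinP/measurable_indic; exact: measurableI.
Qed.

End finite_valued.

(** * Rearrangements of [0, 1] *)

Section levels.
Context {R : realType}.

(** Constancy on each interval [[i/N, (i+1)/N[] of the nonnegative half-line. *)
Definition level (T : Type) (N : nat) (g : R -> T) :=
  forall u v : R, (0 <= u)%R -> (0 <= v)%R ->
    Num.truncn (N%:R * u) = Num.truncn (N%:R * v) -> g u = g v.

(** [N] is a product of the denominators of the breakpoints, so that every nonnegative breakpoint
    falls between two cells. The factor [m] is what gives several step functions a common
    subdivision. *)
Lemma rstep_level (s : seq (rat * rat)) : exists2 N, (0 < N)%N &
  forall m, (0 < m)%N -> level (N * m) (rstep (R:=R) s).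
Proof.
elim: s => [|[c q] s [N N0 ih]].
  by exists 1%N => // m _ u v _ _ _; rewrite /rstep !big_nil.
exists (`|denq q| * N)%N; first by rewrite muln_gt0 absz_gt0 denq_neq0.
move=> m m0 u v u0 v0 uv.
rewrite /rstep !big_cons -!/(rstep _ _) /=; congr (_ + _)%R; last first.
  apply: (ih (`|denq q| * m)%N) => //.
    by rewrite muln_gt0 absz_gt0 denq_neq0.
  by rewrite mulnA (mulnC N).
congr (_ * _%:R)%R; congr nat_of_bool.
have [q0|q0] := ltP q 0%R.
  by rewrite !ltNge !(le_trans _ u0, le_trans _ v0)// ?lerq0 ltW.
have M0 : (0 < (`|denq q| * N * m)%:R :> R)%R.
  by rewrite ltr0n !muln_gt0 absz_gt0 denq_neq0 N0.
have [k kE] : exists k : nat, ((`|denq q| * N * m)%:R * ratr q = k%:R :> R)%R.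
  exists (`|numq q| * N * m)%N.
  have dq : (`|denq q|%:R * ratr q = `|numq q|%:R :> R)%R.
    rewrite -[q in ratr q]divq_num_den fmorph_div/= !ratr_int.
    rewrite !pmulrn absz_denq gez0_abs ?numq_ge0//.
    by rewrite mulrC divfK// intr_eq0 denq_neq0.
  by rewrite !natrM -dq; ring.
have E (w : R) : (0 <= w)%R -> (w < ratr q)%R = (Num.truncn ((`|denq q| * N * m)%:R * w)%R < k)%N.
  by move=> w0; rewrite -(ltr_pM2l M0) kE truncn_lt_nat ?mulr_ge0.
by rewrite !E// uv.
Qed.

Lemma vstep_level n (S : n.-tuple (seq (rat * rat))) : exists2 N, (0 < N)%N &
  forall m, (0 < m)%N -> level (N * m) (vstep (R:=R) S).
Proof.
have /choice[N NP] i : exists N, (0 < N)%N /\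
    forall m, (0 < m)%N -> level (N * m) (rstep (R:=R) (tnth S i)).
  by have [N N0 NP] := rstep_level (tnth S i); exists N.
exists (\prod_(i < n) N i)%N.
  by rewrite prodn_gt0// => i; have [] := NP i.
move=> m m0 u v u0 v0 uv; apply: eq_from_tnth => i; rewrite !tnth_mktuple.
have [Ni0 Ni] := NP i.
apply: (Ni ((\prod_(j < n | j != i) N j) * m)%N) => //.
  by rewrite muln_gt0 m0 andbT prodn_gt0// => j; have [] := NP j.
by rewrite mulnA; move: uv; rewrite (bigD1 i).
Qed.

Variable n : nat.
Local Notation N := n.+1.

(** Meant on [[0, 1[]; every other real is sent to the cell of index 0. *)
Definition cell (u : R) : 'I_N := inord (Num.truncn (N%:R * u)).

Lemma cellE u : (0 <= u < 1)%R -> cell u = Num.truncn (N%:R * u) :> nat.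
Proof.
move=> /andP[u0 u1]; rewrite inordK// truncn_lt_nat ?mulr_ge0//.
by rewrite -[ltRHS]mulr1 ltr_pM2l.
Qed.

Lemma cell_itv u (i : 'I_N) : (0 <= u < 1)%R ->
  (cell u == i) = (i%:R / N%:R <= u < i.+1%:R / N%:R)%R.
Proof.
move=> u01; rewrite -val_eqE/= cellE// truncn_eq; last first.
  by rewrite mulr_ge0//; case/andP: u01.
by rewrite ler_pdivrMr// ltr_pdivlMr// mulrC.
Qed.

Lemma measurable_cell (i : 'I_N) : measurable [set u | cell u = i].
Proof.
have mle m : measurable [set u : R | (Num.truncn (N%:R * u)%R <= m)%N].
  under eq_set do rewrite truncn_le_nat.
  rewrite -[X in measurable X]setTI -preimage_itvNyo.
  have mN : measurable_fun setT (fun u : R => N%:R * u)%R.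
    exact: measurable_funM.
  exact: mN.
have meq m : measurable [set u : R | Num.truncn (N%:R * u) = m].
  case: m => [|m].
    rewrite (_ : [set _ | _] = [set u : R | (Num.truncn (N%:R * u)%R <= 0)%N])//.
    by apply/seteqP; split => u /=; [move=> ->|rewrite leqn0 => /eqP].
  rewrite (_ : [set _ | _] = [set u : R | (Num.truncn (N%:R * u)%R <= m.+1)%N] `\`
     [set u : R | (Num.truncn (N%:R * u)%R <= m)%N]); first exact: measurableD.
  apply/seteqP; split => u /=; first by move=> ->; rewrite ltnn.
  by move=> [h1 /negP]; rewrite -ltnNge => h2; apply/eqP; rewrite eqn_leq h1.
rewrite (_ : [set u | _] = \bigcup_m if inord m == i then
    [set u : R | Num.truncn (N%:R * u) = m] else set0).
  by apply: bigcupT_measurable => m; case: ifP.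
apply/seteqP; split => u /=.
  by move=> ui; exists (Num.truncn (N%:R * u)) => //; rewrite -/(cell u) ui eqxx.
by move=> [m _]; case: ifP => // /eqP <- /= um; rewrite /cell um.
Qed.

Lemma natr_divS (k : nat) : (k.+1%:R / N%:R = k%:R / N%:R + N%:R^-1 :> R)%R.
Proof. by rewrite -natr1 mulrDl mul1r. Qed.

Lemma cell_bounds u : (0 <= u < 1)%R ->
  ((cell u)%:R / N%:R <= u < (cell u)%:R / N%:R + N%:R^-1)%R.
Proof. by move=> u01; have := cell_itv (cell u) u01; rewrite eqxx natr_divS => /esym. Qed.

Lemma natr_divN_le1 (i : 'I_N) : (i.+1%:R / N%:R <= 1 :> R)%R.
Proof. by rewrite ler_pdivrMr// mul1r ler_nat. Qed.

Lemma cell_setI (i : 'I_N) :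
  [set u | cell u = i] `&` `[0%R, 1%R[%classic =
  `[(i%:R / N%:R)%R, (i.+1%:R / N%:R)%R[%classic.
Proof.
apply/seteqP; split => u /=; rewrite !in_itv/=.
  by move=> [/eqP ui u01]; rewrite -cell_itv.
move=> /andP[u0 u1].
have u01 : (0 <= u < 1)%R.
  rewrite (le_trans _ u0) ?divr_ge0//= (lt_le_trans u1)//.
  exact: natr_divN_le1.
by split => //; apply/eqP; rewrite cell_itv// u0.
Qed.

Lemma lam_cell (i : 'I_N) : lam [set u : R | cell u = i] = (N%:R^-1)%:E.
Proof.
rewrite -(@prob_measureI_full _ _ _ lam `[0%R, 1%R[%classic) ?lam_unit_co//.
  rewrite cell_setI lam_itvoo ?divr_ge0 ?natr_divN_le1//.
    by rewrite -mulrBl -natrB// subSnn mul1r.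
  by rewrite ler_pM2r ?invr_gt0// ler_nat.
exact: measurable_cell.
Qed.

Lemma lam_cells (A : set R) : measurable A ->
  lam A = \sum_(i < N) lam (A `&` [set u | cell u = i]).
Proof. by apply: measure_fin; exact: measurable_cell. Qed.

(* [act sigma] translates the [i]-th cell of length [1/N] onto the [sigma i]-th one. *)
Definition act (sigma : 'S_N) (u : R) : R :=
  if (0 <= u < 1)%R then (u + ((sigma (cell u))%:R - (cell u)%:R) / N%:R)%R else u.

Lemma act_itv sigma u : (0 <= u < 1)%R -> (0 <= act sigma u < 1)%R.
Proof.
move=> u01; rewrite /act u01.
have /andP[u0 u1] := cell_bounds u01.
have s0 : (0 <= (sigma (cell u))%:R / N%:R :> R)%R by rewrite divr_ge0.
have s1 := natr_divN_le1 (sigma (cell u)); rewrite natr_divS in s1.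
rewrite mulrBl; set a := (_ / _)%R in u0 u1 *; set b := (_ / _)%R in s0 s1 *.
by move: N%:R^-1%R u1 s1 => c; lra.
Qed.

Lemma cell_act sigma u : (0 <= u < 1)%R -> cell (act sigma u) = sigma (cell u).
Proof.
move=> u01; apply/eqP; rewrite cell_itv ?act_itv//.
have /andP[u0 u1] := cell_bounds u01.
rewrite natr_divS /act u01 mulrBl.
set a := (_ / _)%R in u0 u1 *; set b := (_ / _)%R.
by move: N%:R^-1%R u1 => c; lra.
Qed.

Lemma measurable_act sigma : measurable_fun setT (act sigma).
Proof.
have mid : measurable_fun setT (fun u : R => u) by exact: measurable_id.
apply: measurable_fun_if => //.
- by apply: measurable_and; [exact: measurable_fun_ler|exact: measurable_fun_ltr].
- apply: measurable_funTS; apply: measurable_funD => //.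
  exact: (measurable_fun_fin measurable_cell (fun i => ((sigma i)%:R - i%:R) / N%:R)%R).
Qed.

Lemma lam_itv_shift (a b a' b' : R) : (0 <= a)%R -> (0 <= a')%R -> (b <= 1)%R ->
  (b' <= 1)%R -> (b - a = b' - a')%R -> lam `[a, b[%classic = lam `[a', b'[%classic.
Proof.
move=> a0 a'0 b1 b'1 ba; have [ab|ab] := leP a b.
  by rewrite !lam_itvoo// ?ba//; lra.
by rewrite !set_itv_ge ?measure0// bnd_simp -leNgt; lra.
Qed.

(** It suffices to treat half-lines. Inside the [i]-th cell, the preimage of []-oo, t[] is a
    translate of the part of []-oo, t[] inside the [sigma i]-th cell, and [sigma] reindexes the sum
    over the cells. *)
Lemma lam_act sigma (A : set R) : measurable A ->
  lam (act sigma @^-1` A) = lam A.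
Proof.
have m01 : measurable (`[0%R, 1%R[%classic : set R) by [].
have mact := measurable_act sigma.
have lI (B : set R) : measurable B -> lam B = lam (B `&` `[0%R, 1%R[%classic).
  by move=> mB; rewrite prob_measureI_full// lam_unit_co.
suff H : forall t : R, law lam mact `]-oo, t[%classic = lam `]-oo, t[%classic.
  by move=> mA; rewrite -[RHS](prob_eqR H mA).
move=> t; rewrite [LHS]lawE.
have mpre : measurable (act sigma @^-1` `]-oo, t[%classic).
  by rewrite -[X in measurable X]setTI; exact: mact.
rewrite [LHS](lam_cells mpre) [RHS]lam_cells//.
rewrite [RHS](reindex_inj (@perm_inj _ sigma))/=; apply: eq_bigr => i _.
have mi := measurable_cell.
rewrite [LHS]lI; last exact: measurableI.
rewrite [RHS]lI; last exact: measurableI.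
rewrite -!setIA !cell_setI.
pose t' : R := (t - ((sigma i)%:R - i%:R) / N%:R)%R.
have -> : act sigma @^-1` `]-oo, t[ `&` `[(i%:R / N%:R)%R, (i.+1%:R / N%:R)%R[%classic
   = `[(i%:R / N%:R)%R, (Num.min (i.+1%:R / N%:R) t')%R[%classic.
  have E u : (i%:R / N%:R <= u < i.+1%:R / N%:R)%R ->
      act sigma u = (u + ((sigma i)%:R - i%:R) / N%:R)%R.
    move=> ui; have : (`[(i%:R / N%:R)%R, (i.+1%:R / N%:R)%R[%classic : set R) u.
      by rewrite /= in_itv.
    by rewrite -cell_setI /= in_itv/= => -[ci u01]; rewrite /act u01 ci.
  apply/seteqP; split => u /=; rewrite !in_itv/= lt_min.
    by move=> [+ ui]; rewrite E// => ut; case/andP: ui => -> -> /=; rewrite /t' ltrBrDr.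
  move=> /and3P[u1 u2 ut]; rewrite E ?u1//; split => //.
  by move: ut; rewrite /t' ltrBrDr.
have -> : `]-oo, t[%classic `&` `[((sigma i)%:R / N%:R)%R, ((sigma i).+1%:R / N%:R)%R[%classic
   = `[((sigma i)%:R / N%:R)%R, (Num.min ((sigma i).+1%:R / N%:R) t)%R[%classic.
  apply/seteqP; split => u /=; rewrite !in_itv/= lt_min.
    by move=> [-> /andP[-> ->]].
  by move=> /and3P[-> -> ->].
apply: lam_itv_shift.
- by rewrite divr_ge0.
- by rewrite divr_ge0.
- by rewrite ge_min natr_divN_le1.
- by rewrite ge_min natr_divN_le1.
- rewrite /t' !natr_divS mulrBl.
  set a := (i%:R / _)%R; set b := ((sigma i)%:R / _)%R; move: N%:R^-1%R => c.
  by rewrite /Num.min; do 2 case: ifPn; rewrite -?leNgt => ? ?; lra.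
Qed.

End levels.

(** * From couplings to rearrangements *)

Section discrete_transport.
Context {R : realType} {n k : nat}.
Local Notation Rn := (n.-tuple R).
Local Notation N := k.+1.

Lemma level_cell (g : R -> Rn) : level N g -> forall u, (0 <= u < 1)%R ->
  g u = g ((cell k u)%:R / N%:R)%R.
Proof.
move=> gN u u01; case/andP: (u01) => u0 u1; apply: gN => //.
by rewrite [in RHS]mulrC divfK// natrK cellE.
Qed.

Lemma ae_unit : {ae @lam R, forall u, (0 <= u < 1)%R}.
Proof.
exists (~` `[0%R, 1%R[%classic); split.
- exact: measurableC.
- by rewrite probability_setC// lam_unit_co subee.
- by move=> u /= + u01; apply; move: u01; rewrite /= in_itv.
Qed.

(* The joint law of the cells of [U1] and [U2] is, up to scaling, doubly stochastic. *)
Lemma discrete_transport (g1 g2 : R -> Rn) d (T : measurableType d)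
    (Q : probability T R) (U1 U2 : T -> R) :
  measurable_fun setT g1 -> measurable_fun setT g2 -> level N g1 -> level N g2 ->
  measurable_fun setT U1 -> measurable_fun setT U2 ->
  (forall A, measurable A -> Q (U1 @^-1` A) = lam A) ->
  (forall A, measurable A -> Q (U2 @^-1` A) = lam A) ->
  exists sigma : 'S_N, L2sq lam g1 (g2 \o act sigma) <= L2sq Q (g1 \o U1) (g2 \o U2).
Proof.
move=> mg1 mg2 lg1 lg2 mU1 mU2 QU1 QU2.
pose v1 (i : 'I_N) := g1 (i%:R / N%:R)%R; pose v2 (i : 'I_N) := g2 (i%:R / N%:R)%R.
pose c i j : R := edist2 (v1 i) (v2 j).
have c0 i j : (0 <= c i j)%R by exact: edist2_ge0.
have mc := @measurable_cell R k.
have mUc (U : T -> R) (i : 'I_N) : measurable_fun setT U -> measurable [set t | cell k (U t) = i].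
  by move=> mU; rewrite -[X in measurable X]setTI; exact: mU (mc i).
have m1 i := mUc U1 i mU1; have m2 i := mUc U2 i mU2.
pose A i := [set t | cell k (U1 t) = i]; pose B j := [set t | cell k (U2 t) = j].
pose p i j : R := fine (Q (A i `&` B j)).
have mAB i j : measurable (A i `&` B j) by apply: measurableI; [exact: m1|exact: m2].
have pE i j : Q (A i `&` B j) = (p i j)%:E by rewrite fineK// fin_num_measure.
have QA i : Q (A i) = (N%:R^-1)%:E by rewrite (QU1 _ (mc i)) lam_cell.
have QB j : Q (B j) = (N%:R^-1)%:E by rewrite (QU2 _ (mc j)) lam_cell.
have prow i : (\sum_j p i j = N%:R^-1)%R.
  apply: EFin_inj; rewrite -(QA i) (measure_fin m2 Q (m1 i)) -sumEFin.
  by apply: eq_bigr => j _; rewrite -pE.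
have pcol j : (\sum_i p i j = N%:R^-1)%R.
  apply: EFin_inj; rewrite -(QB j) (measure_fin m1 Q (m2 j)) -sumEFin.
  by apply: eq_bigr => i _; rewrite -pE setIC.
have p0 i j : (0 <= p i j)%R by rewrite fine_ge0.
have [sigma sP] := birkhoff_le c p0 prow pcol.
exists sigma.
have -> : L2sq lam g1 (g2 \o act sigma) = (N%:R^-1 * \sum_i c i (sigma i))%:E.
  transitivity (\int[lam]_u (c (cell k u) (sigma (cell k u)))%:E).
    apply: ae_eq_integral => //.
    - apply/measurable_EFinP; apply: measurable_edist2 => //.
      by apply: measurableT_comp mg2 _; exact: measurable_act.
    - apply/measurable_EFinP.
      exact: (measurable_fun_fin mc (fun i => c i (sigma i))).
    - apply: filterS ae_unit => u u01 _ /=; congr EFin.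
      rewrite (level_cell lg1 u01) (level_cell lg2 (act_itv sigma u01)).
      by rewrite cell_act.
  rewrite (integral_fin mc lam (v := fun i => c i (sigma i)))//.
  under eq_bigr do rewrite lam_cell -EFinM.
  by rewrite sumEFin mulr_sumr; congr EFin; apply: eq_bigr => i _; rewrite mulrC.
have -> : L2sq Q (g1 \o U1) (g2 \o U2) = (\sum_i \sum_j c i j * p i j)%:E.
  pose h t := (cell k (U1 t), cell k (U2 t)).
  have hE ij : [set t | h t = ij] = A ij.1 `&` B ij.2.
    by case: ij => i j; apply/seteqP; split => t; rewrite /h /A /B /=; [case=> -> ->|case=> -> ->].
  have mh ij : measurable [set t | h t = ij] by rewrite hE.
  transitivity (\int[Q]_t (c (h t).1 (h t).2)%:E).
    apply: ae_eq_integral => //.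
    - apply/measurable_EFinP; apply: measurable_edist2; exact: measurableT_comp.
    - apply/measurable_EFinP.
      exact: (measurable_fun_fin mh (fun ij => c ij.1 ij.2)).
    - have aeU (U : T -> R) : measurable_fun setT U ->
          (forall A, measurable A -> Q (U @^-1` A) = lam A) ->
          {ae Q, forall t, (0 <= U t < 1)%R}.
        move=> mU QU; exists (U @^-1` (~` `[0%R, 1%R[%classic)); split.
        + rewrite -[X in measurable X]setTI; apply: mU => //; exact: measurableC.
        + rewrite [LHS]QU ?probability_setC ?lam_unit_co ?subee//; exact: measurableC.
        + by move=> t /= + t01; apply; move: t01; rewrite /= in_itv.
      apply: filterS2 (aeU _ mU1 QU1) (aeU _ mU2 QU2) => t u1 u2 _ /=; congr EFin.
      by rewrite (level_cell lg1 u1) (level_cell lg2 u2).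
  rewrite (integral_fin mh Q (v := fun ij => c ij.1 ij.2))//.
  rewrite pair_bigA/= -sumEFin; apply: eq_bigr => ij _.
  by rewrite hE pE EFinM.
by rewrite lee_fin.
Qed.

End discrete_transport.

Section coupling_lift.
Context {R : realType} {n : nat} {d} {T : measurableType d}.
Local Notation Rn := (n.-tuple R).
Variable gamma : probability T R.
Local Notation Q := (gamma \x (@lam R)).

Lemma prod_fst (A : set T) : measurable A -> Q (fst @^-1` A) = gamma A.
Proof.
move=> mA; rewrite (_ : _ @^-1` _ = A `*` setT); last first.
  by apply/seteqP; split => -[x y] //= [].
by rewrite [LHS]product_measure1E// [X in _ * X]probability_setT mule1.
Qed.

Lemma L2sq_fst (f g : T -> Rn) : measurable_fun setT f -> measurable_fun setT g ->
  L2sq Q (f \o fst) (g \o fst) = L2sq gamma f g.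
Proof.
move=> mf mg; have mfst : measurable_fun setT (@fst T R) by exact: measurable_fst.
rewrite -(L2sq_law Q mfst mf mg); apply: eq_measure_integral => A mA _.
exact: prod_fst.
Qed.

(* [X] has the law of [h] under [lam]; sampling the conditional law of [u] given
   [h u = X], by means of the extra uniform variable, yields [U]. *)
Lemma coupling_lift (X : T -> Rn) (h : R -> Rn) :
  measurable_fun setT X -> measurable_fun setT h ->
  (forall A, measurable A -> gamma (X @^-1` A) = lam (h @^-1` A)) ->
  exists U : T * R -> R, [/\ measurable_fun setT U,
    (forall A, measurable A -> Q (U @^-1` A) = lam A) &
    L2sq Q (h \o U) (X \o fst) = 0].
Proof.
move=> mX mh Xh.
have mgr : measurable_fun setT (fun u : R => (u, h u)) by exact/measurable_fun_pair.
have mgrE (C : set (R * Rn)) : measurable C -> measurable ((fun u : R => (u, h u)) @^-1` C).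
  by move=> mC; rewrite -[X in measurable X]setTI; exact: mgr.
(* Disintegrates the law of [(u, h u)] along its second coordinate: for a uniform [v], [K (x, v)]
   has the law of [u] given [h u = x]. *)
have [] := @disintegration_noise _ _ _ _ _ (law lam mgr) (law lam mh).
- move=> B mB; rewrite [LHS]lawE [RHS]lawE; congr (lam _).
  by apply/seteqP; split => u //= [].
- exact: encodable_R.
move=> K [mK KP].
pose Z z : Rn * R := (X z.1, z.2).
have mZ : measurable_fun setT Z.
  by apply/measurable_fun_pair => //; exact: measurableT_comp.
have ZP C : measurable C -> law Q mZ C = (law lam mh \x lam) C.
  apply: prob_eq_prod => A B mA mB.
  rewrite [RHS]product_measure1E// [LHS]lawE.
  rewrite (_ : Z @^-1` (A `*` B) = (X @^-1` A) `*` B)//.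
  rewrite [LHS]product_measure1E//; last first.
    by rewrite -[X in measurable X]setTI; exact: mX.
  by congr (_ * _); exact: Xh.
pose U z := K (Z z).
have mU : measurable_fun setT U by exact: measurableT_comp.
pose W z : R * Rn := (U z, X z.1).
have mW : measurable_fun setT W.
  by apply/measurable_fun_pair => //; exact: measurableT_comp.
(* [(U, X)] has the law of [(u, h u)]: so [U] is uniform, and [h o U = X] almost surely because the
   law is carried by the graph of [h]. *)
have WP C : measurable C -> law Q mW C = law lam mgr C.
  move=> mC; rewrite KP//.
  have mC' : measurable ((fun z : Rn * R => (K z, z.1)) @^-1` C).
    by rewrite -[X in measurable X]setTI; exact: measurable_graph.
  exact: (ZP _ mC').
exists U; split => //.
- move=> A mA; have := WP (A `*` setT) (measurableX mA measurableT).
  rewrite [X in X = _ -> _]lawE [X in _ = X -> _]lawE.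
  rewrite (_ : W @^-1` _ = U @^-1` A); last by apply/seteqP; split => z //= [].
  by move=> ->; congr (lam _); apply/seteqP; split => z //= [].
- have m1 : measurable_fun setT (h \o @fst R Rn) by exact: measurableT_comp.
  have m2 : measurable_fun setT (@snd R Rn) by exact: measurable_snd.
  rewrite -[LHS](L2sq_law Q mW m1 m2).
  transitivity (L2sq (law lam mgr) (h \o fst) snd).
    by apply: eq_measure_integral => A mA _; exact: WP.
  by rewrite L2sq_law// L2sqxx.
Qed.

End coupling_lift.

Section transport.
Context {R : realType} {n : nat}.
Local Notation Rn := (n.-tuple R).
Local Notation origin := [tuple 0%R | i < n].

Lemma L2sq_act (k : nat) (sigma : 'S_k.+1) (f g : R -> Rn) :
  measurable_fun setT f -> measurable_fun setT g ->
  L2sq lam (f \o act sigma) (g \o act sigma) = L2sq lam f g.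
Proof.
move=> mf mg; rewrite -(L2sq_law lam (measurable_act sigma) mf mg).
by apply: eq_measure_integral => A mA _; exact: lam_act.
Qed.

(** Each [h] is exchanged for a step function twice, once under [lam] and once under the lifted
    coupling: four errors of [r = e / 4]. The product [N1 * N2] is a subdivision common to both step
    functions. *)
Lemma transport_le (h1 h2 : R -> Rn) (gamma : probability (Rn * Rn)%type R) (e : R) :
  measurable_fun setT h1 -> measurable_fun setT h2 ->
  L2sq lam h1 (cst origin) < +oo -> L2sq lam h2 (cst origin) < +oo ->
  (forall A, measurable A -> gamma (fst @^-1` A) = lam (h1 @^-1` A)) ->
  (forall A, measurable A -> gamma (snd @^-1` A) = lam (h2 @^-1` A)) ->
  (0 < e)%R ->
  exists k (sigma : 'S_k.+1),
    sqrte (L2sq lam h1 (h2 \o act sigma)) <= sqrte (L2sq gamma fst snd) + e%:E.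
Proof.
move=> mh1 mh2 h1oo h2oo g1 g2 e0.
pose r := (e / 4)%R; have r0 : (0 < r)%R by rewrite divr_gt0.
have r20 : (0 < r ^+ 2)%R by rewrite exprn_gt0.
have [S1 S1P] := vstep_dense mh1 h1oo r20; have [S2 S2P] := vstep_dense mh2 h2oo r20.
have [N1 N10 l1] := vstep_level (R := R) S1; have [N2 N20 l2] := vstep_level (R := R) S2.
have N0 : (0 < N1 * N2)%N by rewrite muln_gt0 N10.
pose k := (N1 * N2).-1; have kE : k.+1 = (N1 * N2)%N by rewrite prednK.
have {}l1 : level k.+1 (vstep (R := R) S1) by rewrite kE; exact: l1.
have {}l2 : level k.+1 (vstep (R := R) S2) by rewrite kE mulnC; exact: l2.
set s1 := vstep S1 in S1P l1; set s2 := vstep S2 in S2P l2.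
have ms1 : measurable_fun setT s1 by exact: measurable_vstep.
have ms2 : measurable_fun setT s2 by exact: measurable_vstep.
have sr (x : \bar R) : 0 <= x -> x < (r ^+ 2)%:E -> sqrte x <= r%:E.
  have -> : r%:E = sqrte (r ^+ 2)%:E by rewrite /= sqrtr_sqr ger0_norm// ltW.
  by move=> x0 xr; rewrite lee_sqrt ?ltW// lee_fin ltW.
have {}S1P := sr _ (L2sq_ge0 _ _ _) S1P; have {}S2P := sr _ (L2sq_ge0 _ _ _) S2P.
have mf : measurable_fun setT (@fst Rn Rn) by exact: measurable_fst.
have ms : measurable_fun setT (@snd Rn Rn) by exact: measurable_snd.
have [U1 [mU1 QU1 U1X]] := coupling_lift mf mh1 g1.
have [U2 [mU2 QU2 U2X]] := coupling_lift ms mh2 g2.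
have [sigma sP] := discrete_transport ms1 ms2 l1 l2 mU1 mU2 QU1 QU2.
exists k, sigma.
pose Q := gamma \x (@lam R).
have QU (U : (Rn * Rn) * R -> R) (mU : measurable_fun setT U) f g :
    (forall A, measurable A -> Q (U @^-1` A) = lam A) ->
    measurable_fun setT f -> measurable_fun setT g ->
    L2sq Q (f \o U) (g \o U) = L2sq lam f g :> \bar R.
  move=> QU mf' mg'; rewrite -(L2sq_law Q mU mf' mg').
  by apply: eq_measure_integral => A mA _; exact: QU.
have mact := measurable_act (R := R) sigma.
have mfQ : measurable_fun setT ((@fst Rn Rn) \o (@fst _ R)) by exact: measurableT_comp.
have msQ : measurable_fun setT ((@snd Rn Rn) \o (@fst _ R)) by exact: measurableT_comp.
have mc (f : R -> Rn) (U : (Rn * Rn) * R -> R) : measurable_fun setT f ->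
   measurable_fun setT U -> measurable_fun setT (f \o U) by move=> ? ?; exact: measurableT_comp.
have step1 : sqrte (L2sq Q (s1 \o U1) (s2 \o U2)) <=
    r%:E + (0 + (sqrte (L2sq gamma fst snd) + (0 + r%:E))).
  apply: (le_trans (L2_triangle Q (mc _ _ ms1 mU1) (mc _ _ mh1 mU1) (mc _ _ ms2 mU2))).
  apply: leeD; first by rewrite QU// L2sqC.
  apply: (le_trans (L2_triangle Q (mc _ _ mh1 mU1) mfQ (mc _ _ ms2 mU2))).
  apply: leeD; first by rewrite U1X sqrte0.
  apply: (le_trans (L2_triangle Q mfQ msQ (mc _ _ ms2 mU2))).
  apply: leeD; first by rewrite L2sq_fst.
  apply: (le_trans (L2_triangle Q msQ (mc _ _ mh2 mU2) (mc _ _ ms2 mU2))).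
  by apply: leeD; [rewrite L2sqC U2X sqrte0|rewrite QU].
have ma (f : R -> Rn) : measurable_fun setT f -> measurable_fun setT (f \o act sigma).
  by move=> ?; exact: measurableT_comp.
apply: (@le_trans _ _ (r%:E + ((r%:E + (0 + (sqrte (L2sq gamma fst snd) + (0 + r%:E)))) + r%:E))).
  apply: (le_trans (L2_triangle lam mh1 ms1 (ma _ mh2))); apply: leeD => //.
  apply: (le_trans (L2_triangle lam ms1 (ma _ ms2) (ma _ mh2))); apply: leeD.
    by apply: le_trans step1; rewrite lee_sqrt// L2sq_ge0.
  by rewrite L2sq_act// L2sqC.
rewrite !add0e; case: (sqrte _) (sqrte_ge0 (L2sq gamma fst snd)) => [x| |]// _.
by rewrite -!EFinD lee_fin /r; lra.
Qed.

End transport.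

(** * Integrals of functions not known to be measurable *)

Section integral_extra.
Context {R : realType} {d} {T : measurableType d}.

(* The integral of a nonnegative function is a supremum over the simple functions
   below it, so that measurability is not needed for monotonicity. *)
Lemma ge0_le_integral_sup (mu : {measure set T -> \bar R}) (f g : T -> \bar R) :
  (forall x, 0 <= f x) -> (forall x, f x <= g x) ->
  \int[mu]_x f x <= \int[mu]_x g x.
Proof.
move=> f0 fg; have g0 x : 0 <= g x by rewrite (le_trans (f0 x)).
rewrite !ge0_integralTE//; apply: le_ereal_sup => _ [h hf <-].
by exists h => //= x; rewrite (le_trans (hf x)).
Qed.

(** Used to integrate [W2 ^+ 2] along disintegrations without knowing that it is measurable. On the
    null set [f] lies between 0 and +oo, and replacing [g] there by either constant keeps its
    integral. *)
Lemma ge0_ae_eq_integral_sup (mu : {measure set T -> \bar R}) (f g : T -> \bar R) :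
  (forall x, 0 <= f x) -> (forall x, 0 <= g x) -> measurable_fun setT g ->
  {ae mu, forall x, f x = g x} ->
  \int[mu]_x f x = \int[mu]_x g x.
Proof.
move=> f0 g0 mg [N [mN N0 Nfg]].
have fgN x : ~ N x -> f x = g x by move=> Nx; apply: contrapT => fgx; apply: Nx; exact: Nfg.
have mm : measurable_fun setT (fun w => w \in N).
  apply: (measurable_fun_bool true); rewrite setTI.
  by rewrite (_ : _ @^-1` _ = N)//; apply/seteqP; split => w /=; [move=> /set_mem|move=> /mem_set].
have E c : 0 <= c -> \int[mu]_x (if x \in N then c else g x) = \int[mu]_x g x.
  move=> c0; apply: ge0_ae_eq_integral => //.
  - by apply: measurable_fun_if => //; exact: measurable_funTS.
  - by move=> x _; case: ifP.
  - exists N; split => // x /= H; apply: contrapT => Nx; apply: H => _.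
    by rewrite memNset.
apply/eqP; rewrite eq_le; apply/andP; split.
  rewrite -(E +oo)//; apply: ge0_le_integral_sup => // x.
  case: ifPn => [_|]; first by rewrite leey.
  by rewrite notin_setE => /fgN ->.
rewrite -(E 0)//; apply: ge0_le_integral_sup => x; first by case: ifP.
by case: ifPn => //; rewrite notin_setE => /fgN ->.
Qed.

End integral_extra.

(** Countably many tests suffice, so almost sure equalities at each rational hold outside a single
    null set. *)
Lemma prob_eqR_rat (R : realType) (P1 P2 : probability R R) :
  (forall q : rat, P1 `]-oo, (ratr q : R)[%classic = P2 `]-oo, (ratr q : R)[%classic) ->
  forall A, measurable A -> P1 A = P2 A.
Proof.
move=> P12; apply: prob_eqR => t.
have [r [rnd rt tr]] := rat_seq_lt t.
have -> : `]-oo, t[%classic = \bigcup_n `]-oo, (ratr (r n) : R)[%classic.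
  apply/seteqP; split => x /=; rewrite in_itv/=.
    by move=> /tr[n xn]; exists n => //=; rewrite in_itv.
  by move=> [n _] /=; rewrite in_itv/= => /lt_trans; apply.
have H (P : probability R R) : P `]-oo, (ratr (r n) : R)[%classic @[n --> \oo] -->
    P (\bigcup_n `]-oo, (ratr (r n) : R)[%classic).
  apply: nondecreasing_cvg_mu => //; first exact: bigcupT_measurable.
  by move=> n m nm; apply/subsetPset/subset_itvl; rewrite bnd_simp ler_rat rnd.
have H1 := H P1; have H2 := H P2.
have E : (fun n => P1 `]-oo, (ratr (r n) : R)[%classic) =
    (fun n => P2 `]-oo, (ratr (r n) : R)[%classic).
  by apply/funext => n; exact: P12.
rewrite E in H1; exact: (cvg_unique (@ereal_hausdorff R) H1 H2).
Qed.

(** * Representation of W2 and W2nu by square norms *)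

Section fiber.
Context {R : realType} {n : nat}.
Local Notation Rn := (n.-tuple R).
Local Notation origin := [tuple 0%R | i < n].

Definition rearrangement := {k : nat & 'S_k.+1}.

Definition racts (i : rearrangement) : R -> R := act (tagged i).

Definition rearr0 : rearrangement :=
  Tagged (fun k : nat => 'S_k.+1) (1%g : 'S_1).

Lemma measurable_racts i : measurable_fun setT (racts i).
Proof. exact: measurable_act. Qed.

Lemma racts0 : racts rearr0 = idfun.
Proof.
apply/funext => u; rewrite /racts /act /=; case: ifP => // _.
by rewrite perm1 subrr mul0r addr0.
Qed.

Lemma W2_sq_le (m1 m2 : {measure set Rn -> \bar R}) (h1 h2 : R -> Rn) :
  measurable_fun setT h1 -> measurable_fun setT h2 ->
  (forall A, measurable A -> m1 A = lam (h1 @^-1` A)) ->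
  (forall A, measurable A -> m2 A = lam (h2 @^-1` A)) ->
  W2 m1 m2 ^+ 2 <= L2sq lam h1 h2.
Proof.
move=> mh1 mh2 m1E m2E; rewrite /W2 sqr_sqrte; last first.
  apply: le_ereal_inf_tmp => _ [g _ <-]; apply: integral_ge0 => p _.
  by rewrite lee_fin edist2_ge0.
have mh : measurable_fun setT (fun u => (h1 u, h2 u)) by exact/measurable_fun_pair.
apply: ereal_inf_lbound; exists (law lam mh).
  by move=> A mA; split; [rewrite m1E|rewrite m2E].
have mf : measurable_fun setT (@fst Rn Rn) by exact: measurable_fst.
have ms : measurable_fun setT (@snd Rn Rn) by exact: measurable_snd.
exact: (L2sq_law lam mh mf ms).
Qed.

(** A rearranged [h2] has the same law as [h2], hence defines a coupling; conversely [transport_le]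
    bounds the infimum by any coupling. The latter is applied to square roots, where its slack is
    additive. *)
Lemma W2_sqE (m1 m2 : {measure set Rn -> \bar R}) (h1 h2 : R -> Rn) :
  measurable_fun setT h1 -> measurable_fun setT h2 ->
  L2sq lam h1 (cst origin) < +oo -> L2sq lam h2 (cst origin) < +oo ->
  (forall A, measurable A -> m1 A = lam (h1 @^-1` A)) ->
  (forall A, measurable A -> m2 A = lam (h2 @^-1` A)) ->
  W2 m1 m2 ^+ 2 = ereal_inf [set L2sq lam h1 (h2 \o racts i) | i in [set: rearrangement]].
Proof.
move=> mh1 mh2 h1oo h2oo m1E m2E.
apply/eqP; rewrite eq_le; apply/andP; split.
  apply: le_ereal_inf_tmp => _ [i _ <-].
  apply: W2_sq_le => //; first by apply: measurableT_comp => //; exact: measurable_racts.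
  move=> A mA; rewrite m2E// comp_preimage lam_act//.
  by rewrite -[X in measurable X]setTI; exact: mh2.
rewrite /W2 sqr_sqrte; last first.
  apply: le_ereal_inf_tmp => _ [g _ <-]; apply: integral_ge0 => p _.
  by rewrite lee_fin edist2_ge0.
apply: le_ereal_inf_tmp => _ [g gc <-].
change (ereal_inf [set L2sq lam h1 (h2 \o racts i) | i in [set: rearrangement]] <=
  L2sq g fst snd).
have inf0 : 0 <= ereal_inf [set L2sq lam h1 (h2 \o racts i) | i in [set: rearrangement]].
  by apply: le_ereal_inf_tmp => _ [i _ <-]; exact: L2sq_ge0.
rewrite -lee_sqrt ?L2sq_ge0//; apply/lee_addgt0Pr => e e0.
have [k [sigma H]] := @transport_le _ _ h1 h2 g e mh1 mh2 h1oo h2oo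
  (fun A mA => etrans (gc A mA).1 (m1E A mA)) (fun A mA => etrans (gc A mA).2 (m2E A mA)) e0.
apply: le_trans H; rewrite lee_sqrt ?L2sq_ge0//.
by apply: ereal_inf_lbound; exists (existT _ k sigma).
Qed.

End fiber.

(** * Representations of the elements of [P2nu] *)

Section representation.
Context {R : realType} {d : nat}.
Local Notation Rd := (d.-tuple R).
Local Notation origin := [tuple 0%R | i < d].
Variable nu : probability Rd R.
Local Notation Q := (nu \x (@lam R)).
Implicit Types (mu : P2nu nu) (H : Rd * R -> Rd).

Definition represents mu H := exists mH : measurable_fun setT H,
  forall C, measurable C -> mu C = noise_law nu mH C.

Lemma representation_exists mu : exists H, represents mu H.
Proof.
have [B mB|G [mG GP]] := @disintegration_noise _ _ _ _ _ (P2nu_measure mu) nu _ (encodable_tuple d).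
  rewrite -(P2nu_marginal mu mB); congr (P2nu_measure mu _).
  by apply/seteqP; split => -[x y] //= [].
by exists G, mG.
Qed.

Lemma L2sq_sections (F G : Rd * R -> Rd) : measurable_fun setT F ->
  measurable_fun setT G ->
  L2sq Q F G = \int[nu]_w L2sq lam (fun u => F (w, u)) (fun u => G (w, u)).
Proof.
move=> mF mG.
have mm : measurable_fun setT (fun z => (edist2 (F z) (G z))%:E).
  by apply/measurable_EFinP; exact: measurable_edist2.
have m0 z : 0 <= (edist2 (F z) (G z))%:E by rewrite lee_fin edist2_ge0.
by rewrite /L2sq (fubini_tonelli1 _ mm m0).
Qed.

Lemma measurable_L2sq_sections (F G : Rd * R -> Rd) : measurable_fun setT F ->
  measurable_fun setT G ->
  measurable_fun setT (fun w => L2sq lam (fun u => F (w, u)) (fun u => G (w, u))).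
Proof.
move=> mF mG.
have mm : measurable_fun setT (fun z => (edist2 (F z) (G z))%:E).
  by apply/measurable_EFinP; exact: measurable_edist2.
have m0 z : 0 <= (edist2 (F z) (G z))%:E by rewrite lee_fin edist2_ge0.
exact: (measurable_fun_fubini_tonelli_F _ mm m0).
Qed.

Lemma represents_moment mu H : represents mu H -> L2sq Q H (cst origin) < +oo.
Proof.
move=> [mH HE]; apply: le_lt_trans (P2nu_moment mu).
have mf : measurable_fun setT (@fst Rd Rd) by exact: measurable_fst.
have mo : measurable_fun setT (cst origin : Rd * Rd -> Rd) by exact: measurable_cst.
rewrite -(L2sq_law Q (measurable_graph mH) mf mo).
rewrite le_eqVlt; apply/orP; left; apply/eqP.
transitivity (L2sq (P2nu_measure mu) fst (cst origin)).
  by apply: eq_measure_integral => A mA _; exact: (esym (HE _ mA)).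
by apply: eq_integral => p _; rewrite enorm2E.
Qed.

(** The laws of [H (w, u)] in [u] form a disintegration, so the default kernel is never selected. *)
Lemma disintegrationP mu : is_disintegration mu (disintegration mu).
Proof.
rewrite /disintegration; case: pselect => [mu_k|]; first by case: cid.
move=> nex; exfalso; apply: nex.
have [H [mH HE]] := representation_exists mu.
have [k kE] := noise_kernel mH; exists k => A B mA mB.
rewrite HE; last exact: measurableX.
by rewrite noise_lawE//; apply: eq_integral => w _; rewrite kE.
Qed.

(** The almost sure uniqueness of disintegrations. Coding the points in [R] reduces it to half-lines
    with rational endpoints, so that one null set serves all [A]. *)
Lemma kernel_section_ae mu H (k : R.-pker Rd ~> Rd) : represents mu H ->
  is_disintegration mu k ->
  {ae nu, forall w, forall A, measurable A -> k w A = lam [set u | A (H (w, u))]}.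
Proof.
move=> [mH HE] kP; have [P Pk mP] := pker_probability k.
have [phi [psi [mphi mpsi phiK _]]] := @encodable_tuple R d.
have mq (q : rat) : measurable (phi @^-1` `]-oo, (ratr q : R)[%classic).
  by rewrite -[X in measurable X]setTI; exact: mphi.
have mHw w := measurable_section w mH.
have mHA A : measurable A -> measurable_fun setT (fun w => lam [set u | A (H (w, u))]).
  move=> mA; have mHA : measurable (H @^-1` A).
    by have := mH measurableT _ mA; rewrite setTI.
  have := measurable_fun_xsection lam mHA.
  congr measurable_fun; apply/funext => w /=; congr (lam _).
  by apply/seteqP; split => u; rewrite xsectionE.
have aeq (q : rat) : {ae nu, forall w, P w (phi @^-1` `]-oo, (ratr q : R)[%classic) =
     lam [set u | (phi @^-1` `]-oo, (ratr q : R)[%classic) (H (w, u))]}.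
  set A := phi @^-1` _.
  have mA : measurable A by exact: mq.
  have : ae_eq nu setT (fun w => P w A) (fun w => lam [set u | A (H (w, u))]).
    apply: integral_ae_eq => //.
    - apply/integrableP; split; first exact: mP.
      apply: (@le_lt_trans _ _ (\int[nu]_w 1)).
        apply: ge0_le_integral => //.
          by apply: measurableT_comp => //; exact: mP.
        by move=> w _; rewrite gee0_abs// probability_le1.
      by rewrite integral_cst// mul1e [X in X < _]probability_setT ltry.
    - exact: mHA.
    - move=> B _ mB; rewrite -noise_lawE// -HE; last exact: measurableX.
      by rewrite kP//; apply: eq_integral => w _; rewrite Pk.
  by apply: filterS => w; apply.
have : {ae nu, forall w, forall m : nat, if unpickle m is Some q then
    P w (phi @^-1` `]-oo, (ratr (q : rat) : R)[%classic) =
    lam [set u | (phi @^-1` `]-oo, (ratr q : R)[%classic) (H (w, u))] else True}.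
  apply/ae_foralln => m; case: (unpickle m) => [q|]; last exact: aeW.
  exact: aeq.
apply: filterS => w Hw A mA.
have key : forall C, measurable C -> law (P w) mphi C =
    law lam (measurableT_comp mphi (mHw w)) C.
  apply: prob_eqR_rat => q; have := Hw (pickle q); rewrite pickleK => E.
  by rewrite [LHS]lawE [RHS]lawE E.
have mpA : measurable (psi @^-1` A).
  by rewrite -[X in measurable X]setTI; exact: mpsi.
have := key _ mpA; rewrite [X in X = _ -> _]lawE [X in _ = X -> _]lawE.
rewrite -Pk (_ : phi @^-1` _ = A); last by apply/seteqP; split => x /=; rewrite phiK.
by move=> ->; congr (lam _); apply/seteqP; split => u /=; rewrite phiK.
Qed.

Lemma section_moment_ae mu H : represents mu H ->
  {ae nu, forall w, L2sq lam (fun u => H (w, u)) (cst origin) < +oo}.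
Proof.
move=> HP; have := represents_moment HP; case: HP => mH HE.
have mo : measurable_fun setT (cst origin : Rd * R -> Rd) by exact: measurable_cst.
rewrite (L2sq_sections mH mo) => foo.
have : nu.-integrable setT (fun w => L2sq lam (fun u => H (w, u)) (cst origin)).
  apply/integrableP; split; first exact: (measurable_L2sq_sections mH mo).
  by under eq_integral do rewrite gee0_abs ?L2sq_ge0//.
move=> /(integrable_ae measurableT); apply: filterS => w /(_ Logic.I).
by rewrite ge0_fin_numE// L2sq_ge0.
Qed.

Definition rearr_cost (F G : Rd * R -> Rd) (i : rearrangement) (w : Rd) : \bar R :=
  L2sq lam (fun u => F (w, u)) ((fun u => G (w, u)) \o racts i).

(** For representations, this is [W2 ^+ 2] of the fibers at almost every [w], and it is measurable
    in [w] as a countable infimum. *)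
Definition fiber_cost (F G : Rd * R -> Rd) (w : Rd) : \bar R :=
  ereal_inf [set rearr_cost F G i w | i in [set: rearrangement]].

Lemma fiber_cost_ge0 F G w : 0 <= fiber_cost F G w.
Proof. by apply: le_ereal_inf_tmp => _ [i _ <-]; exact: L2sq_ge0. Qed.

Lemma measurable_rearr (G : Rd * R -> Rd) i : measurable_fun setT G ->
  measurable_fun setT (fun z => G (z.1, racts i z.2)).
Proof.
move=> mG; apply: (measurableT_comp mG); apply/measurable_fun_pair => //.
apply: measurableT_comp; first exact: measurable_racts.
exact: measurable_snd.
Qed.

Lemma measurable_rearr_cost F G i : measurable_fun setT F -> measurable_fun setT G ->
  measurable_fun setT (rearr_cost F G i).
Proof.
move=> mF mG.
exact: (measurable_L2sq_sections mF (measurable_rearr i mG)).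
Qed.

Lemma measurable_fiber_cost F G : measurable_fun setT F -> measurable_fun setT G ->
  measurable_fun setT (fiber_cost F G).
Proof.
move=> mF mG; pose h m w := if unpickle m is Some i then rearr_cost F G i w else +oo.
rewrite (_ : fiber_cost F G = (fun w => einfs (h ^~ w) 0%N)).
  apply: measurable_fun_einfs => m; rewrite /h.
  by case: (unpickle m) => [i|]; [exact: measurable_rearr_cost|exact: measurable_cst].
apply/funext => w; apply/eqP; rewrite eq_le; apply/andP; split.
  apply: le_ereal_inf_tmp => _ [m _ <-]; rewrite /h.
  case: (unpickle m) => [i|]; last by rewrite leey.
  by apply: ereal_inf_lbound; exists i.
apply: le_ereal_inf_tmp => _ [i _ <-]; apply: ereal_inf_lbound.
by exists (pickle i) => //; rewrite /h pickleK.
Qed.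

Lemma W2nuE mu1 mu2 H1 H2 : represents mu1 H1 -> represents mu2 H2 ->
  W2nu mu1 mu2 = sqrte (\int[nu]_w fiber_cost H1 H2 w).
Proof.
move=> r1 r2; have [mH1 _] := r1; have [mH2 _] := r2.
rewrite /W2nu; congr sqrte; apply: ge0_ae_eq_integral_sup.
- by move=> w; rewrite sqre_ge0.
- by move=> w; exact: fiber_cost_ge0.
- exact: measurable_fiber_cost.
- have a1 := kernel_section_ae r1 (@disintegrationP mu1).
  have a2 := kernel_section_ae r2 (@disintegrationP mu2).
  have b1 := section_moment_ae r1; have b2 := section_moment_ae r2.
  apply: (filterS2 _ _ (filterI a1 a2) (filterI b1 b2)) => w [k1 k2] [s1 s2].
  by rewrite (W2_sqE (measurable_section w mH1) (measurable_section w mH2)).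
Qed.

Lemma W2nu_le mu1 mu2 H1 H2 : represents mu1 H1 -> represents mu2 H2 ->
  W2nu mu1 mu2 <= sqrte (L2sq Q H1 H2).
Proof.
move=> r1 r2; have [mH1 _] := r1; have [mH2 _] := r2.
rewrite (W2nuE r1 r2) lee_sqrt ?L2sq_ge0// L2sq_sections//.
apply: ge0_le_integral => //.
- by move=> w _; exact: fiber_cost_ge0.
- exact: measurable_fiber_cost.
- exact: measurable_L2sq_sections.
- by move=> w _; apply: ereal_inf_lbound; exists rearr0; rewrite // /rearr_cost racts0.
Qed.

(** Any representation [G] of [mu2] is rearranged fiber by fiber by an almost optimal element; each
    fiber keeps its law because [act] preserves [lam]. A slack of [e ^+ 2] in the squared costs
    becomes at most [e] after the square root. *)
Lemma W2nu_approx mu1 mu2 H1 (e : R) : represents mu1 H1 -> (0 < e)%R ->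
  exists2 H2, represents mu2 H2 & sqrte (L2sq Q H1 H2) <= W2nu mu1 mu2 + e%:E.
Proof.
move=> r1 e0; have [G rG] := representation_exists mu2.
have [mH1 _] := r1; have [mG GE] := rG.
have e20 : (0 < e ^+ 2)%R by rewrite exprn_gt0.
(* Integers that code no rearrangement stand for the identity, so every integer is an admissible
   index. *)
pose i_ m : rearrangement := odflt rearr0 (unpickle m).
pose J m w := rearr_cost H1 G (i_ m) w.
pose C w := fiber_cost H1 G w.
have mJ m : measurable_fun setT (J m) by exact: measurable_rearr_cost.
have mC : measurable_fun setT C by exact: measurable_fiber_cost.
have C0 w : 0 <= C w by exact: fiber_cost_ge0.
have near w : exists m, J m w <= C w + (e ^+ 2)%:E.
  have [->|Coo] := eqVneq (C w) +oo; first by exists 0%N; rewrite addye// leey.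
  have Cfin : C w \is a fin_num by rewrite ge0_fin_numE// ltey.
  have [_ [i _ <-] Ji] := lb_ereal_inf_adherent e20 Cfin.
  by exists (pickle i); rewrite /J /i_ pickleK ltW.
(* The least index is a measurable choice: [s w = m] means that [w] is in [E m] and in no earlier
   [E j]. *)
pose s w := ex_minn (near w).
have sP w : J (s w) w <= C w + (e ^+ 2)%:E by rewrite /s; case: ex_minnP.
pose E m := [set w | J m w <= C w + (e ^+ 2)%:E].
have mE m : measurable (E m).
  rewrite -[X in measurable X]setTI; apply: measurable_lee => //.
  by apply: emeasurable_funD => //; exact: measurable_cst.
have ms m : measurable [set w | s w = m].
  rewrite (_ : [set _ | _] = E m `\` \big[setU/set0]_(j < m) E j).
    by apply: measurableD => //; exact: bigsetU_measurable.
  apply/seteqP; split => w /=.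
    rewrite /s; case: ex_minnP => m' m'P minm' <-; split => //.
    rewrite -bigcup_mkord => -[j /= jm' Ejw].
    by have := minm' _ Ejw; rewrite leqNgt jm'.
  rewrite -bigcup_mkord => -[Emw nE]; rewrite /s; case: ex_minnP => m' m'P minm'.
  apply/eqP; rewrite eqn_leq minm'//= leqNgt; apply/negP => m'm.
  by apply: nE; exists m'.
pose H2 z := G (z.1, racts (i_ (s z.1)) z.2).
have mH2 : measurable_fun setT H2.
  move=> _ A mA; rewrite setTI.
  rewrite (_ : H2 @^-1` A = \bigcup_m (([set w | s w = m] `*` setT) `&`
     ((fun z => G (z.1, racts (i_ m) z.2)) @^-1` A))).
    apply: bigcupT_measurable => m; apply: measurableI; first exact: measurableX.
    by rewrite -[X in measurable X]setTI; exact: measurable_rearr.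
  apply/seteqP; split => -[w u] /=; first by move=> HA; exists (s w).
  by move=> [m _ [[/= swm _]]]; rewrite /H2/= swm.
exists H2.
  exists mH2 => Z mZ; rewrite (GE _ mZ).
  have K A B : measurable A -> measurable B ->
      noise_law nu mG (A `*` B) = noise_law nu mH2 (A `*` B).
    move=> mA mB; rewrite (noise_lawE nu mG mA mB) (noise_lawE nu mH2 mA mB).
    apply: eq_integral => w _; apply/esym.
    have mGA := measurable_section w mG measurableT mA; rewrite setTI in mGA.
    exact: (lam_act (tagged (i_ (s w))) mGA).
  exact: (prob_eq_prod K mZ).
have W0 : 0 <= \int[nu]_w C w by apply: integral_ge0 => w _; exact: C0.
rewrite (W2nuE r1 rG).
apply: (@le_trans _ _ (sqrte (\int[nu]_w C w + (e ^+ 2)%:E))).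
  have CE0 : 0 <= \int[nu]_w C w + (e ^+ 2)%:E by rewrite adde_ge0// lee_fin sqr_ge0.
  rewrite lee_sqrt// (L2sq_sections mH1 mH2).
  apply: (@le_trans _ _ (\int[nu]_w (C w + (e ^+ 2)%:E))).
    apply: ge0_le_integral => //.
    - by move=> w _; exact: L2sq_ge0.
    - exact: measurable_L2sq_sections.
    - by apply: emeasurable_funD => //; exact: measurable_cst.
    - by move=> w _; exact: sP.
  rewrite ge0_integralD//; last by move=> w _; rewrite lee_fin sqr_ge0.
  by rewrite leeD2l// integral_cst// [X in _ * X]probability_setT mule1.
move: W0; rewrite -/C; case: (\int[nu]_w C w) => [x|_|//]; last by rewrite /= leey.
rewrite lee_fin => x0; rewrite -EFinD /= lee_fin.
rewrite -[leRHS]ger0_norm; last by rewrite addr_ge0 ?sqrtr_ge0// ltW.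
rewrite -sqrtr_sqr ler_sqrt ?sqr_ge0// sqrrD sqr_sqrtr// -addrA lerD2l lerDr.
by rewrite mulrn_wge0// mulr_ge0 ?sqrtr_ge0// ltW.
Qed.

End representation.

(** * Quotient of a pseudometric *)

Section quotient_metric.
Context {R : realType} {T : Type} (D : T -> T -> R).
Hypothesis D0 : forall x, D x x = 0%R.
Hypothesis DC : forall x y, D x y = D y x.
Hypothesis Dtri : forall y x z, (D x z <= D x y + D y z)%R.

Let D_eq x x' y : D x x' = 0%R -> D x y = D x' y.
Proof. by move=> xx'; have := Dtri x' x y; have := Dtri x x' y; rewrite (DC x' x) xx'; lra. Qed.

(* The points of the quotient are the classes of the relation [D x y = 0]. *)
Let Q := {C : set T | exists x, C = [set y | D x y = 0%R]}.

Let pi (x : T) : Q := exist _ [set y | D x y = 0%R] (ex_intro _ x erefl).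

Let rep (q : Q) : T := sval (cid (svalP q)).

Let repE (q : Q) : sval q = [set y | D (rep q) y = 0%R].
Proof. exact: svalP (cid (svalP q)). Qed.

Let Q_eq (q q' : Q) : sval q = sval q' -> q = q'.
Proof.
case: q q' => [C hC] [C' hC'] /= CC'; subst C'.
by congr exist; exact: Prop_irrelevance.
Qed.

Let pi_rep (q : Q) : pi (rep q) = q.
Proof. by apply: Q_eq; exact: (esym (repE q)). Qed.

Let rep_pi x : D (rep (pi x)) x = 0%R.
Proof.
have : (sval (pi x)) x by rewrite /= D0.
by rewrite repE.
Qed.

Let pi_eq x y : pi x = pi y <-> D x y = 0%R.
Proof.
split=> [/(congr1 (@proj1_sig _ _))/= H|xy].
  by have : [set z | D x z = 0%R] y by rewrite H /= D0.
by apply: Q_eq => /=; apply/seteqP; split => z /=; rewrite (D_eq z xy).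
Qed.

Let dist (q q' : Q) : R := D (rep q) (rep q').

Let distxx q : dist q q = 0%R. Proof. exact: D0. Qed.

Let dist_positivity q q' : dist q q' = 0%R -> q = q'.
Proof. by move=> /pi_eq; rewrite !pi_rep. Qed.

Let dist_sym q q' : dist q q' = dist q' q. Proof. exact: DC. Qed.

Let dist_triangle y x z : (dist x z <= dist x y + dist y z)%R.
Proof. exact: Dtri. Qed.

Lemma quotient_metric : exists (M : metricType R) (p : T -> M),
  [/\ forall m, exists x, p x = m, forall x y, p x = p y <-> D x y = 0%R &
      forall x y, mdist (p x) (p y) = D x y].
Proof.
pose Qe := gen_eqMixin Q; pose Qc := gen_choiceMixin Q.
pose C : choiceType := HB.pack Q Qe Qc.
pose m : isMetric R C := isMetric.Build R C distxx dist_positivity dist_sym dist_triangle.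
pose M : metricType R := HB.pack Q Qe Qc m.
exists M, pi; split.
- by move=> q; exists (rep q); exact: pi_rep.
- exact: pi_eq.
- move=> x y; change (D (rep (pi x)) (rep (pi y)) = D x y).
  by rewrite (D_eq _ (rep_pi x)) DC (D_eq _ (rep_pi y)) DC.
Qed.

End quotient_metric.

Lemma fast_cvgn (R : realType) (x : R^nat) (K : R) :
  (forall m, (x m.+1 - x m) ^+ 2 <= K * (4^-1) ^+ m)%R -> cvgn x.
Proof.
move=> xK; have K0 : (0 <= K)%R.
  by have := xK 0%N; rewrite expr0 mulr1; apply: le_trans; exact: sqr_ge0.
have -> : x = (fun n => x 0%N + series (telescope x) n)%R.
  by apply/funext => n; rewrite -eq_sum_telescope.
apply: is_cvgD; first exact: is_cvg_cst.
apply: normed_cvg.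
have h2 : (`|2^-1 : R| < 1)%R by rewrite ger0_norm// invf_lt1// ltr1n.
apply: (@series_le_cvg _ _ (geometric (Num.sqrt K) 2^-1)) => [m|m|m|].
- exact: normr_ge0.
- by rewrite /geometric /= mulr_ge0// ?sqrtr_ge0// exprn_ge0.
- rewrite /= -sqrtr_sqr /geometric /=.
  have -> : (Num.sqrt K * 2^-1 ^+ m = Num.sqrt (K * (4^-1) ^+ m))%R.
    rewrite sqrtrM//; congr (_ * _)%R.
    rewrite -[LHS]ger0_norm ?exprn_ge0// -sqrtr_sqr; congr Num.sqrt.
    rewrite -exprM mulnC exprM; congr (_ ^+ _)%R.
    by rewrite expr2 -invfM; congr (_^-1)%R; rewrite -natrM.
  rewrite ler_sqrt; first exact: xK.
  by rewrite mulr_ge0// exprn_ge0.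
- exact: is_cvg_geometric_series.
Qed.

(** * Convergence in L2 *)

Section ae_bounded.
Context {R : realType} {d} {T : measurableType d} (P : probability T R).

(** The sum of all [f m] has a finite integral, hence is almost everywhere finite, and it bounds
    each term. *)
Lemma ae_bounded (f : nat -> T -> R) (c : R) :
  (forall m, measurable_fun setT (f m)) -> (forall m z, 0 <= f m z)%R ->
  (forall m, \int[P]_z (f m z)%:E <= (c * 2^-1 ^+ m)%:E) ->
  {ae P, forall z, exists K, forall m, (f m z <= K)%R}.
Proof.
move=> mf f0 fc.
have mEf m : measurable_fun setT (EFin \o f m) by exact/measurable_EFinP.
have f0' m z : setT z -> 0 <= (EFin \o f m) z by move=> _; rewrite lee_fin.
have c0 : (0 <= c)%R.
  have := fc 0%N; rewrite expr0 mulr1 -lee_fin; apply: le_trans.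
  by apply: integral_ge0 => z _; rewrite lee_fin.
pose S z := \sum_(m <oo) (EFin \o f m) z.
have S0 z : 0 <= S z by apply: nneseries_ge0 => m _ _; rewrite lee_fin.
have mS : measurable_fun setT S by apply: ge0_emeasurable_sum => // m z _ _; rewrite lee_fin.
have Soo : \int[P]_z S z < +oo.
  rewrite /S integral_nneseries//.
  apply: (@le_lt_trans _ _ (2 * c)%:E); last exact: ltry.
  apply: lime_le.
    by apply: is_cvg_nneseries => m _ _; apply: integral_ge0 => z _; rewrite lee_fin.
  apply: nearW => N; apply: (@le_trans _ _ (\sum_(0 <= m < N) (c * 2^-1 ^+ m)%:E)).
    by apply: lee_sum => m _; exact: fc.
  rewrite sumEFin lee_fin -mulr_sumr mulrC ler_wpM2r//.
  have E : (\sum_(0 <= m < N) 2^-1 ^+ m = 2 - 2 * 2^-1 ^+ N :> R)%R.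
    elim: N => [|N ih]; first by rewrite big_geq// expr0 mulr1 subrr.
    by rewrite big_nat_recr//= ih exprS; field.
  by rewrite E gerBl mulr_ge0// exprn_ge0.
have : P.-integrable setT S.
  by apply/integrableP; split => //; under eq_integral do rewrite gee0_abs//.
move=> /(integrable_ae measurableT); apply: filterS => z /(_ Logic.I) Sfin.
exists (fine (S z)) => m; rewrite -lee_fin fineK//.
apply: (@le_trans _ _ (\sum_(0 <= i < m.+1) (f i z)%:E)).
  rewrite big_nat_recr//= leeDr// sume_ge0// => i _; by rewrite lee_fin.
by apply: nneseries_lim_ge => i _ _; rewrite lee_fin.
Qed.

End ae_bounded.

Lemma sqrte_leE (R : realType) (x : \bar R) (c : R) : (0 <= c)%R ->
  (sqrte x <= c%:E) = (x <= (c ^+ 2)%:E).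
Proof.
move=> c0; have -> : c%:E = sqrte (c ^+ 2)%:E by rewrite /= sqrtr_sqr ger0_norm.
by rewrite lee_sqrt// lee_fin sqr_ge0.
Qed.

Lemma cvg_sumr (R : realType) (I : Type) (r : seq I) (f : I -> R^nat) (l : I -> R) :
  (forall i, f i @ \oo --> l i) ->
  (\sum_(i <- r) f i m)%R @[m --> \oo] --> (\sum_(i <- r) l i)%R.
Proof.
move=> fl; elim: r => [|i r ih].
  under eq_fun do rewrite big_nil; rewrite big_nil; exact: cvg_cst.
by under eq_fun do rewrite big_cons; rewrite big_cons; exact: cvgD.
Qed.

Section fatou_ae.
Context {R : realType} {d} {T : measurableType d} (P : probability T R).

(** Setting [g] to 0 on the exceptional null set makes the lower bound hold everywhere, so Fatou's
    lemma applies. *)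
Lemma fatou_ae_le (f : nat -> T -> \bar R) (g : T -> \bar R) (c : \bar R) :
  (forall m, measurable_fun setT (f m)) -> (forall m z, 0 <= f m z) ->
  measurable_fun setT g -> (forall z, 0 <= g z) ->
  {ae P, forall z, g z <= limn_einf (f ^~ z)} ->
  (forall m, \int[P]_z f m z <= c) -> \int[P]_z g z <= c.
Proof.
move=> mf f0 mg g0 gf fc.
have einf0 z : 0 <= limn_einf (f ^~ z).
  rewrite limn_einf_lim; apply: lime_ge; first exact: is_cvg_einfs.
  by apply: nearW => m; apply: le_ereal_inf_tmp => _ [k _ <-].
have {}fc : limn_einf (fun m => \int[P]_z f m z) <= c.
  rewrite limn_einf_lim; apply: lime_le; first exact: is_cvg_einfs.
  apply: nearW => m; apply: le_trans (fc m).
  by apply: ereal_inf_lbound; exists m => /=.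
apply: le_trans fc; apply: (le_trans _ (fatou P measurableT mf _)) => //.
have [N [mN N0 Ngf]] := gf.
have mm : measurable_fun setT (fun w => w \in N).
  apply: (measurable_fun_bool true); rewrite setTI.
  by rewrite (_ : _ @^-1` _ = N)//; apply/seteqP; split => w /=; [move=> /set_mem|move=> /mem_set].
have <- : \int[P]_z (if z \in N then 0 else g z) = \int[P]_z g z.
  apply: ge0_ae_eq_integral => //.
  - by apply: measurable_fun_if => //; exact: measurable_funTS.
  - by move=> z _; case: ifP.
  - exists N; split => // z /= H; apply: contrapT => Nz; apply: H => _.
    by rewrite memNset.
apply: ge0_le_integral_sup => z; first by case: ifP.
case: ifPn => //; rewrite notin_setE => Nz.
by apply: contrapT => H; apply: Nz; exact: Ngf.
Qed.

End fatou_ae.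

Section L2_limits.
Context {R : realType} {n : nat} {d} {T : measurableType d} (P : probability T R).
Local Notation Rn := (n.-tuple R).

Lemma cvg_edist2 (x : nat -> Rn) (y l : Rn) :
  (forall i, tnth (x m) i @[m --> \oo] --> tnth l i) ->
  (edist2 y (x m))%:E @[m --> \oo] --> (edist2 y l)%:E.
Proof.
move=> xl; apply: cvg_EFin; first exact: nearW.
apply: (cvg_sumr _ (f := fun i m => (tnth y i - tnth (x m) i) ^+ 2)%R) => i.
have h : (tnth y i - tnth (x m) i)%R @[m --> \oo] --> (tnth y i - tnth l i)%R.
  by apply: cvgB; [exact: cvg_cst|exact: xl].
exact: (cvgM h h).
Qed.

Lemma L2sq_lim_le (F : nat -> T -> Rn) (G H : T -> Rn) (c : \bar R) :
  (forall m, measurable_fun setT (F m)) -> measurable_fun setT G ->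
  measurable_fun setT H ->
  {ae P, forall z, forall i, tnth (F m z) i @[m --> \oo] --> tnth (H z) i} ->
  (forall m, L2sq P G (F m) <= c) -> L2sq P G H <= c.
Proof.
move=> mF mG mH FH Fc.
apply: (@fatou_ae_le _ _ _ _ (fun m z => (edist2 (G z) (F m z))%:E)) => //.
- by move=> m; apply/measurable_EFinP; exact: measurable_edist2.
- by move=> m z; rewrite lee_fin edist2_ge0.
- by apply/measurable_EFinP; exact: measurable_edist2.
- by move=> z; rewrite lee_fin edist2_ge0.
- apply: filterS FH => z Fz.
  by rewrite (cvg_limn_einf_sup (@cvg_edist2 (fun m => F m z) (G z) (H z) Fz)).1.
Qed.

(** Half of the decay in mean is spent on summability: multiplied by [w ^+ m], the integrals still
    decay like [2^-m], which leaves the pointwise rate [w^-m]. *)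
Lemma weighted_ae_bounded (F G : nat -> T -> Rn) (c : R) (w : R) :
  (forall m, measurable_fun setT (F m)) -> (forall m, measurable_fun setT (G m)) ->
  (0 < w)%R ->
  (forall m, L2sq P (F m) (G m) <= (c * (w^-1 / 2) ^+ m)%:E) ->
  {ae P, forall z, exists K, forall m, (edist2 (F m z) (G m z) <= K * w^-1 ^+ m)%R}.
Proof.
move=> mF mG w0 FG.
have wm m : (0 < w ^+ m)%R by rewrite exprn_gt0.
have := @ae_bounded _ _ _ P (fun m z => w ^+ m * edist2 (F m z) (G m z))%R c.
case=> [m|m z|m|].
- by apply: measurable_funM => //; exact: measurable_edist2.
- by rewrite mulr_ge0// ?edist2_ge0// ltW.
- under eq_integral do rewrite EFinM.
  rewrite ge0_integralZl//.
  + apply: (@le_trans _ _ ((w ^+ m)%:E * (c * (w^-1 / 2) ^+ m)%:E)).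
      by apply: lee_wpmul2l; [rewrite lee_fin ltW|exact: FG].
    have E : (w ^+ m * (w^-1 / 2) ^+ m = 2^-1 ^+ m :> R)%R.
      by rewrite -exprMn mulrA divff ?mul1r// gt_eqF.
    by rewrite -EFinM lee_fin mulrCA E.
  + by apply/measurable_EFinP; exact: measurable_edist2.
  + by move=> z _; rewrite lee_fin edist2_ge0.
  + by rewrite lee_fin ltW.
move=> N [mN N0 NH]; exists N; split => // z /= H; apply: NH => /= -[K HK].
by apply: H; exists K => m; rewrite exprVn ler_pdivlMr// mulrC.
Qed.

Lemma fast_ae_cvg (F : nat -> T -> Rn) (H : T -> Rn) :
  (forall m, measurable_fun setT (F m)) -> measurable_fun setT H ->
  (forall m, L2sq P (F m) H <= ((2^-1 / 2) ^+ m)%:E) ->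
  {ae P, forall z, forall i, tnth (F m z) i @[m --> \oo] --> tnth (H z) i}.
Proof.
move=> mF mH FH.
have := @weighted_ae_bounded F (fun=> H) 1 2 mF (fun=> mH).
case=> // [m|]; first by rewrite mul1r.
move=> N [mN N0 NH]; exists N; split => // z /= H'; apply: NH => /= -[K HK].
apply: H' => i; apply/cvgrPdist_lt => e e0.
have g0 : (geometric K 2^-1 : R^nat) @ \oo --> (0 : R)%R.
  by apply: cvg_geometric; rewrite ger0_norm// invf_lt1// ltr1n.
have e20 : (0 < e ^+ 2)%R by rewrite exprn_gt0.
move/cvgrPdist_lt : g0 => /(_ _ e20); apply: filterS => m.
rewrite sub0r normrN => /(le_lt_trans (ler_norm _)) Ke.
rewrite -(@ltr_pXn2r _ 2)// ?nnegrE// ?ltW// real_normK ?num_real//.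
apply: le_lt_trans Ke; apply: le_trans (HK m).
rewrite /edist2 (bigD1 i)//= -[leLHS]sqrrN opprB lerDl.
by apply: sumr_ge0 => j _; exact: sqr_ge0.
Qed.

(** Geometric sum with [8 / 3 = 2 / (1 - 1/4)], kept exact so that the induction closes. *)
Lemma L2_fast_cauchy (F : nat -> T -> Rn) :
  (forall m, measurable_fun setT (F m)) ->
  (forall m, sqrte (L2sq P (F m) (F m.+1)) <= (2 * (4^-1) ^+ m)%:E) ->
  forall m k, sqrte (L2sq P (F m) (F (m + k)%N)) <=
    (8 / 3 * ((4^-1) ^+ m - (4^-1) ^+ (m + k)))%:E.
Proof.
move=> mF FS m; elim=> [|k ih].
  by rewrite addn0 subrr mulr0 L2sqxx sqrte0.
apply: (le_trans (L2_triangle P (mF m) (mF (m + k)%N) (mF (m + k.+1)%N))).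
apply: (le_trans (leeD ih _)); first by rewrite addnS; exact: FS.
by rewrite -EFinD lee_fin addnS exprS; set x := ((4^-1) ^+ (m + k))%R; lra.
Qed.

(** The squared steps are at most [4 * 16^-m], below the [4 * (4^-1 / 2)^m] needed for pointwise
    increments of squared size [K * 4^-m]. Hence the coordinates converge almost everywhere, and
    Fatou's lemma passes the Cauchy bound, [8 / 3] rounded up to 3, to the limit. *)
Lemma L2_fast_limit (F : nat -> T -> Rn) :
  (forall m, measurable_fun setT (F m)) ->
  (forall m, sqrte (L2sq P (F m) (F m.+1)) <= (2 * (4^-1) ^+ m)%:E) ->
  exists2 H, measurable_fun setT H &
    forall m, sqrte (L2sq P (F m) H) <= (3 * (4^-1) ^+ m)%:E.
Proof.
move=> mF FS.
have p4 m : (0 <= 4^-1 ^+ m :> R)%R by rewrite exprn_ge0.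
(* The superior limit is measurable and defined everywhere, and it is the limit wherever there is
   one. *)
pose H z : Rn := [tuple fine (limn_esup (fun m => (tnth (F m z) i)%:E)) | i < n].
have mH : measurable_fun setT H.
  apply/measurable_fun_tnthP => i.
  rewrite (_ : _ \o H = fine \o (fun z => limn_esup (fun m => (tnth (F m z) i)%:E))); last first.
    by apply/funext => z /=; rewrite tnth_mktuple.
  apply: measurableT_comp; first exact: fine_measurable.
  apply: measurable_fun_limn_esup => m; apply/measurable_EFinP.
  by have /measurable_fun_tnthP := mF m; exact.
exists H => // m.
have FH : {ae P, forall z, forall i, tnth (F (m + k)%N z) i @[k --> \oo] --> tnth (H z) i}.
  have := @weighted_ae_bounded F (fun m => F m.+1) 4 4 mF (fun m => mF m.+1).
  case=> // [k|].
    have := FS k; rewrite sqrte_leE ?mulr_ge0//; move=> FSk.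
    apply: (le_trans FSk) => /=.
    rewrite lee_fin exprMn -natrX; apply: ler_wpM2l => //.
    rewrite -exprM mulnC exprM; apply: lerXn2r; rewrite ?nnegrE//; lra.
  move=> N [mN N0 NH]; exists N; split => // z /= H'; apply: NH => /= -[K HK].
  apply: H' => i; rewrite tnth_mktuple.
  have : cvgn (fun k => tnth (F k z) i).
    apply: (@fast_cvgn _ _ K) => k; apply: le_trans (HK k).
    rewrite /edist2 (bigD1 i)//= -[leLHS]sqrrN opprB lerDl.
    by apply: sumr_ge0 => j _; exact: sqr_ge0.
  move=> /cvg_ex[l Fl].
  have Fl' : (tnth (F k z) i)%:E @[k --> \oo] --> l%:E.
    by apply: cvg_EFin => //; exact: nearW.
  rewrite (cvg_limn_einf_sup Fl').2 /=.
  rewrite (_ : (fun k => _) = (fun k => (fun k => tnth (F k z) i) (k + m)%N)).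
    by rewrite (cvg_shiftn m (fun k => tnth (F k z) i)).
  by apply/funext => k; rewrite addnC.
rewrite sqrte_leE ?mulr_ge0//.
apply: (L2sq_lim_le _ _ _ FH) => // k.
rewrite -sqrte_leE ?mulr_ge0//.
apply: (le_trans (L2_fast_cauchy mF FS m k)).
rewrite lee_fin; have := p4 m; have := p4 (m + k)%N.
by set x := ((4^-1) ^+ _)%R; set y := ((4^-1) ^+ _)%R; lra.
Qed.

End L2_limits.

(** * Open orthants generate the Borel sets *)

Section orthants.
Context {R : realType} {n : nat}.
Local Notation Rn := (n.-tuple R).

Definition orthant (a : Rn) : set Rn := [set x | forall i, (tnth x i < tnth a i)%R].

Lemma measurable_orthant a : measurable (orthant a).
Proof.
have -> : orthant a = \bigcap_(i in [set: 'I_n]) [set x : Rn | (tnth x i < tnth a i)%R].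
  by apply/seteqP; split => [x xa i _|x xa i]; [exact: xa|exact: (xa i)].
apply: fin_bigcap_measurable; first exact: finite_finset.
move=> i _; rewrite -[X in measurable X]setTI -preimage_itvNyo.
exact: (measurable_tnth i).
Qed.

(** The half-space where the [i]-th coordinate is below [t] is the union over [m] of the orthants
    bounded by [t] in that coordinate and by [m] in the others. *)
Lemma measurable_orthantE : @measurable _ Rn = <<s [set orthant a | a in [set: Rn]] >>.
Proof.
set G := [set orthant a | a in [set: Rn]].
apply/seteqP; split; last first.
  apply: smallest_sub; first exact: sigma_algebra_measurable.
  by move=> _ [a _ <-]; exact: measurable_orthant.
have mi : measurable_fun setT (fun x : g_sigma_algebraType G => x : Rn).
  apply/measurable_fun_tnthP => i.
  apply: (measurability _ (RGenInftyO.measurableE R)) => _ [_ [t ->] <-].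
  rewrite setTI (_ : _ @^-1` _ = \bigcup_m
      orthant [tuple if j == i then t else m%:R | j < n]).
    by apply: bigcupT_measurable => m; apply: sub_sigma_algebra; eexists.
  apply/seteqP; split => x /=; rewrite in_itv/=; last first.
    by move=> [m _ /(_ i)]; rewrite tnth_mktuple eqxx.
  move=> xt; have [M xM] : exists M : nat, forall j, (tnth x j < M%:R)%R.
    exists (\sum_(j < n) (Num.truncn `|tnth x j|).+1)%N => j.
    rewrite (le_lt_trans (ler_norm _))// (lt_le_trans (truncnS_gt _))// ler_nat.
    by rewrite (bigD1 j)//= leq_addr.
  exists M => // j; rewrite tnth_mktuple; case: eqP => [->//|_]; exact: xM.
by move=> A mA; have := mi measurableT A mA; rewrite setTI.
Qed.

Lemma setI_closed_orthant : setI_closed [set orthant a | a in [set: Rn]].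
Proof.
move=> _ _ [a _ <-] [b _ <-]; exists [tuple Num.min (tnth a i) (tnth b i) | i < n] => //.
apply/seteqP; split => x /=.
  by move=> H; split => i; have := H i; rewrite tnth_mktuple lt_min => /andP[].
by move=> [xa xb] i; rewrite tnth_mktuple lt_min xa xb.
Qed.

End orthants.

(** * The metric space P2nu *)

Section metric_axioms.
Context {R : realType} {d : nat}.
Local Notation Rd := (d.-tuple R).
Local Notation origin := [tuple 0%R | i < d].
Variable nu : probability Rd R.
Local Notation Q := (nu \x (@lam R)).
Implicit Types (mu : P2nu nu) (H : Rd * R -> Rd).

Lemma measurable_origin : measurable_fun setT (cst origin : Rd * R -> Rd).
Proof. exact: measurable_cst. Qed.

Lemma L2sq_fin_num H1 H2 : measurable_fun setT H1 -> measurable_fun setT H2 ->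
  L2sq Q H1 (cst origin) < +oo -> L2sq Q H2 (cst origin) < +oo ->
  L2sq Q H1 H2 < +oo.
Proof.
move=> m1 m2 h1 h2.
apply: (le_lt_trans (L2sq_le Q m1 measurable_origin m2 ltr01)).
rewrite lte_add_pinfty// lte_mul_pinfty ?lee_fin ?addr_ge0 ?invr_ge0//.
by rewrite L2sqC.
Qed.

Lemma W2nu_ge0 mu1 mu2 : 0 <= W2nu mu1 mu2.
Proof. exact: sqrte_ge0. Qed.

Lemma W2nu_fin_num mu1 mu2 : W2nu mu1 mu2 \is a fin_num.
Proof.
have [H1 r1] := representation_exists mu1; have [H2 r2] := representation_exists mu2.
have [m1 _] := r1; have [m2 _] := r2.
rewrite ge0_fin_numE ?W2nu_ge0//; apply: (le_lt_trans (W2nu_le r1 r2)).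
rewrite -ge0_fin_numE ?sqrte_ge0// sqrte_fin_num ?L2sq_ge0//.
rewrite ge0_fin_numE ?L2sq_ge0//.
by apply: L2sq_fin_num => //; [exact: represents_moment r1|exact: represents_moment r2].
Qed.

Lemma W2nu_same mu1 mu2 : same_measure mu1 mu2 -> W2nu mu1 mu2 = 0.
Proof.
move=> mu12; have [H r1] := representation_exists mu1.
have r2 : represents mu2 H.
  by have [mH HE] := r1; exists mH => C mC; rewrite -mu12// HE.
apply/eqP; rewrite eq_le W2nu_ge0 andbT.
by rewrite (le_trans (W2nu_le r1 r2))// L2sqxx sqrte0.
Qed.

Lemma W2nu_sym_le mu1 mu2 : W2nu mu2 mu1 <= W2nu mu1 mu2.
Proof.
have [H1 r1] := representation_exists mu1.
apply/lee_addgt0Pr => e e0; have [H2 r2] := W2nu_approx mu2 r1 e0.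
by apply: le_trans; rewrite L2sqC; exact: W2nu_le.
Qed.

Lemma W2nuC mu1 mu2 : W2nu mu1 mu2 = W2nu mu2 mu1.
Proof. by apply/le_anti/andP; split; exact: W2nu_sym_le. Qed.

(** [H2] is chosen near [H1], then [H3] near [H2]: both estimates share [H2], so the triangle
    inequality of L2 applies. *)
Lemma W2nu_triangle mu2 mu1 mu3 : W2nu mu1 mu3 <= W2nu mu1 mu2 + W2nu mu2 mu3.
Proof.
have [H1 r1] := representation_exists mu1.
apply/lee_addgt0Pr => e e0; have e20 : (0 < e / 2)%R by rewrite divr_gt0.
have [H2 r2 h12] := W2nu_approx mu2 r1 e20.
have [H3 r3 h23] := W2nu_approx mu3 r2 e20.
have [m1 _] := r1; have [m2 _] := r2; have [m3 _] := r3.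
apply: (le_trans (W2nu_le r1 r3)); apply: (le_trans (L2_triangle Q m1 m2 m3)).
apply: (le_trans (leeD h12 h23)).
by rewrite addeACA -EFinD -splitr.
Qed.

(* Orthants are open, so that Fatou's lemma compares the measures of orthants along
   an almost everywhere convergent sequence of representations. *)
Lemma orthant_le mu1 mu2 a B : measurable B -> W2nu mu1 mu2 = 0 ->
  mu1 (orthant a `*` B) <= mu2 (orthant a `*` B).
Proof.
move=> mB mu12; have [H r1] := representation_exists mu1; have [mH HE] := r1.
have p2 m : (0 < 2^-1 ^+ m :> R)%R by rewrite exprn_gt0.
(* The infimum 0 need not be attained: representations of [mu2] at distance at most [2^-m] from [H]
   are taken instead, fast enough to converge to [H] almost everywhere. *)
have /choice[F FP] m : exists F, represents mu2 F /\
    sqrte (L2sq Q H F) <= (2^-1 ^+ m)%:E.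
  have [F rF] := W2nu_approx mu2 r1 (p2 m).
  by rewrite mu12 add0e => FH; exists F.
have mF m : measurable_fun setT (F m) by have [[]] := FP m.
have FH m : L2sq Q (F m) H <= ((2^-1 / 2) ^+ m)%:E.
  have [_] := FP m; rewrite (sqrte_leE _ (ltW (p2 m))) L2sqC => h.
  by apply: (le_trans h); rewrite lee_fin -exprM mulnC exprM expr2.
have cvgF := fast_ae_cvg mF mH FH.
have mS : measurable (orthant a `*` B) by apply: measurableX => //; exact: measurable_orthant.
have ind (K : Rd * R -> Rd) (mK : measurable_fun setT K) mu : represents mu K ->
    \int[Q]_z (\1_(orthant a `*` B) (K z, z.1))%:E = mu (orthant a `*` B).
  move=> [mK' KE]; rewrite (KE _ mS) [RHS]lawE.
  transitivity (\int[Q]_z (\1_((fun z => (K z, z.1)) @^-1` (orthant a `*` B)) z)%:E).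
    by apply: eq_integral => z _; rewrite !indicE; congr (_%:R)%:E; apply/idP/idP; rewrite !inE.
  rewrite integral_indic ?setIT//.
  by have := measurable_graph mK measurableT mS; rewrite setTI.
have mind (K : Rd * R -> Rd) : measurable_fun setT K ->
    measurable_fun setT (fun z => (\1_(orthant a `*` B) (K z, z.1) : R)%:E).
  move=> mK; have m1 : measurable_fun setT (\1_(orthant a `*` B) : Rd * Rd -> R).
    exact: measurable_indic.
  by have /measurable_EFinP := measurableT_comp m1 (measurable_graph mK).
rewrite -(ind _ mH _ r1).
apply: (@fatou_ae_le _ _ _ Q (fun m z => (\1_(orthant a `*` B) (F m z, z.1))%:E)).
- by move=> m; exact: mind.
- by move=> m z; rewrite lee_fin.
- exact: mind.
- by move=> z; rewrite lee_fin.
- apply: filterS cvgF => z Fz.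
  have [zS|zS] := pselect ((orthant a `*` B) (H z, z.1)); last first.
    rewrite indicE memNset//= limn_einf_lim; apply: lime_ge; first exact: is_cvg_einfs.
    by apply: nearW => m; apply: le_ereal_inf_tmp => _ [k _ <-]; rewrite lee_fin.
  rewrite indicE mem_set//= (cvg_limn_einf_sup (l := 1) _).1//.
  apply: cvg_near_cst.
  have [Ha zB] := zS.
  have : \forall m \near \oo, forall i, (tnth (F m z) i < tnth a i)%R.
    apply: filter_forall => i; have /cvgrPdist_lt := Fz i.
    have e0 : (0 < tnth a i - tnth (H z) i)%R by rewrite subr_gt0; exact: Ha.
    move=> /(_ _ e0); apply: filterS => m; rewrite distrC => /(le_lt_trans (ler_norm _)).
    by rewrite ltrD2r.
  by apply: filterS => m Fm; rewrite indicE mem_set.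
- move=> m; have [rF _] := FP m; by rewrite (ind _ (mF m) _ rF).
Qed.

Lemma W2nu_eq0 mu1 mu2 : W2nu mu1 mu2 = 0 -> same_measure mu1 mu2.
Proof.
move=> mu12; rewrite /same_measure.
apply: (prob_eq_gen measurable_orthantE setI_closed_orthant) => [B mB|_ B [a _ <-] mB].
  rewrite -(_ : snd @^-1` B = setT `*` B); last by apply/seteqP; split => -[x y] //= [].
  exact: etrans (P2nu_marginal mu1 mB) (esym (P2nu_marginal mu2 mB)).
apply/le_anti/andP; split; apply: orthant_le => //.
exact: (etrans (W2nuC mu2 mu1) mu12).
Qed.

Lemma represents_of H : measurable_fun setT H -> L2sq Q H (cst origin) < +oo ->
  exists mu, represents mu H.
Proof.
move=> mH Hoo; pose m := noise_law nu mH.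
have m1 B : measurable B -> pushforward m snd B = nu B.
  move=> mB; rewrite /pushforward (_ : snd @^-1` B = setT `*` B); last first.
    by apply/seteqP; split => -[x y] //= [].
  rewrite /m noise_lawE//.
  rewrite (eq_integral (cst 1)); first by rewrite integral_cst// mul1e.
  by move=> w _; exact: probability_setT.
have m2 : \int[m]_p (enorm2 p.1)%:E < +oo.
  apply: le_lt_trans Hoo.
  have mf : measurable_fun setT (@fst Rd Rd) by exact: measurable_fst.
  have mo : measurable_fun setT (cst origin : Rd * Rd -> Rd) by exact: measurable_cst.
  rewrite -(L2sq_law Q (measurable_graph mH) mf mo).
  by rewrite le_eqVlt; apply/orP; left; apply/eqP; apply: eq_integral => p _; rewrite enorm2E.
by exists (Build_P2nu m1 m2), mH.
Qed.

Lemma W2nu_fast_limit (mu : nat -> P2nu nu) :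
  (forall m, W2nu (mu m) (mu m.+1) <= (4^-1 ^+ m)%:E) ->
  exists l, forall m, W2nu (mu m) l <= (3 * 4^-1 ^+ m)%:E.
Proof.
move=> muS.
have p4 m : (0 < 4^-1 ^+ m :> R)%R by rewrite exprn_gt0.
pose X m := {H | represents (mu m) H}.
(* Each representation is chosen from the previous one; the factor 2 is the distance plus an equal
   slack. *)
have step m (x : X m) : {y : X m.+1 | sqrte (L2sq Q (sval x) (sval y)) <= (2 * 4^-1 ^+ m)%:E}.
  apply: cid; have [H2 r2 h] := W2nu_approx (mu m.+1) (svalP x) (p4 m).
  exists (exist _ H2 r2); apply: (le_trans h).
  by rewrite mulr2n mulrDl mul1r EFinD leeD2r.
have [H0 r0] := cid (representation_exists (mu 0%N)).
pose G := fix G m : X m := if m is k.+1 then sval (step k (G k)) else exist _ H0 r0.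
pose F m := sval (G m).
have rF m : represents (mu m) (F m) by exact: svalP (G m).
have mF m : measurable_fun setT (F m) by have [] := rF m.
have FS m : sqrte (L2sq Q (F m) (F m.+1)) <= (2 * 4^-1 ^+ m)%:E.
  exact: svalP (step m (G m)).
have [H mH FH] := L2_fast_limit mF FS.
have Hoo : L2sq Q H (cst origin) < +oo.
  apply: (le_lt_trans (L2sq_le Q mH (mF 0%N) measurable_origin ltr01)).
  rewrite lte_add_pinfty// lte_mul_pinfty ?lee_fin ?addr_ge0 ?invr_ge0//.
    have s0 : (0 <= 3 * 4^-1 ^+ 0 :> R)%R by rewrite mulr_ge0// ltW.
    rewrite L2sqC; have := FH 0%N; rewrite (sqrte_leE _ s0) => h.
    by rewrite (le_lt_trans h)// ltry.
  exact: represents_moment (rF 0%N).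
have [l rl] := represents_of mH Hoo.
by exists l => m; apply: (le_trans (W2nu_le (rF m) rl)).
Qed.

(** Coding [(w, u)] by a real turns L2 of the product into L2 of a law on the line, where the step
    functions [vstep S] are dense. *)
Lemma W2nu_separable : exists2 mu_ : d.-tuple (seq (rat * rat)) -> P2nu nu, True &
  forall mu (e : R), (0 < e)%R -> exists S, W2nu mu (mu_ S) < e%:E.
Proof.
have [phi [psi [mphi mpsi phiK _]]] := @encodable_tupleX R d.
pose g S : Rd * R -> Rd := vstep S \o phi.
have mg S : measurable_fun setT (g S) by apply: measurableT_comp mphi; exact: measurable_vstep.
have o_oo : L2sq Q (cst origin) (cst origin) < +oo by rewrite L2sqxx ltry.
have [mu0 _] := represents_of measurable_origin o_oo.
(* The default [mu0] makes the family total. It is not taken for the [S] found below, since [g S] is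
   square-integrable by its nearness to [H]. *)
pose mu_ S := if pselect (exists mu, represents mu (g S)) is left h then sval (cid h) else mu0.
exists mu_ => // mu e e0; have [H rH] := representation_exists mu; have [mH _] := rH.
have Hoo := represents_moment rH.
pose e2 := (e / 2)%R; have e20 : (0 < e2)%R by rewrite divr_gt0.
have e22 : (0 < e2 ^+ 2)%R by rewrite exprn_gt0.
have mHpsi : measurable_fun setT (H \o psi) by exact: measurableT_comp.
have phiE f : measurable_fun setT f ->
    L2sq (law Q mphi) (H \o psi) f = L2sq Q H (f \o phi) :> \bar R.
  move=> mf; rewrite L2sq_law//; apply: eq_integral => z _ /=.
  by rewrite phiK.
have [|S SP] := @vstep_dense _ _ (law Q mphi) _ _ mHpsi _ e22.
  by rewrite phiE//; exact: measurable_cst.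
have {}SP : L2sq Q H (g S) < (e2 ^+ 2)%:E.
  by rewrite -phiE//; exact: measurable_vstep.
have goo : L2sq Q (g S) (cst origin) < +oo.
  apply: (le_lt_trans (L2sq_le Q (mg S) mH measurable_origin ltr01)).
  rewrite lte_add_pinfty// lte_mul_pinfty ?lee_fin ?addr_ge0 ?invr_ge0//.
  by rewrite L2sqC (lt_trans SP)// ltry.
have rS : represents (mu_ S) (g S).
  rewrite /mu_; case: pselect => [h|]; first exact: svalP (cid h).
  by move=> []; exact: represents_of.
exists S; apply: (le_lt_trans (W2nu_le rH rS)); apply: (@le_lt_trans _ _ e2%:E).
  by rewrite (sqrte_leE _ (ltW e20)) ltW.
by rewrite lte_fin /e2 ltr_pdivrMr// mulrDr mulr1 ltrDl.
Qed.

End metric_axioms.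

Theorem proposition3p4 (R : realType) (d : nat)
    (nu : probability (d.-tuple R) R) :
  exists (M : metricType R) (pi : P2nu nu -> M),
    [/\ is_metric_quotient (same_measure (nu := nu)) (W2nu (nu := nu)) pi,
        complete_space M & separable_space M].
Proof.
have D0 (x : P2nu nu) : fine (W2nu x x) = 0%R by rewrite W2nu_same.
have DC (x y : P2nu nu) : fine (W2nu x y) = fine (W2nu y x).
  by apply: congr1; exact: W2nuC.
have Dtri (y x z : P2nu nu) : (fine (W2nu x z) <= fine (W2nu x y) + fine (W2nu y z))%R.
  rewrite -fineD ?W2nu_fin_num//; apply: fine_le; last exact: W2nu_triangle.
    exact: W2nu_fin_num.
  by rewrite fin_numD !W2nu_fin_num.
have [M [p [p_surj p_eq p_dist]]] := quotient_metric D0 DC Dtri.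
have distE (x y : P2nu nu) : (W2nu x y = (mdist (p x) (p y))%:E)%E.
  by rewrite p_dist fineK ?W2nu_fin_num.
exists M, p; split.
- split => // x y; split=> [/p_eq xy|xy].
    by apply: W2nu_eq0; rewrite -[LHS]fineK ?W2nu_fin_num// xy.
  by apply/p_eq; rewrite W2nu_same.
- move=> F FF /cauchyP Fc.
  (* Balls of radius [4^-m / 8] that belong to the filter: consecutive ones meet, so their centers
     are less than [4^-m] apart, as [W2nu_fast_limit] requires. *)
  have e0 m : (0 < 4^-1 ^+ m / 8 :> R)%R by rewrite divr_gt0// exprn_gt0.
  have /choice[x xF] m := Fc _ (e0 m).
  have /choice[mu muE] m : exists mu, p mu = x m by exact: p_surj.
  have xx m : (mdist (x m) (x m.+1) < 4^-1 ^+ m)%R.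
    have [y [y1 y2]] : ball (x m) (4^-1 ^+ m / 8)%R `&` ball (x m.+1) (4^-1 ^+ m.+1 / 8)%R !=set0.
      exact: (filter_ex (filterI (xF m) (xF m.+1))).
    move: y1 y2; rewrite !ballEmdist/= => y1 y2.
    have := metric_triangle (x m) y (x m.+1); rewrite (metric_sym y).
    have := e0 m; move: y1 y2; rewrite exprS; set u := (4^-1 ^+ m)%R => *; lra.
  have [|l lP] := @W2nu_fast_limit R d nu mu.
    by move=> m; rewrite distE lee_fin !muE ltW.
  exists (p l) => A /nbhs_ballP[e /= e1 eA].
  (* A point of the [m]-th ball is within [3 * 4^-m + 4^-m / 8] of the limit, which is less than
     [4 * 4^-m]. *)
  have [m mP] : exists m, (4 * 4^-1 ^+ m < e :> R)%R.
    have g0 : (geometric 4 4^-1 : R^nat) @ \oo --> (0 : R)%R.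
      by apply: cvg_geometric; rewrite ger0_norm// invf_lt1// ltr1n.
    move/cvgrPdist_lt : g0 => /(_ _ e1)[m _ /(_ m (leqnn m))] /=.
    by rewrite sub0r normrN => /(le_lt_trans (ler_norm _)) h; exists m.
  apply: filterS (xF m) => y; rewrite ballEmdist/= => y1.
  apply: eA; rewrite ballEmdist/=.
  have := lP m; rewrite distE lee_fin muE => h.
  have := metric_triangle (p l) (x m) y; rewrite (metric_sym (p l) (x m)).
  have := e0 m; move: h y1 mP; set u := (4^-1 ^+ m)%R => *; lra.
- have [mu_ _ mu_d] := W2nu_separable nu.
  exists (range (p \o mu_)).
    by apply: (sub_countable (card_image_le _ _)); exact: countableP.
  move=> O [y Oy] oO; have [x xy] := p_surj y; subst y.
  have /nbhs_ballP[e /= e1 eO] := open_nbhs_nbhs (conj oO Oy).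
  have [S SP] := mu_d x e e1; exists (p (mu_ S)); split; last by exists S.
  by apply: eO; rewrite ballEmdist/= -lte_fin -distE.
Qed.
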